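(* Let $\Gamma$ be a finite connected metric graph with $V$ vertices and let $q:\Gamma\to\mathbb{R}$ be measurable and bounded with $q(x)\ge0$ for almost all $x\in\Gamma$. Let $-\Delta_{\Gamma,q}$ be any self-adjoint extension in $L^2(\Gamma)$ of the operator $S$ (the Schrödinger operator with potential $q$ and both Dirichlet and Kirchhoff conditions at all vertices), and let $d:=\dim\ker(-\Delta_{\Gamma,q})$. Then $$\lambda_{j+d}(-\Delta_{\Gamma,q})\le\lambda_j^+(-\Delta_{{\rm K},\Gamma,q})=\lambda_{j+V}(-\Delta_{{\rm K},\Gamma,q})$$ holds for all $j\in\mathbb{N}$. In particular, $$\lambda_j(-\Delta_{{\rm D},\Gamma,q})\le\lambda_j^+(-\Delta_{{\rm K},\Gamma,q})=\lambda_{j+V}(-\Delta_{{\rm K},\Gamma,q})$$ holds for all $j\in\mathbb{N}$, and in the potential-free case ($q=0$ identically) we have $$\lambda_{j+1}(-\Delta_{{\rm st},\Gamma})\le\lambda_j^+(-\Delta_{{\rm K},\Gamma})=\lambda_{j+V}(-\Delta_{{\rm K},\Gamma})$$ for all $j\in\mathbb{N}$.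
   Context: A finite metric graph $\Gamma$ consists of a finite vertex set $\mathcal{V}$, a finite nonempty edge set $\mathcal{E}$ (loops and multiple edges allowed) and a length function $\ell:\mathcal{E}\to(0,\infty)$; $V=|\mathcal{V}|$. Each edge $e$ is identified with $[0,\ell(e)]$, its two endpoints corresponding to the (possibly equal) vertices incident with $e$. A function $f$ on $\Gamma$ is a collection $(f_e)_{e\in\mathcal{E}}$ of functions $f_e:(0,\ell(e))\to\mathbb{C}$; $f\in L^2(\Gamma)$ means $f_e\in L^2(0,\ell(e))$ for all $e$. $\widetilde H^k(\Gamma)$ is the set of $f\in L^2(\Gamma)$ with $f_e\in H^k(0,\ell(e))$ for all $e$; $H^1(\Gamma)$ is the set of $f\in\widetilde H^1(\Gamma)$ that are continuous at each vertex (all traces at endpoints corresponding to the same vertex $v$ coincide; the common value is $f(v)$). For $f\in\widetilde H^2(\Gamma)$ and $v\in\mathcal{V}$, $\partial_\nu f(v)$ is the sum, over all edge endpoints located at $v$ (both endpoints of a loop at $v$ are counted), of the derivative of $f_e$ at that endpoint taken in the direction pointing towards $v$ (i.e. $f_e'(\ell(e))$ for the endpoint $\ell(e)$ and $-f_e'(0)$ for the endpoint $0$). All operators below act in $L^2(\Gamma)$ as $f\mapsto(-f_e''+q_ef_e)_{e\in\mathcal{E}}$. $S$ has domain $\{f\in\widetilde H^2(\Gamma)\cap H^1(\Gamma): f(v)=\partial_\nu f(v)=0\ \forall v\in\mathcal{V}\}$; it is closed, symmetric, densely defined with a positive lower bound. $S^*$ has domain $\widetilde H^2(\Gamma)\cap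 H^1(\Gamma)$. $-\Delta_{{\rm D},\Gamma,q}$ has domain $\{f\in\widetilde H^2(\Gamma)\cap H^1(\Gamma): f(v)=0\ \forall v\}$; $-\Delta_{{\rm st},\Gamma,q}$ has domain $\{f\in\widetilde H^2(\Gamma)\cap H^1(\Gamma):\partial_\nu f(v)=0\ \forall v\}$; the perturbed Krein Laplacian $-\Delta_{{\rm K},\Gamma,q}$ is the Krein–von Neumann extension of $S$, i.e. the self-adjoint restriction of $S^*$ to $\operatorname{dom}S\dotplus\ker S^*$. If $q=0$ identically the index $q$ is omitted. For a self-adjoint operator $A$ with purely discrete spectrum bounded from below (as is the case for every self-adjoint extension of $S$), $\lambda_1(A)\le\lambda_2(A)\le\dots$ are its eigenvalues and $\lambda_1^+(A)\le\lambda_2^+(A)\le\dots$ its positive eigenvalues, counted with multiplicities. *)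

(* Defs.v *)
From HB Require Import structures.
From mathcomp Require Import all_boot all_order all_algebra.
From mathcomp Require Import all_classical all_reals all_analysis.
From mathcomp Require Import measurable_realfun complex.

Set Implicit Arguments.
Unset Strict Implicit.
Unset Printing Implicit Defensive.

Import Order.TTheory GRing.Theory Num.Theory.
Import numFieldNormedType.Exports.

Local Open Scope classical_set_scope.
Local Open Scope complex_scope.
Local Open Scope ring_scope.

(* Finite metric graphs.  The edge e is identified with [0, len e], with 0
   located at src e and len e at tgt e.  The vertices and edges are arbitrary
   finite types, so loops and multiple edges are allowed.                     *)

Record metric_graph (R : realType) : Type := MetricGraph {
  vertex : finType;
  edge : finType;
  src : edge -> vertex;
  tgt : edge -> vertex;
  len : edge -> R;
  edge_nonempty : (0 < #|edge|)%N;
  len_gt0 : forall e, 0 < len e }.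

Definition adjacent (R : realType) (G : metric_graph R) : rel (vertex G) :=
  fun u v => [exists e : edge G,
    ((src e == u) && (tgt e == v)) || ((src e == v) && (tgt e == u))].

Definition connected_graph (R : realType) (G : metric_graph R) : Prop :=
  forall u v : vertex G, connect (@adjacent R G) u v.

(* Endpoints of edges: (e, false) is the endpoint 0 of e and (e, true) is the
   endpoint len e.  A loop has two distinct endpoints at the same vertex.     *)

Definition endpoint (R : realType) (G : metric_graph R) : finType :=
  (edge G * bool)%type.

Definition location (R : realType) (G : metric_graph R) (p : endpoint G)
  : vertex G := if p.2 then tgt p.1 else src p.1.

Definition coordinate (R : realType) (G : metric_graph R) (p : endpoint G)
  : R := if p.2 then len p.1 else 0.

(* Complex-valued functions on the interval (0, l); they are represented by
   total functions whose values outside the interval are never used.         *)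

Section Interval.
Variables (R : realType) (l : R).
Local Notation mu := (@lebesgue_measure R).
Implicit Types f g h : R -> R[i].

Definition ae_equal f g : Prop := ae_eq mu `]0, l[%classic f g.

Definition square_integrable f : Prop :=
  [/\ measurable_fun `]0, l[%classic (fun x => complex.Re (f x)),
      measurable_fun `]0, l[%classic (fun x => complex.Im (f x)) &
      mu.-integrable `]0, l[%classic
        (fun x => (complex.Re (f x) ^+ 2 + complex.Im (f x) ^+ 2)%:E)].

Definition cintegral f : R[i] :=
  (\int[mu]_(x in `]0, l[%classic) complex.Re (f x))
    +i* (\int[mu]_(x in `]0, l[%classic) complex.Im (f x)).

(* The functions of class C^1 with compact support in (0, l), extended by 0.
   These are Brezis' test functions for Sobolev spaces on an interval; they
   define the same weak derivatives as smooth ones.                           *)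
Definition test_function (phi : R -> R) : Prop :=
  [/\ forall x, derivable phi x 1,
      continuous (phi^`())%classic &
      exists a b, [/\ 0 < a, b < l &
        forall x, ~ (a <= x <= b) -> phi x = 0]].

Definition weak_derivative f g : Prop :=
  [/\ square_integrable f, square_integrable g &
      forall phi, test_function phi ->
        cintegral (fun x => f x * ((phi^`())%classic x)%:C)
        = - cintegral (fun x => g x * (phi x)%:C)].

Definition sobolev1 f : Prop := exists g, weak_derivative f g.

(* f', for f in H^1(0, l); unique up to equality almost everywhere.           *)
Definition wderiv f : R -> R[i] := xget 0 [set g | weak_derivative f g].

Definition sobolev2 f : Prop := sobolev1 f /\ sobolev1 (wderiv f).

Definition continuous_representative f h : Prop :=
  [/\ {within `[0, l]%classic, continuous (fun x => complex.Re (h x))},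
      {within `[0, l]%classic, continuous (fun x => complex.Im (h x))} & ae_equal f h].

(* The representative of f in H^1(0, l) which is continuous on [0, l]; its
   values on [0, l] are unique.                                               *)
Definition crep f : R -> R[i] := xget 0 [set h | continuous_representative f h].

End Interval.

Section Graph.
Variables (R : realType) (G : metric_graph R).

Definition gfun : Type := edge G -> R -> R[i].

Implicit Types f g u v k : gfun.

(* Elements of L^2(G) are represented by square integrable (Borel) functions,
   considered up to the relation eqae.                                        *)

Definition eqae f g : Prop := forall e, ae_equal (len e) (f e) (g e).

Definition L2 : set gfun := [set f | forall e, square_integrable (len e) (f e)].

Definition inner f g : R[i] :=
  \sum_(e : edge G) cintegral (len e) (fun x => f e x * ((g e x)^*)%C).

Definition norm2 f : R := Num.sqrt (complex.Re (inner f f)).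

Definition Htilde1 : set gfun := [set f | forall e, sobolev1 (len e) (f e)].

Definition Htilde2 : set gfun := [set f | forall e, sobolev2 (len e) (f e)].

Definition gderiv f : gfun := fun e => wderiv (len e) (f e).

Definition trace f (p : endpoint G) : R[i] :=
  crep (len p.1) (f p.1) (coordinate p).

Definition H1 : set gfun := [set f | Htilde1 f /\
  forall p p' : endpoint G, location p = location p' -> trace f p = trace f p'].

Definition vertex_value f (x : vertex G) (a : R[i]) : Prop :=
  forall p : endpoint G, location p = x -> trace f p = a.

(* The sum over all endpoints at x of the derivatives pointing towards x.     *)
Definition normal_derivative f (x : vertex G) : R[i] :=
  \sum_(p : endpoint G | location p == x)
    (if p.2 then trace (gderiv f) p else - trace (gderiv f) p).

(* Operators in L^2(G) are given by their graphs: A (f, g) means that f is in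
   the domain of A and that A f = g in L^2(G).  These graphs are unions of
   classes of eqae.                                                           *)

Definition operator : Type := set (gfun * gfun).

Implicit Type A : operator.

Definition dom A : set gfun := [set f | exists g, A (f, g)].

Definition ker A : set gfun := [set f | exists2 g, A (f, g) & eqae g 0].

Definition eigenspace A (mu : R) : set gfun :=
  [set f | exists2 g, A (f, g) & eqae g (mu%:C *: f)].

Definition linear_operator A : Prop :=
  [/\ forall f g, A (f, g) -> L2 f /\ L2 g,
      forall f g f' g', A (f, g) -> L2 f' -> L2 g' ->
        eqae f f' -> eqae g g' -> A (f', g'),
      A (0, 0),
      forall (a : R[i]) f g f' g',
        A (f, g) -> A (f', g') -> A (a *: f + f', a *: g + g') &
      forall f g g', A (f, g) -> A (f, g') -> eqae g g'].

Definition densely_defined A : Prop :=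
  forall f, L2 f -> forall eps : R, 0 < eps ->
    exists2 u, dom A u & norm2 (f - u) < eps.

Definition adjoint A : operator :=
  [set fg | [/\ L2 fg.1, L2 fg.2 &
    forall u v, A (u, v) -> inner v fg.1 = inner u fg.2]].

Definition self_adjoint A : Prop :=
  [/\ linear_operator A, densely_defined A & adjoint A = A].

(* The Krein-von Neumann extension of A: the restriction of the adjoint of A
   to dom A + ker (adjoint A).                                                *)
Definition krein_von_neumann A : operator :=
  [set fg | adjoint A fg /\
    exists u k, [/\ dom A u, ker (adjoint A) k & eqae fg.1 (u + k)]].

Definition has_dim (W : set gfun) (n : nat) : Prop :=
  exists b : 'I_n -> gfun,
    [/\ forall i, W (b i),
        forall c : 'I_n -> R[i],
          eqae (\sum_(i < n) c i *: b i) 0 -> forall i, c i = 0 &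
        forall f, W f ->
          exists c : 'I_n -> R[i], eqae f (\sum_(i < n) c i *: b i)].

Definition dimension (W : set gfun) : nat := xget 0%N [set n | has_dim W n].

(* lam 0 <= lam 1 <= ... is the list of all eigenvalues of A that belong to P,
   each one repeated according to its (finite) multiplicity.  For a
   self-adjoint A all eigenvalues are real, and such a list is unique.        *)
Definition eigenvalue_list (P : set R) A (lam : nat -> R) : Prop :=
  [/\ nondecreasing_seq lam,
      forall j, P (lam j) &
      forall mu, P mu -> exists2 n, has_dim (eigenspace A mu) n &
        ([set j | lam j = mu] #= `I_n)%card].

(* The j-th eigenvalue and the j-th positive eigenvalue; the numbering starts
   at j = 1.                                                                  *)
Definition lambda (j : nat) A : R :=
  xget 0 [set lam | eigenvalue_list setT A lam] j.-1.

Definition lambda_pos (j : nat) A : R :=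
  xget 0 [set lam | eigenvalue_list [set x | 0 < x] A lam] j.-1.

End Graph.

Section Schroedinger.
Variables (R : realType) (G : metric_graph R) (q : edge G -> R -> R).

(* Lebesgue measurability, i.e. with respect to the completion of the Borel
   sigma-algebra.                                                             *)
Definition measurable_potential : Prop := forall e,
  measurable_fun
    (`]0, len e[%classic : set (g_sigma_algebraType
                          (completed_algebra_gen (@lebesgue_measure R))))
    (q e).

Definition bounded_potential : Prop :=
  exists M : R, forall e x, 0 < x < len e -> `|q e x| <= M.

Definition nonnegative_potential : Prop := forall e,
  {ae @lebesgue_measure R, forall x, 0 < x < len e -> 0 <= q e x}.

(* The operator f |-> - f'' + q f with domain D, a subset of Htilde2.         *)
Definition schroedinger (D : set (gfun G)) : operator G :=
  [set fg | [/\ D fg.1, L2 fg.2 & eqae fg.2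
    (fun e x => - gderiv (gderiv fg.1) e x + (q e x)%:C * fg.1 e x)]].

Definition minimal_operator : operator G :=
  schroedinger [set f | [/\ Htilde2 f, H1 f &
    forall x, vertex_value f x 0 /\ normal_derivative f x = 0]].

Definition dirichlet_laplacian : operator G :=
  schroedinger [set f | [/\ Htilde2 f, H1 f & forall x, vertex_value f x 0]].

Definition standard_laplacian : operator G :=
  schroedinger [set f | [/\ Htilde2 f, H1 f &
    forall x, normal_derivative f x = 0]].

Definition krein_laplacian : operator G := krein_von_neumann minimal_operator.

End Schroedinger.

Definition zero_potential (R : realType) (G : metric_graph R)
  : edge G -> R -> R := fun _ _ => 0.
Arguments zero_potential {R} G.

(* Main.v *)
Require Import Defs.
From HB Require Import structures.
From mathcomp Require Import all_boot all_order all_algebra.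
From mathcomp Require Import all_classical all_reals all_analysis.
From mathcomp Require Import complex measurable_realfun.
From mathcomp Require Import ring lra.

Set Implicit Arguments.
Unset Strict Implicit.
Unset Printing Implicit Defensive.

Import Order.TTheory GRing.Theory Num.Theory.
Import numFieldNormedType.Exports.

Local Open Scope classical_set_scope.
Local Open Scope complex_scope.
Local Open Scope ring_scope.

(** Let K be the Krein-von Neumann extension of the minimal operator S and T
    the adjoint of S.  If K f = lam f with lam > 0, then f = u + k with u in the
    domain of S and k in the kernel of T, and S u = lam f.  Since S u is
    orthogonal to the kernel of T, the map f |-> u satisfies
    <S u, u> = <S u, f>.

    Let f_1, ..., f_j be orthonormal eigenfunctions of K for its first j
    positive eigenvalues lam_1 <= ... <= lam_j = mu, with corresponding
    u_1, ..., u_j, and let A be a self-adjoint extension of S whose kernel has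
    dimension d.  On the space E spanned by the u_i and the kernel of A, which
    has dimension j + d, every v = sum c_i u_i + k satisfies
    A v = sum c_i lam_i f_i, and A v is orthogonal to k.  Hence
    |A v|^2 = sum lam_i^2 |c_i|^2 and <A v, v> = sum lam_i |c_i|^2, so that
    |A v|^2 <= mu <A v, v>, which is the same as
    |(A - mu/2) v| <= (mu/2) |v| ([comparison_space]).  By the min-max principle
    for (A - mu/2)^2, the operator A has at least j + d eigenvalues in
    [0, mu]; the square is nonnegative, so that minima exist.  The min-max
    principle enters through [minimal_eigenfunction]: on the orthogonal
    complement of finitely many eigenfunctions the minimum of
    |(A - s) f| / |f| is attained at an eigenfunction.  It yields the
    eigenfunctions of A one by one ([extension_eigenfamily]), and also, with
    s = 0, the list of all eigenvalues of K ([exists_eigensequence],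
    [sequence_list]).

    The kernel of K is the kernel of T.  Its dimension is the number V of
    vertices, because the equation - F'' + q F = 0 has exactly one continuous
    solution with given vertex values ([maximal_kernel_dim]).  As K is
    nonnegative, its list of eigenvalues begins with exactly V zeros, which
    gives the equality of the two numberings.  The remaining statements are the
    cases of the Dirichlet operator, whose kernel is trivial, and of the standard
    operator with q = 0, whose kernel consists of the constants.

    The operator theory rests on an explicit description of H^2 on an edge.
    Functions in the Sobolev spaces are primitives of square integrable
    functions, by the lemma of du Bois-Reymond ([du_bois_reymond],
    [sobolev2P]); so an operator f |-> - f'' + q f is given by a condition on
    the values and normal derivatives at the endpoints ([bcop]).  By Green's
    identity the adjoint of such an operator is given by the symplectic
    complement of its condition ([adjoint_bcop]); this identifies T and shows
    that the Dirichlet and standard operators are self-adjoint.  The Poincare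
    inequality makes the Dirichlet operator, and with it S, coercive.
    Minimisers exist because the domains are compactly embedded
    ([bcop_compact]), which is proved by equicontinuity on the edges. *)

(** * Complex numbers by real and imaginary parts *)

Notation ReC := complex.Re.
Notation ImC := complex.Im.
Notation cj z := (conjc z).

Section ComplexParts.
Variable R : realType.
Implicit Types (a : R) (z w : R[i]).

Definition sqmod z : R := ReC z ^+ 2 + ImC z ^+ 2.

Lemma complex_eq z w : ReC z = ReC w -> ImC z = ImC w -> z = w.
Proof. by case: z w => [a b] [c d] /= -> ->. Qed.

Lemma cReD z w : ReC (z + w) = ReC z + ReC w. Proof. by case: z w => [a b] []. Qed.
Lemma cImD z w : ImC (z + w) = ImC z + ImC w. Proof. by case: z w => [a b] []. Qed.
Lemma cReN z : ReC (- z) = - ReC z. Proof. by case: z. Qed.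
Lemma cImN z : ImC (- z) = - ImC z. Proof. by case: z. Qed.
Lemma cReB z w : ReC (z - w) = ReC z - ReC w. Proof. by rewrite cReD cReN. Qed.
Lemma cImB z w : ImC (z - w) = ImC z - ImC w. Proof. by rewrite cImD cImN. Qed.
Lemma cReM z w : ReC (z * w) = ReC z * ReC w - ImC z * ImC w.
Proof. by case: z w => [a b] []. Qed.
Lemma cImM z w : ImC (z * w) = ReC z * ImC w + ImC z * ReC w.
Proof. by case: z w => [a b] [c d] /=; rewrite addrC; ring. Qed.
Lemma Re_cj z : ReC (cj z) = ReC z. Proof. by case: z. Qed.
Lemma Im_cj z : ImC (cj z) = - ImC z. Proof. by case: z. Qed.
Lemma Re_real a : ReC a%:C = a. Proof. by []. Qed.
Lemma Im_real a : ImC a%:C = 0. Proof. by []. Qed.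
Lemma Re0 : ReC (0 : R[i]) = 0. Proof. by []. Qed.
Lemma Im0 : ImC (0 : R[i]) = 0. Proof. by []. Qed.
Lemma Re1 : ReC (1 : R[i]) = 1. Proof. by []. Qed.
Lemma Im1 : ImC (1 : R[i]) = 0. Proof. by []. Qed.

Definition cpartsE := (cReB, cImB, cReD, cImD, cReN, cImN, cReM, cImM, Re_cj, Im_cj,
  Re_real, Im_real, Re0, Im0, Re1, Im1).

(** Multiply by i to recover the imaginary part from a real part; this
    reduces limits of inner products to limits of their real parts. *)
Lemma Re_mul_inj z w : (forall x : R[i], ReC (x * z) = ReC (x * w)) -> z = w.
Proof.
move=> h; apply: complex_eq; first by have := h 1; rewrite !mul1r.
by have := h 'i; rewrite !cReM/= !mul0r !sub0r !mul1r => /oppr_inj.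
Qed.

Lemma cjD z w : cj (z + w) = cj z + cj w. Proof. exact: rmorphD. Qed.
Lemma cjN z : cj (- z) = - cj z. Proof. exact: rmorphN. Qed.
Lemma cjM z w : cj (z * w) = cj z * cj w. Proof. exact: rmorphM. Qed.
Lemma cj_real a : cj a%:C = a%:C. Proof. exact: conjc_real. Qed.

Lemma Re_sum (I : Type) (r : seq I) (P : pred I) (F : I -> R[i]) :
  ReC (\sum_(i <- r | P i) F i) = \sum_(i <- r | P i) ReC (F i).
Proof. by apply: (big_morph _ cReD). Qed.
Lemma cj_sum (I : Type) (r : seq I) (P : pred I) (F : I -> R[i]) :
  cj (\sum_(i <- r | P i) F i) = \sum_(i <- r | P i) cj (F i).
Proof. by apply: (big_morph _ cjD); rewrite conjc0. Qed.

Lemma sqmod_ge0 z : 0 <= sqmod z.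
Proof. by rewrite addr_ge0 ?sqr_ge0. Qed.
Lemma sqmod_eq0 z : sqmod z = 0 -> z = 0.
Proof.
move=> h; have h1 := sqr_ge0 (ReC z); have h2 := sqr_ge0 (ImC z).
have hr : ReC z ^+ 2 = 0 by rewrite /sqmod in h; lra.
have hi : ImC z ^+ 2 = 0 by rewrite /sqmod in h; lra.
by apply: complex_eq; apply/eqP; rewrite -sqrf_eq0 ?hr ?hi.
Qed.
Lemma sqmodM z w : sqmod (z * w) = sqmod z * sqmod w.
Proof. by rewrite /sqmod !cpartsE; ring. Qed.
Lemma mul_cj z : z * cj z = (sqmod z)%:C.
Proof. by apply: complex_eq; rewrite /sqmod !cpartsE; ring. Qed.
Lemma sqmodN z : sqmod (- z) = sqmod z.
Proof. by rewrite /sqmod !cpartsE; ring. Qed.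
Lemma sqmod_real a : sqmod a%:C = a ^+ 2.
Proof. by rewrite /sqmod !cpartsE expr0n addr0. Qed.
Lemma Re_sqr_le_sqmod z : ReC z ^+ 2 <= sqmod z.
Proof. by rewrite lerDl sqr_ge0. Qed.
Lemma Im_sqr_le_sqmod z : ImC z ^+ 2 <= sqmod z.
Proof. by rewrite lerDr sqr_ge0. Qed.
Lemma sqmodD_le z w : sqmod (z + w) <= 2 * sqmod z + 2 * sqmod w.
Proof.
rewrite -subr_ge0.
have -> : 2 * sqmod z + 2 * sqmod w - sqmod (z + w) = sqmod (z - w).
  by rewrite /sqmod !cpartsE; ring.
exact: sqmod_ge0.
Qed.

End ComplexParts.

(** * Semi-inner products *)

Section SemiInner.
Variables (R : realType) (V : lmodType R[i]).

(** Functions that agree almost everywhere are not identified, so inner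
    products are only semi-definite; and they are only well behaved on the
    subset L of square integrable functions. *)
Record semi_inner (L : set V) (ip : V -> V -> R[i]) : Prop := SemiInner {
  si0 : L 0;
  si_lin : forall a u v, L u -> L v -> L (a *: u + v);
  si_linl : forall a u v w, L u -> L v -> L w ->
    ip (a *: u + v) w = a * ip u w + ip v w;
  si_conj : forall u v, L u -> L v -> ip v u = cj (ip u v);
  si_ge0 : forall u, L u -> 0 <= ReC (ip u u) }.

Variables (L : set V) (ip : V -> V -> R[i]).
Hypothesis HS : semi_inner L ip.
Implicit Types (u v w : V) (a : R[i]).

Lemma siD u v : L u -> L v -> L (u + v).
Proof. by move=> Lu Lv; have := si_lin HS 1 Lu Lv; rewrite scale1r. Qed.
Lemma siZ a u : L u -> L (a *: u).
Proof. by move=> Lu; have := si_lin HS a Lu (si0 HS); rewrite addr0. Qed.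
Lemma siN u : L u -> L (- u).
Proof. by move=> Lu; rewrite -scaleN1r; exact: siZ. Qed.
Lemma siB u v : L u -> L v -> L (u - v).
Proof. by move=> Lu Lv; apply: siD => //; exact: siN. Qed.
Lemma si_sum (I : Type) (r : seq I) (P : pred I) (F : I -> V) :
  (forall i, P i -> L (F i)) -> L (\sum_(i <- r | P i) F i).
Proof. by move=> h; apply: big_ind => //; [exact: si0 HS|exact: siD]. Qed.

Lemma ipDl u v w : L u -> L v -> L w -> ip (u + v) w = ip u w + ip v w.
Proof. by move=> *; rewrite -[u]scale1r (si_linl HS)// mul1r scale1r. Qed.
Lemma ip0l w : L w -> ip 0 w = 0.
Proof.
move=> Lw; have L0 := si0 HS; have := ipDl L0 L0 Lw.
by rewrite addr0 => /eqP; rewrite -subr_eq0 opprD addrA subrr add0r oppr_eq0 => /eqP.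
Qed.
Lemma ipZl a u w : L u -> L w -> ip (a *: u) w = a * ip u w.
Proof.
move=> Lu Lw; have := si_linl HS a Lu (si0 HS) Lw.
by rewrite !addr0 ip0l// addr0.
Qed.
Lemma ipNl u w : L u -> L w -> ip (- u) w = - ip u w.
Proof. by move=> *; rewrite -scaleN1r ipZl// mulN1r. Qed.
Lemma ipBl u v w : L u -> L v -> L w -> ip (u - v) w = ip u w - ip v w.
Proof. by move=> *; rewrite ipDl ?ipNl//; exact: siN. Qed.
Lemma ip_conj u v : L u -> L v -> ip v u = cj (ip u v).
Proof. exact: si_conj HS u v. Qed.
Lemma ip0r w : L w -> ip w 0 = 0.
Proof. by move=> Lw; rewrite (ip_conj (si0 HS) Lw) ip0l// conjc0. Qed.
Lemma ipDr u v w : L u -> L v -> L w -> ip w (u + v) = ip w u + ip w v.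
Proof.
move=> Lu Lv Lw; rewrite (ip_conj (siD Lu Lv) Lw) ipDl// cjD.
by rewrite -!ip_conj.
Qed.
Lemma ipZr a u w : L u -> L w -> ip w (a *: u) = cj a * ip w u.
Proof.
by move=> Lu Lw; rewrite (ip_conj (siZ a Lu) Lw) ipZl// cjM -ip_conj.
Qed.
Lemma ipNr u w : L u -> L w -> ip w (- u) = - ip w u.
Proof. by move=> *; rewrite -scaleN1r ipZr// cjN conjc1 mulN1r. Qed.
Lemma ipBr u v w : L u -> L v -> L w -> ip w (u - v) = ip w u - ip w v.
Proof. by move=> *; rewrite ipDr ?ipNr//; exact: siN. Qed.
Lemma ip_suml (I : Type) (r : seq I) (P : pred I) (F : I -> V) w :
  L w -> (forall i, P i -> L (F i)) ->
  ip (\sum_(i <- r | P i) F i) w = \sum_(i <- r | P i) ip (F i) w.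
Proof.
move=> Lw LF; elim: r => [|i r IH]; first by rewrite !big_nil ip0l.
rewrite !big_cons; case: ifP => // Pi; rewrite ipDl// ?IH//; first exact: LF.
exact: si_sum.
Qed.
Lemma ip_sumr (I : Type) (r : seq I) (P : pred I) (F : I -> V) w :
  L w -> (forall i, P i -> L (F i)) ->
  ip w (\sum_(i <- r | P i) F i) = \sum_(i <- r | P i) ip w (F i).
Proof.
move=> Lw LF; rewrite (ip_conj (si_sum _ LF) Lw) ip_suml// cj_sum.
by apply: eq_bigr => i Pi; rewrite -ip_conj//; exact: LF.
Qed.

Definition sqn u : R := ReC (ip u u).

Lemma sqn_ge0 u : L u -> 0 <= sqn u. Proof. exact: si_ge0 HS u. Qed.
Lemma ip_sqn u : L u -> ip u u = (sqn u)%:C.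
Proof.
move=> Lu; apply: complex_eq; rewrite ?cpartsE//.
by have := congr1 (@complex.Im R) (ip_conj Lu Lu); rewrite Im_cj; lra.
Qed.
Lemma sqn0 : sqn 0 = 0. Proof. by rewrite /sqn ip0l//; exact: si0 HS. Qed.
Lemma sqnZ a u : L u -> sqn (a *: u) = sqmod a * sqn u.
Proof.
move=> Lu; rewrite {1}/sqn ipZl ?ipZr//; last exact: siZ.
by rewrite mulrA mul_cj ip_sqn// -rmorphM.
Qed.
Lemma sqnN u : L u -> sqn (- u) = sqn u.
Proof.
by move=> Lu; rewrite -scaleN1r sqnZ// sqmodN /sqmod /= expr1n expr0n addr0 mul1r.
Qed.
Lemma Re_ipC u v : L u -> L v -> ReC (ip v u) = ReC (ip u v).
Proof. by move=> Lu Lv; rewrite (ip_conj Lu Lv) Re_cj. Qed.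
Lemma sqnD u v : L u -> L v -> sqn (u + v) = sqn u + sqn v + 2 * ReC (ip u v).
Proof.
move=> Lu Lv; rewrite {1}/sqn ipDl ?ipDr//; [|exact: siD..].
by rewrite !cReD (Re_ipC Lu Lv) /sqn; ring.
Qed.
Lemma sqnB u v : L u -> L v -> sqn (u - v) = sqn u + sqn v - 2 * ReC (ip u v).
Proof.
move=> Lu Lv; rewrite sqnD//; last exact: siN.
by rewrite sqnN// ipNr// cReN; ring.
Qed.
Lemma sqnBC u v : L u -> L v -> sqn (u - v) = sqn (v - u).
Proof. by move=> Lu Lv; rewrite -opprB sqnN//; exact: siB. Qed.
Lemma parallelogram u v : L u -> L v ->
  sqn (u + v) + sqn (u - v) = 2 * sqn u + 2 * sqn v.
Proof. by move=> Lu Lv; rewrite sqnD// sqnB//; ring. Qed.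
Lemma sqnD_le u v : L u -> L v -> sqn (u + v) <= 2 * sqn u + 2 * sqn v.
Proof.
move=> Lu Lv; rewrite -(parallelogram Lu Lv) lerDl.
by apply: sqn_ge0; exact: siB.
Qed.

Lemma cauchy_schwarz u v : L u -> L v -> sqmod (ip u v) <= sqn u * sqn v.
Proof.
move=> Lu Lv; set b := ip u v.
have key (t : R) : 0 <= sqn u + t ^+ 2 * sqmod b * sqn v - 2 * t * sqmod b.
  have -> : sqn u + t ^+ 2 * sqmod b * sqn v - 2 * t * sqmod b =
            sqn (u - (t%:C * b) *: v).
    rewrite sqnB ?sqnZ ?ipZr//; last exact: siZ.
    by rewrite -/b /sqmod !cpartsE; ring.
  by apply: sqn_ge0; apply: siB => //; exact: siZ.
have [v0|] := eqVneq (sqn v) 0.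
  rewrite v0 mulr0 leNgt; apply/negP => b0.
  (* for this t the quadratic expression equals - 1 *)
  have := key ((sqn u + 1) / (2 * sqmod b)); rewrite v0 mulr0 addr0.
  suff -> : 2 * ((sqn u + 1) / (2 * sqmod b)) * sqmod b = sqn u + 1 by lra.
  by field; rewrite gt_eqF.
move=> vn0; have v0 : 0 < sqn v by rewrite lt_def vn0 sqn_ge0.
have := key (sqn v)^-1.
have -> : sqn u + (sqn v)^-1 ^+ 2 * sqmod b * sqn v - 2 * (sqn v)^-1 * sqmod b
  = sqn u - sqmod b / sqn v by field.
by rewrite subr_ge0 ler_pdivrMr.
Qed.

Lemma ip_null_l u v : L u -> L v -> sqn u = 0 -> ip u v = 0.
Proof.
move=> Lu Lv u0; apply: sqmod_eq0; apply/eqP; rewrite eq_le sqmod_ge0 andbT.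
by rewrite (le_trans (cauchy_schwarz Lu Lv))// u0 mul0r.
Qed.
Lemma ip_null_r u v : L u -> L v -> sqn v = 0 -> ip u v = 0.
Proof. by move=> Lu Lv v0; rewrite (ip_conj Lv Lu) ip_null_l// conjc0. Qed.
Lemma sqn_null_add u v : L u -> L v -> sqn u = 0 -> sqn (u + v) = sqn v.
Proof. by move=> Lu Lv u0; rewrite sqnD// u0 ip_null_l//= mulr0 add0r addr0. Qed.

Definition orthonormal (n : nat) (e : 'I_n -> V) : Prop :=
  (forall i, L (e i)) /\ forall i j, ip (e i) (e j) = (i == j)%:R.

Lemma orthonormal_comb n (e : 'I_n -> V) (c : 'I_n -> R[i]) i :
  orthonormal e -> ip (\sum_j c j *: e j) (e i) = c i.
Proof.
move=> [Le oe]; rewrite ip_suml//; last by move=> j _; exact: siZ.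
rewrite (bigD1 i)//= big1 ?addr0; first by rewrite ipZl// oe eqxx mulr1.
by move=> j ji; rewrite ipZl// oe (negPf ji) mulr0.
Qed.

Lemma sqn_orthonormal_comb n (e : 'I_n -> V) (c : 'I_n -> R[i]) :
  orthonormal e -> sqn (\sum_j c j *: e j) = \sum_j sqmod (c j).
Proof.
move=> oe; have [Le _] := oe; rewrite /sqn ip_sumr; last first.
- by move=> j _; exact: siZ.
- by apply: si_sum => j _; exact: siZ.
rewrite Re_sum; apply: eq_bigr => j _; rewrite ipZr//; last first.
  by apply: si_sum => k _; exact: siZ.
by rewrite orthonormal_comb// mulrC mul_cj.
Qed.

Lemma orthonormal_residual n (e : 'I_n -> V) u i :
  orthonormal e -> L u -> ip (u - \sum_j ip u (e j) *: e j) (e i) = 0.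
Proof.
move=> oe Lu; have [Le _] := oe; rewrite ipBl//.
- by rewrite (orthonormal_comb (fun j => ip u (e j)))// subrr.
- by apply: si_sum => k _; exact: siZ.
Qed.

(** Least squares by Gram-Schmidt.  The family may be dependent, even null, so
    a null residual r of the new element is given the coefficient 0. *)
Lemma finite_projection (n : nat) (e : nat -> V) u :
  (forall i, L (e i)) -> L u ->
  exists c : nat -> R[i],
    forall k, (k < n)%N -> ip (u - \sum_(j < n) c j *: e j) (e k) = 0.
Proof.
move=> Le; have Ls m (c : nat -> R[i]) : L (\sum_(j < m) c j *: e j).
  by apply: si_sum => j _; exact: siZ.
elim: n u => [|n IH] u Lu; first by exists (fun=> 0).
have [c cP] := IH _ Lu; have [d dP] := IH _ (Le n).
set u' := u - _ in cP; set r := e n - _ in dP.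
have Lu' : L u' by exact: siB.
have Lr : L r by exact: siB.
have enE : e n = r + \sum_(j < n) d j *: e j by rewrite /r subrK.
have orth v : L v -> (forall k, (k < n)%N -> ip v (e k) = 0) ->
    ip v (\sum_(j < n) d j *: e j) = 0.
  move=> Lv vP; rewrite ip_sumr//; last by move=> j _; exact: siZ.
  by rewrite big1// => j _; rewrite ipZr// vP// mulr0.
pose a := if sqn r == 0 then 0 else ip u' r / (sqn r)%:C.
exists (fun j => if (j < n)%N then c j - a * d j else a) => k.
have -> : u - \sum_(j < n.+1)
    (if (j < n)%N then c j - a * d j else a) *: e j = u' - a *: r.
  rewrite big_ord_recr/= ltnn.
  under eq_bigr => j _ do rewrite ltn_ord scalerBl -scalerA.
  rewrite sumrB -scaler_sumr /r /u' scalerBr.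
  by rewrite !opprD !opprK !addrA -!addrA; congr (_ + _); congr (_ + _); rewrite addrC.
have Lar : L (a *: r) by exact: siZ.
rewrite ltnS leq_eqVlt => /predU1P[->|kn]; last first.
  by rewrite ipBl// ipZl// cP// dP// mulr0 subr0.
rewrite enE ipDr//; last exact: siB.
rewrite orth ?addr0; [|exact: siB|]; last first.
  by move=> j jn; rewrite ipBl// ipZl// cP// dP// mulr0 subr0.
rewrite ipBl// ipZl// ip_sqn// /a; case: ifPn => [/eqP r0|r0].
  by rewrite mul0r subr0 ip_null_r.
by rewrite divfK ?subrr// -(rmorph0 (real_complex R)) (inj_eq (@complexI R)).
Qed.

(** * Limits *)

Definition lim_to (u_ : nat -> V) (u : V) := (fun n => sqn (u_ n - u)) @ \oo --> (0 : R).

Definition cauchy (u_ : nat -> V) : Prop := forall eps : R, 0 < eps ->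
  exists N, forall m n, (N <= m)%N -> (N <= n)%N -> sqn (u_ m - u_ n) < eps.

Definition complete_ip : Prop := forall u_ : nat -> V, (forall n, L (u_ n)) -> cauchy u_ ->
  exists2 u, L u & lim_to u_ u.

Lemma lim_to_cst u : L u -> lim_to (fun=> u) u.
Proof. by move=> Lu; rewrite /lim_to subrr sqn0; exact: cvg_cst. Qed.

Lemma squeeze0 (f g : nat -> R) : (forall n, 0 <= f n <= g n) ->
  g @ \oo --> 0 -> f @ \oo --> 0.
Proof.
move=> fg g0; apply: (@squeeze_cvgr _ _ _ _ (fun=> 0) g) => //.
- by apply: nearW.
- exact: cvg_cst.
Qed.

Lemma lim_toD (u_ v_ : nat -> V) u v : (forall n, L (u_ n)) -> (forall n, L (v_ n)) ->
  L u -> L v -> lim_to u_ u -> lim_to v_ v ->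
  lim_to (fun n => u_ n + v_ n) (u + v).
Proof.
move=> Lu_ Lv_ Lu Lv uu vv.
apply: (@squeeze0 _ (fun n => 2 * sqn (u_ n - u) + 2 * sqn (v_ n - v))).
  move=> n; have Hu := siB (Lu_ n) Lu; have Hv := siB (Lv_ n) Lv.
  have -> : u_ n + v_ n - (u + v) = (u_ n - u) + (v_ n - v).
    by rewrite opprD addrACA.
  by rewrite sqnD_le// sqn_ge0//; exact: siD.
rewrite -[X in _ --> X](_ : 2 * 0 + 2 * 0 = 0); last by rewrite !mulr0 addr0.
by apply: cvgD; apply: cvgMl_tmp.
Qed.

Lemma lim_toZ a (u_ : nat -> V) u : (forall n, L (u_ n)) -> L u -> lim_to u_ u ->
  lim_to (fun n => a *: u_ n) (a *: u).
Proof.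
move=> Lu_ Lu uu; rewrite /lim_to.
have -> : (fun n => sqn (a *: u_ n - a *: u)) = (fun n => sqmod a * sqn (u_ n - u)).
  by apply/funext => n; rewrite -scalerBr sqnZ//; exact: siB.
by rewrite -[X in _ --> X](mulr0 (sqmod a)); exact: cvgMl_tmp.
Qed.

Lemma lim_to_ip (u_ : nat -> V) u v : (forall n, L (u_ n)) -> L u -> L v -> lim_to u_ u ->
  (fun n => ReC (ip (u_ n) v)) @ \oo --> ReC (ip u v).
Proof.
move=> Lu_ Lu Lv uu; apply/subr_cvg0.
have bnd n : `|ReC (ip (u_ n) v) - ReC (ip u v)| <=
    Num.sqrt (sqn v) * Num.sqrt (sqn (u_ n - u)).
  have Hu := siB (Lu_ n) Lu.
  rewrite -cReB -ipBl// -sqrtrM ?sqn_ge0// -sqrtr_sqr ler_sqrt; last first.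
    by rewrite mulr_ge0 ?sqn_ge0.
  rewrite (le_trans (Re_sqr_le_sqmod _))// mulrC.
  exact: cauchy_schwarz.
have s0 : (fun n => Num.sqrt (sqn v) * Num.sqrt (sqn (u_ n - u))) @ \oo --> 0.
  rewrite -[X in _ --> X](mulr0 (Num.sqrt (sqn v))); apply: cvgMl_tmp.
  rewrite -[X in _ --> X](@sqrtr0 R).
  by apply: (@cvg_comp _ _ _ _ Num.sqrt _ _ _ uu); exact: sqrt_continuous.
apply/norm_cvg0P; apply: squeeze0 s0 => n.
by rewrite normr_ge0 bnd.
Qed.

Lemma lim_to_sqn (u_ : nat -> V) u : (forall n, L (u_ n)) -> L u -> lim_to u_ u ->
  (fun n => sqn (u_ n)) @ \oo --> sqn u.
Proof.
move=> Lu_ Lu uu.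
have -> : (fun n => sqn (u_ n)) =
    (fun n => sqn (u_ n - u) + 2 * ReC (ip (u_ n) u) - sqn u).
  by apply/funext => n; rewrite sqnB//; ring.
rewrite -[X in _ --> X](_ : 0 + 2 * sqn u - sqn u = _); last by ring.
apply: cvgB; last exact: cvg_cst.
by apply: cvgD => //; apply: cvgMl_tmp; exact: lim_to_ip.
Qed.

Lemma lim_ip_eq (u_ w_ : nat -> V) u v w z : (forall n, L (u_ n)) -> (forall n, L (w_ n)) ->
  L u -> L v -> L w -> L z -> lim_to u_ u -> lim_to w_ w ->
  (forall n, ip (u_ n) v = ip (w_ n) z) -> ip u v = ip w z.
Proof.
move=> Lu_ Lw_ Lu Lv Lw Lz uu ww e; apply: Re_mul_inj => a.
have h1 := lim_to_ip (fun n => siZ a (Lu_ n)) (siZ a Lu) Lv (lim_toZ a Lu_ Lu uu).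
have h2 := lim_to_ip (fun n => siZ a (Lw_ n)) (siZ a Lw) Lz (lim_toZ a Lw_ Lw ww).
have E : (fun n => ReC (ip (a *: u_ n) v)) = (fun n => ReC (ip (a *: w_ n) z)).
  by apply/funext => n; rewrite !ipZl// e.
by rewrite E in h1; rewrite -!ipZl//; exact: (cvg_unique (@Rhausdorff R) h1 h2).
Qed.

(** * Orthogonal projection onto a subspace *)

(** In the parallelogram law for two almost minimal elements u, v of a convex
    set, the term |u + v|^2 is at least four times the infimum, which leaves
    little room for |u - v|^2. *)
Lemma minimizing_cauchy (D : set V) (c : R) (u_ : nat -> V) :
  (forall u, D u -> L u) ->
  (forall u v, D u -> D v -> 4 * c <= sqn (u + v)) ->
  (forall n, D (u_ n)) -> (forall n, sqn (u_ n) <= c + n.+1%:R^-1) ->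
  cauchy u_.
Proof.
move=> DL Dc Du_ ub eps e0.
have [N NP] : exists N, N.+1%:R^-1 < eps / 4.
  have e4 : 0 < eps / 4 by rewrite divr_gt0.
  have [N _ NP] := near_infty_natSinv_lt (PosNum e4).
  by exists N; exact: NP (leqnn _).
exists N => m n Nm Nn.
have b k : (N <= k)%N -> k.+1%:R^-1 < eps / 4.
  move=> Nk; apply: le_lt_trans NP; rewrite lef_pV2 ?posrE ?ltr0n// ler_nat ltnS//.
have := parallelogram (DL _ (Du_ m)) (DL _ (Du_ n)).
have := Dc _ _ (Du_ m) (Du_ n); have := ub m; have := ub n.
have := b _ Nm; have := b _ Nn.
by move: (m.+1%:R^-1) (n.+1%:R^-1) => *; lra.
Qed.

Lemma minimal_orthogonal x w : L x -> L w ->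
  (forall t, sqn x <= sqn (x - t *: w)) -> ip x w = 0.
Proof.
move=> Lx Lw h; set b := ip x w; apply: sqmod_eq0.
have w0 := sqn_ge0 Lw; have b0 := sqmod_ge0 b.
have w1 : 0 < sqn w + 1 by lra.
(* a multiple of w in the direction of b; adding 1 covers a null vector w *)
have := h ((sqn w + 1)^-1%:C * b).
have -> : sqn (x - ((sqn w + 1)^-1%:C * b) *: w) =
    sqn x - sqmod b * ((sqn w + 2) / (sqn w + 1) ^+ 2).
  rewrite sqnB ?sqnZ ?ipZr//; last exact: siZ.
  by rewrite -/b /sqmod !cpartsE; field; rewrite gt_eqF.
have : 0 < (sqn w + 2) / (sqn w + 1) ^+ 2 by rewrite divr_gt0// ?exprn_gt0//; lra.
move=> k0 hb; have : sqmod b * ((sqn w + 2) / (sqn w + 1) ^+ 2) <= 0 by lra.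
by rewrite pmulr_lle0// => b1; lra.
Qed.

(** For a subspace W that is not closed, the projection h of u is only a limit of
    elements of W. *)
Lemma projection (W : set V) u : complete_ip ->
  W 0 -> (forall a v w, W v -> W w -> W (a *: v + w)) ->
  (forall w, W w -> L w) -> L u ->
  exists (w_ : nat -> V) (h : V), [/\ forall n, W (w_ n), L h, lim_to w_ h &
    forall w, W w -> ip (u - h) w = 0].
Proof.
move=> cpl W0 Wlin WL Lu.
have WZ a v : W v -> W (a *: v).
  by move=> Wv; have := Wlin a v 0 Wv W0; rewrite addr0.
have WD v w : W v -> W w -> W (v + w).
  by move=> Wv Ww; have := Wlin 1 v w Wv Ww; rewrite scale1r.
pose Q := [set sqn (u - w) | w in W].
have hQ : has_inf Q.
  split; first by exists (sqn (u - 0)); exists 0.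
  by exists 0 => _ [w Ww <-]; apply: sqn_ge0; apply: siB => //; exact: WL.
set c := inf Q.
have cP w : W w -> c <= sqn (u - w).
  by move=> Ww; apply: ge_inf; [exact: hQ.2|exists w].
have ex (n : nat) : exists w, W w /\ sqn (u - w) <= c + n.+1%:R^-1.
  have n0 : 0 < n.+1%:R^-1 :> R by rewrite invr_gt0 ltr0n.
  by have [_ [w Ww <-] /ltW lt] := inf_adherent n0 hQ; exists w.
have [w_ w_P] := choice ex.
have Ww_ n : W (w_ n) by have [] := w_P n.
have Lw_ n : L (w_ n) by exact: WL.
have cw : cauchy w_.
  have : cauchy (fun n => u - w_ n).
    apply: (@minimizing_cauchy [set u - w | w in W] c).
    - by move=> _ [w Ww <-]; apply: siB => //; exact: WL.
    - move=> _ _ [w Ww <-] [w' Ww' <-].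
      have -> : u - w + (u - w') = 2%:R *: (u - 2%:R^-1 *: (w + w')).
        rewrite scalerBr scalerA mulfV ?pnatr_eq0// scale1r scaler_nat mulr2n.
        by rewrite opprD addrACA.
      rewrite sqnZ; last by apply: siB => //; apply: siZ; apply: WL; exact: WD.
      have -> : sqmod (2%:R : R[i]) = 4.
        by rewrite -(rmorph_nat (real_complex R)) sqmod_real; ring.
      by rewrite ler_pM2l//; apply: cP; apply: WZ; exact: WD.
    - by move=> n; exists (w_ n).
    - by move=> n; have [] := w_P n.
  move=> cu eps e0; have [N NP] := cu _ e0; exists N => m n Nm Nn.
  have -> : w_ m - w_ n = - (u - w_ m - (u - w_ n)).
    by rewrite !opprB [RHS]addrC addrA subrK.
  rewrite sqnN; first exact: NP.
  by apply: siB; exact: siB.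
have [h Lh hP] := cpl _ Lw_ cw.
exists w_, h; split=> // w Ww.
(* the distance from u to h + w' is a limit of distances to elements of W + w' *)
have lim_u w' : L w' -> (fun n => sqn (u - w_ n - w')) @ \oo --> sqn (u - h - w').
  move=> Lw'; have := @lim_toD (fun=> u - w') (fun n => (-1) *: w_ n) (u - w') ((-1) *: h).
  have LuB : L (u - w') by exact: siB.
  move=> /(_ (fun=> LuB) (fun n => siZ _ (Lw_ n)) LuB (siZ _ Lh) (lim_to_cst LuB)
    (lim_toZ _ Lw_ Lh hP)).
  rewrite scaleN1r; under eq_fun => n do rewrite scaleN1r.
  move=> /lim_to_sqn H.
  have -> : u - h - w' = u - w' - h by rewrite addrAC.
  under eq_fun => n do rewrite addrAC.
  by apply: H => [n|]; apply: siB.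
have hc : sqn (u - h) <= c.
  have l1 := lim_u 0 (si0 HS); rewrite subr0 in l1.
  have l2 : (fun n => c + n.+1%:R^-1 : R) @ \oo --> c.
    rewrite -[X in _ --> X]addr0; apply: cvgD; first exact: cvg_cst.
    exact: (@cvg_harmonic R).
  apply: (ler_cvg_to l1 l2); apply: nearW => n; rewrite subr0.
  by have [] := w_P n.
have Lw : L w by exact: WL.
apply: minimal_orthogonal => [||t] //; first exact: siB.
apply: (le_trans hc).
have l1 := lim_u (t *: w) (siZ t Lw).
apply: (cvgr_to_ge l1); apply: nearW => n.
rewrite -addrA -opprD; apply: cP; apply: WD => //; exact: WZ.
Qed.

End SemiInner.

(** * Homogeneous linear systems *)

(** The coefficient matrix has more columns than its rank. *)
Lemma underdetermined (F : fieldType) (m n : nat) (M : 'I_m -> 'I_n -> F) :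
  (m < n)%N ->
  exists2 c : 'I_n -> F, (exists j, c j != 0) & forall i, \sum_j M i j * c j = 0.
Proof.
move=> mn; pose A := (\matrix_(j < n, i < m) M i j)%R.
have : kermx A != 0.
  rewrite -mxrank_eq0 mxrank_ker -lt0n subn_gt0.
  exact: leq_ltn_trans (rank_leq_col A) mn.
move=> /rowV0Pn[v /sub_kermxP vA v0].
exists (fun j => v 0 j).
  by have /rV0Pn[j vj] := v0; exists j.
move=> i; have := congr1 (fun B : 'rV_m => B 0 i) vA.
rewrite !mxE => E; rewrite -[RHS]E.
by apply: eq_bigr => j _; rewrite mxE mulrC.
Qed.

(** * Real square integrable functions *)

Section AlmostEverywhere.
Variable R : realType.
Local Notation mu := (@lebesgue_measure R).
Implicit Types P Q S : R -> Prop.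

Lemma ae_imp P Q : (forall x, P x -> Q x) ->
  {ae mu, forall x, P x} -> {ae mu, forall x, Q x}.
Proof. exact: (@filterS _ _ (ae_filter_ringOfSetsType mu)). Qed.

Lemma ae_imp2 P Q S : {ae mu, forall x, P x} -> {ae mu, forall x, Q x} ->
  (forall x, P x -> Q x -> S x) -> {ae mu, forall x, S x}.
Proof. by move=> hP hQ PQS; exact: (@filterS2 _ _ (ae_filter_ringOfSetsType mu) _ _ _ PQS). Qed.

End AlmostEverywhere.

Section RealL2.
Variables (R : realType) (D : set R).
Local Notation mu := (@lebesgue_measure R).
Hypothesis mD : measurable (D : set (measurableTypeR R)).
Hypothesis Dfin : (mu D < +oo)%E.
Implicit Types f g : R -> R.

Lemma measurable_funE f : measurable_fun D f -> measurable_fun D (fun x => (f x)%:E).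
Proof. by move=> mf; exact/measurable_EFinP. Qed.

Lemma rmeas_cst (a : R) : measurable_fun D (fun=> a).
Proof. exact: measurable_cst. Qed.
Lemma rmeasD f g : measurable_fun D f -> measurable_fun D g ->
  measurable_fun D (fun x => f x + g x).
Proof. exact: measurable_funD. Qed.
Lemma rmeasM f g : measurable_fun D f -> measurable_fun D g ->
  measurable_fun D (fun x => f x * g x).
Proof. exact: measurable_funM. Qed.
Lemma rmeasB f g : measurable_fun D f -> measurable_fun D g ->
  measurable_fun D (fun x => f x - g x).
Proof. exact: measurable_funB. Qed.

Definition rsq f : Prop :=
  measurable_fun D f /\ mu.-integrable D (fun x => (f x ^+ 2)%:E).

Lemma rsq_le f (h : R -> R) : measurable_fun D f ->
  mu.-integrable D (EFin \o h) -> (forall x, D x -> f x ^+ 2 <= h x) -> rsq f.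
Proof.
move=> mf ih fh; split=> //; apply: le_integrable ih => //.
  by apply/measurable_EFinP; exact: measurable_funX.
move=> x Dx /=; rewrite lee_fin ger0_norm ?sqr_ge0//.
by rewrite (le_trans (fh _ Dx))// ler_norm.
Qed.

Lemma rsq_mulint f g : rsq f -> rsq g -> mu.-integrable D (fun x => (f x * g x)%:E).
Proof.
move=> [mf f2] [mg g2].
have fg2 := integrableD mD f2 g2.
apply: le_integrable fg2 => //.
  by apply/measurable_EFinP; exact: measurable_funM.
move=> x Dx /=; rewrite lee_fin [X in _ <= X]ger0_norm ?addr_ge0 ?sqr_ge0//.
have h1 := sqr_ge0 (f x - g x); have h2 := sqr_ge0 (f x + g x).
have h3 := sqr_ge0 (f x); have h4 := sqr_ge0 (g x).
by rewrite ler_norml; apply/andP; split; rewrite sqrrB sqrrD in h1 h2; lra.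
Qed.

Lemma rsqD f g : rsq f -> rsq g -> rsq (fun x => f x + g x).
Proof.
move=> rf rg; have [mf f2] := rf; have [mg g2] := rg.
apply: (@rsq_le _ (fun x => 2 * f x ^+ 2 + 2 * g x ^+ 2)).
- exact: measurable_funD.
- have := integrableD mD (integrableZl mD 2 f2) (integrableZl mD 2 g2).
  by apply: eq_integrable.
- move=> x _; have := sqr_ge0 (f x - g x); rewrite sqrrB sqrrD; lra.
Qed.

Lemma rsqZ a f : rsq f -> rsq (fun x => a * f x).
Proof.
move=> [mf f2]; apply: (@rsq_le _ (fun x => a ^+ 2 * f x ^+ 2)).
- exact: measurable_funM.
- by have := integrableZl mD (a ^+ 2) f2; apply: eq_integrable.
- by move=> x _; rewrite exprMn.
Qed.

Lemma rsqN f : rsq f -> rsq (fun x => - f x).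
Proof.
by move=> /(rsqZ (-1)); congr rsq; apply/funext => x; rewrite mulN1r.
Qed.

Lemma rsqB f g : rsq f -> rsq g -> rsq (fun x => f x - g x).
Proof. by move=> rf rg; apply: rsqD => //; exact: rsqN. Qed.

Lemma rsq_cst a : rsq (fun=> a).
Proof.
split; first exact: measurable_cst.
have : mu.-integrable D (EFin \o cst (a ^+ 2)); last by apply: eq_integrable.
apply: measurable_bounded_integrable => //.
by exists (a ^+ 2); split; [exact: num_real|] => M aM x _ /=; rewrite (le_trans _ (ltW aM))// ger0_norm ?sqr_ge0.
Qed.

Lemma rsq_bounded f M : measurable_fun D f -> (forall x, D x -> `|f x| <= M) -> rsq f.
Proof.
move=> mf fM; apply: (@rsq_le _ (fun=> M ^+ 2)) => //.
- by have [_] := rsq_cst M; apply: eq_integrable.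
- by move=> x Dx; rewrite -ler_sqrt ?sqr_ge0// !sqrtr_sqr (le_trans (fM _ Dx))// ler_norm.
Qed.

Lemma rsq_int f : rsq f -> mu.-integrable D (fun x => (f x)%:E).
Proof.
move=> rf; have := rsq_mulint rf (rsq_cst 1).
by apply: eq_integrable => // x _; rewrite mulr1.
Qed.

Lemma rsqM_bounded f g M : measurable_fun D g -> (forall x, D x -> `|g x| <= M) ->
  rsq f -> rsq (fun x => g x * f x).
Proof.
move=> mg gM [mf f2]; apply: (@rsq_le _ (fun x => M ^+ 2 * f x ^+ 2)).
- exact: measurable_funM.
- by have := integrableZl mD (M ^+ 2) f2; apply: eq_integrable.
- move=> x Dx; rewrite exprMn ler_wpM2r ?sqr_ge0//.
  by rewrite -ler_sqrt ?sqr_ge0// !sqrtr_sqr (le_trans (gM _ Dx))// ler_norm.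
Qed.

Definition rsqn f : R := \int[mu]_(x in D) (f x ^+ 2).

Lemma rsqn_ge0 f : 0 <= rsqn f.
Proof. by apply: Rintegral_ge0 => x _; exact: sqr_ge0. Qed.

Lemma rsqnE f : rsq f -> (rsqn f)%:E = (\int[mu]_(x in D) (f x ^+ 2)%:E)%E.
Proof. by move=> [_ f2]; rewrite fineK//; exact: integrable_fin_num. Qed.

(** The core of the Riesz-Fischer theorem: the increments g_(k+1) - g_k are
    summable in L^1, hence absolutely summable almost everywhere. *)
Lemma rsq_fast_complete (g_ : nat -> R -> R) : (forall n, rsq (g_ n)) ->
  (forall k, rsqn (fun x => g_ k.+1 x - g_ k x) <= 4^-1 ^+ k) ->
  exists2 h : R -> R, measurable_fun D h &
    {ae mu, forall x, D x -> (fun n => g_ n x) @ \oo --> h x}.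
Proof.
move=> rg gk.
pose d k x := `|g_ k.+1 x - g_ k x|.
have md k : measurable_fun D (d k).
  apply: measurableT_comp => //; apply: measurable_funB.
  - by have [] := rg k.+1.
  - by have [] := rg k.
have mdE k : measurable_fun D (fun x => (d k x)%:E) by exact/measurable_EFinP.
have d0 k x : D x -> (0 <= (d k x)%:E)%E by rewrite lee_fin normr_ge0.
(* integrate |t| <= 2^k t^2 / 2 + 2^-k / 2 over D, for t = g_(k+1) - g_k *)
pose c := (1 + fine (mu D)) / 2.
have mu0 : 0 <= fine (mu D) by apply: fine_ge0; exact: measure_ge0.
have dint k : (\int[mu]_(x in D) (d k x)%:E <= (c * 2^-1 ^+ k)%:E)%E.
  have rd := rsqB (rg k.+1) (rg k).
  have i1 : mu.-integrable D (fun x => ((2 ^+ k / 2) * (g_ k.+1 x - g_ k x) ^+ 2)%:E).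
    by have := integrableZl mD (2 ^+ k / 2) rd.2; apply: eq_integrable.
  have i2 : mu.-integrable D (fun x => (2^-1 ^+ k / 2)%:E).
    by apply: rsq_int; exact: rsq_cst.
  have -> : c * 2^-1 ^+ k =
      (2 ^+ k / 2) * 4^-1 ^+ k + (2^-1 ^+ k / 2) * fine (mu D).
    have -> : (4^-1 : R) = 2^-1 * 2^-1 by rewrite -invfM -natrM.
    have ab : (2 : R) ^+ k * 2^-1 ^+ k = 1 by rewrite -exprMn divff ?pnatr_eq0// expr1n.
    rewrite exprMn (_ : 2 ^+ k / 2 * _ = (2 ^+ k * 2^-1 ^+ k) * (2^-1 ^+ k / 2)); last by ring.
    by rewrite ab /c; field.
  apply: (@le_trans _ _ (\int[mu]_(x in D) ((2 ^+ k / 2) * (g_ k.+1 x - g_ k x) ^+ 2 +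
     2^-1 ^+ k / 2)%:E)%E).
    apply: ge0_le_integral => //; first exact: d0.
    - exact: mdE.
    - apply: measurable_funE; apply: rmeasD; last exact: rmeas_cst.
      apply: rmeasM; [exact: rmeas_cst|apply: measurable_funX; exact: rd.1].
    - move=> x Dx; rewrite lee_fin /d.
      set t := g_ k.+1 x - g_ k x.
      have h := sqr_ge0 (2 ^+ k * `|t| - 1).
      have t2 : t ^+ 2 = `|t| ^+ 2 by rewrite real_normK// num_real.
      have p0 : 0 < (2 : R) ^+ k by rewrite exprn_gt0.
      rewrite t2 exprVn -subr_ge0.
      have -> : 2 ^+ k / 2 * `|t| ^+ 2 + (2 ^+ k)^-1 / 2 - `|t| =
         (2 ^+ k * `|t| - 1) ^+ 2 / (2 * 2 ^+ k) by field; rewrite gt_eqF.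
      by rewrite divr_ge0// mulr_ge0// ltW.
  under eq_integral do rewrite EFinD.
  rewrite integralD//.
  under eq_integral do rewrite EFinM.
  rewrite integralZl//; last exact: rd.2.
  rewrite -(rsqnE rd) integral_cst// EFinD EFinM.
  rewrite leeD//.
    by rewrite -EFinM lee_fin ler_wpM2l ?divr_ge0 ?exprn_ge0.
  by rewrite [leRHS]EFinM fineK// ge0_fin_numE.
pose S x := (\sum_(0 <= k <oo) (d k x)%:E)%E.
have SintE : (\int[mu]_(x in D) S x = \sum_(0 <= k <oo) \int[mu]_(x in D) (d k x)%:E)%E.
  by apply: integral_nneseries.
have c0 : 0 <= c by rewrite divr_ge0// addr_ge0.
have Sint : (\int[mu]_(x in D) S x < +oo)%E.
  rewrite SintE; apply: (@le_lt_trans _ _ (\sum_(0 <= k <oo) (c * 2^-1 ^+ k)%:E)%E).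
    apply: lee_nneseries => // k _ _.
    by apply: integral_ge0 => x; exact: d0.
  have h1 : `|2^-1 : R| < 1 by rewrite ger0_norm ?invr_ge0// invf_lt1// ltr1n.
  have := @cvg_geometric_series R c 2^-1 h1.
  move=> hc; rewrite (_ : limn _ = (c * (1 - 2^-1)^-1)%:E) ?ltry//.
  apply/cvg_lim => //.
  have -> : (fun n => (\sum_(0 <= k < n) (c * 2^-1 ^+ k)%:E)%E) =
     EFin \o (series (geometric c 2^-1)).
    by apply/funext => n; rewrite /= /series/= sumEFin.
  by apply: cvg_EFin => //; apply: nearW.
have S0 x : D x -> (0 <= S x)%E.
  by move=> Dx; apply: nneseries_ge0 => k _ _; exact: d0.
have mS : measurable_fun D S.
  by apply: ge0_emeasurable_sum => // k x Dx _; exact: d0.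
have iS : mu.-integrable D S.
  apply/integrableP; split => //.
  by under eq_integral => x /set_mem Dx do rewrite gee0_abs ?S0//.
have finS := integrable_ae mD iS.
have cvg_g x : D x -> S x \is a fin_num -> cvgn (fun n => g_ n x).
  move=> Dx fx; pose u k := g_ k.+1 x - g_ k x.
  have cu : cvgn (series u).
    apply: normed_cvg; apply: nondecreasing_is_cvgn.
      apply: nondecreasing_series => n _ _; exact: normr_ge0.
    exists (fine (S x)) => _ [n _ <-].
    rewrite -lee_fin fineK// /series/= -sumEFin.
    by apply: nneseries_lim_ge => k _ _; exact: d0.
  have -> : (fun n => g_ n x) = (fun n => series u n + g_ 0%N x).
    by apply/funext => n; rewrite /series/= telescope_sumr// subrK.
  by apply: is_cvgD => //; exact: is_cvg_cst.
(* the sequence is set to 0 off E, so that it converges at every point *)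
pose E := [set x | S x \is a fin_num].
pose g' n x := if x \in E then g_ n x else 0.
have mE : measurable (D `&` E : set (measurableTypeR R)).
  exact: (emeasurable_fin_num mD mS).
have mg' n : measurable_fun D (g' n).
  have -> : g' n = (fun x => \1_E x * g_ n x).
    by apply/funext => x; rewrite /g' indicE; case: (x \in E); rewrite ?mul1r ?mul0r.
  apply: rmeasM; last by have [] := rg n.
  have : measurable_fun (D : set (measurableTypeR R)) (\1_(D `&` E) : R -> R).
    by apply: measurable_indic.
  apply: eq_measurable_fun => x xD.
  by rewrite !indicE in_setI xD.
have cg' x : D x -> cvgn (fun n => g' n x).
  move=> Dx; have [xE|xE] := boolP (x \in E).
    have -> : (fun n => g' n x) = (fun n => g_ n x) by apply/funext => n; rewrite /g' xE.
    by apply: cvg_g => //; move/set_mem: xE.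
  have -> : (fun n => g' n x) = (fun=> 0) by apply/funext => n; rewrite /g' (negPf xE).
  exact: is_cvg_cst.
exists (fun x => limn (fun n => g' n x)).
  by apply: measurable_fun_cvg mg' _ => x Dx; exact: cg'.
apply: ae_imp finS => x fx Dx.
have xE : x \in E by apply/mem_set; exact: fx.
have -> : (fun n => g_ n x) = (fun n => g' n x) by apply/funext => n; rewrite /g' xE.
exact: cg'.
Qed.

Lemma limn_einf_le (u : nat -> \bar R) (e : \bar R) :
  (forall n, (u n <= e)%E) -> (limn_einf u <= e)%E.
Proof.
move=> ue; rewrite limn_einf_lim; apply: lime_le; first exact: is_cvg_einfs.
apply: nearW => n; apply: le_trans (ue n).
by apply: ereal_inf_lbound; exists n => /=.
Qed.

(** Fatou's lemma turns a bound on the norms into a bound on the norm of the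
    pointwise limit. *)
Lemma rsq_fatou (u_ : nat -> R -> R) (u : R -> R) (e : R) : 0 <= e ->
  (forall n, rsq (u_ n)) -> measurable_fun D u ->
  {ae mu, forall x, D x -> (fun n => u_ n x) @ \oo --> u x} ->
  (forall n, rsqn (u_ n) <= e) -> rsq u /\ rsqn u <= e.
Proof.
move=> e0 ru mu' ucv ue.
have mE2 (f : R -> R) : measurable_fun D f -> measurable_fun D (fun x => (f x ^+ 2)%:E).
  by move=> mf; apply: measurable_funE; exact: measurable_funX.
have m_ n : measurable_fun D (fun x => (u_ n x ^+ 2)%:E).
  by apply: mE2; have [] := ru n.
have F := @fatou _ _ _ mu D mD (fun n x => (u_ n x ^+ 2)%:E) m_.
have int_le : (\int[mu]_(x in D) (u x ^+ 2)%:E <= e%:E)%E.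
  rewrite (_ : (\int[mu]_(x in D) _)%E =
     (\int[mu]_(x in D) limn_einf (fun n => (u_ n x ^+ 2)%:E))%E).
    apply: (le_trans (F _)); first by move=> n x _; rewrite lee_fin sqr_ge0.
    by apply: limn_einf_le => n; rewrite -rsqnE// lee_fin.
  have m1 := mE2 _ mu'.
  have m2 : measurable_fun D (fun x => limn_einf (fun n => (u_ n x ^+ 2)%:E)).
    have -> : (fun x => limn_einf (fun n => (u_ n x ^+ 2)%:E)) =
        (fun x => (- limn_esup (fun n => (- (u_ n x ^+ 2)%:E)%E))%E).
      by apply/funext => x; rewrite -limn_einfN; congr limn_einf;
         apply/funext => n; apply/esym; exact: oppeK.
    apply: measurableT_comp => //; apply: measurable_fun_limn_esup => n.
    by apply: measurableT_comp => //; exact: m_.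
  apply: ae_eq_integral => //.
  apply: (ae_imp _ ucv) => x cx Dx.
  have cv : (fun n => (u_ n x ^+ 2)%:E) @ \oo --> (u x ^+ 2)%:E.
    apply: cvg_EFin; first by apply: nearW.
    have -> : fine \o (fun n => (u_ n x ^+ 2)%:E) = (fun n => u_ n x * u_ n x).
      by apply/funext => n /=; rewrite expr2.
    by rewrite expr2; apply: cvgM; exact: cx.
  by rewrite (cvg_limn_einf_sup cv).1.
have ru' : rsq u.
  split=> //; apply/integrableP; split; first exact: mE2.
  under eq_integral do rewrite gee0_abs ?lee_fin ?sqr_ge0//.
  exact: le_lt_trans int_le (ltry _).
by split => //; rewrite -lee_fin rsqnE.
Qed.

(** A Cauchy sequence has a subsequence to which [rsq_fast_complete] applies;
    the limit is taken in the L^2 sense by [rsq_fatou]. *)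
Lemma rsq_complete (f_ : nat -> R -> R) : (forall n, rsq (f_ n)) ->
  (forall e, 0 < e -> exists N, forall m n, (N <= m)%N -> (N <= n)%N ->
     rsqn (fun x => f_ m x - f_ n x) < e) ->
  exists2 h, rsq h & forall e, 0 < e -> exists N, forall n, (N <= n)%N ->
     rsqn (fun x => f_ n x - h x) <= e.
Proof.
move=> rf cf.
have p4 (k : nat) : 0 < (4^-1 : R) ^+ k by rewrite exprn_gt0// invr_gt0.
have [N_ NP] := choice (fun k => cf _ (p4 k)).
(* partial sums make the chosen indices monotone *)
pose phi k := (\sum_(i < k.+1) N_ i)%N.
have Nphi k : (N_ k <= phi k)%N by rewrite /phi big_ord_recr/= leq_addl.
have phi_nd k : (phi k <= phi k.+1)%N by rewrite /phi [leqRHS]big_ord_recr/= leq_addr.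
have phi_mono j k : (j <= k)%N -> (phi j <= phi k)%N.
  move=> jk; rewrite -(subnK jk); elim: (k - j)%N => // i IH.
  exact: leq_trans IH (phi_nd _).
pose g_ k := f_ (phi k).
have rg k : rsq (g_ k) by exact: rf.
have gk k : rsqn (fun x => g_ k.+1 x - g_ k x) <= 4^-1 ^+ k.
  by apply/ltW/NP; [exact: leq_trans (Nphi _) (phi_nd _)|exact: Nphi].
have [h mh hP] := rsq_fast_complete rg gk.
have key k n : (N_ k <= n)%N ->
    rsq (fun x => f_ n x - h x) /\ rsqn (fun x => f_ n x - h x) <= 4^-1 ^+ k.
  move=> Nn; apply: (@rsq_fatou (fun j x => f_ n x - g_ (j + k)%N x)).
  - exact: ltW.
  - by move=> j; exact: rsqB.
  - by apply: rmeasB => //; have [] := rf n.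
  - apply: (ae_imp _ hP) => x hx Dx; apply: cvgB; first exact: cvg_cst.
    have := hx Dx; rewrite -(cvg_shiftn k); exact.
  - move=> j; apply/ltW/NP => //; apply: (leq_trans (Nphi k)).
    by apply: phi_mono; rewrite leq_addl.
exists h.
  have [r _] := key 0%N _ (leqnn _).
  have -> : h = fun x => f_ (N_ 0%N) x - (f_ (N_ 0%N) x - h x).
    by apply/funext => x; rewrite opprB addrC subrK.
  exact: rsqB.
move=> e e0.
have : (fun k => (4^-1 : R) ^+ k) @ \oo --> 0.
  by apply: cvg_expr; rewrite ger0_norm ?invr_ge0// invf_lt1// ltr1n.
move=> /cvgr0Pnorm_lt/(_ _ e0)[k _ /(_ k (leqnn _)) kP].
exists (N_ k) => n Nn; have [_ le] := key k n Nn.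
apply: (le_trans le); apply/ltW; apply: le_lt_trans kP; exact: ler_norm.
Qed.

End RealL2.

(** * Integration by parts for absolutely continuous functions *)

Section FubiniTriangle.
Variable R : realType.
Local Notation mu := (@lebesgue_measure R).
Implicit Types g h : R -> R.

(** Both sides integrate g s * h t over the half plane t < s. *)
Lemma fubini_triangle g h :
  mu.-integrable setT (EFin \o g) -> mu.-integrable setT (EFin \o h) ->
  \int[mu]_s (g s * \int[mu]_(t in `]-oo, s[) h t) =
  \int[mu]_t (h t * \int[mu]_(s in `]t, +oo[) g s).
Proof.
move=> ig ih.
have mg : measurable_fun setT g by have /measurable_int/measurable_EFinP := ig.
have mh : measurable_fun setT h by have /measurable_int/measurable_EFinP := ih.
pose K (p : R * R) : R := g p.1 * h p.2 * (if p.2 < p.1 then 1 else 0).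
have mK : measurable_fun [set: measurableTypeR R * measurableTypeR R] (EFin \o K).
  apply/measurable_EFinP; apply: measurable_funM.
    apply: measurable_funM.
      exact: (measurableT_comp mg (@measurable_fst _ _ _ _)).
    exact: (measurableT_comp mh (@measurable_snd _ _ _ _)).
  apply: measurable_fun_ifT; [|exact: measurable_cst..].
  apply: measurable_fun_ltr; [exact: measurable_snd|exact: measurable_fst].
have iK : (mu \x mu)%E.-integrable setT (EFin \o K).
  apply/integrable12ltyP => //.
  pose C := (\int[mu]_t `|(h t)%:E|)%E.
  have C0 : (0 <= C)%E by apply: integral_ge0.
  have Cfin : (C < +oo)%E by have /integrableP[] := ih.
  apply: (@le_lt_trans _ _ (\int[mu]_s (C * `|(g s)%:E|))%E).
    apply: ge0_le_integral => //.
    - by move=> x _; apply: integral_ge0.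
    - apply: (@measurable_fun_fubini_tonelli_F _ _ _ _ _ mu (abse \o (EFin \o K))).
        by apply: measurableT_comp.
      by move=> x; exact: abse_ge0.
    - by apply: measurable_funeM; apply: measurableT_comp => //; exact/measurable_EFinP.
    - move=> x _.
      rewrite muleC -ge0_integralZl//; last first.
        by apply: measurableT_comp => //; exact/measurable_EFinP.
      apply: ge0_le_integral => //.
      + apply: measurableT_comp => //.
        exact: (measurableT_comp mK (measurable_pair1 x)).
      + apply: measurable_funeM; apply: measurableT_comp => //.
        exact/measurable_EFinP.
      + move=> y _; rewrite /K /= -EFinM lee_fin !normrM.
        by case: ifP => _; rewrite ?normr1 ?normr0 ?mulr1// mulr0 mulr_ge0.
  rewrite ge0_integralZl//; last first.
    by apply: measurableT_comp => //; exact/measurable_EFinP.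
  by apply: lte_mul_pinfty => //; [rewrite ge0_fin_numE|have /integrableP[] := ig].
have in1 s : (\int[mu]_t (K (s, t))%:E)%E = (g s * \int[mu]_(t in `]-oo, s[) h t)%:E.
  have ihs : mu.-integrable `]-oo, s[ (EFin \o h) by exact: integrableS ih.
  rewrite EFinM fineK; last exact: integrable_fin_num.
  rewrite -integralZl// integral_mkcond; apply: eq_integral => t _.
  rewrite /K /= patchE mem_setE in_itv/=.
  by case: ifP; rewrite ?mulr1 ?mulr0.
have in2 t : (\int[mu]_s (K (s, t))%:E)%E = (h t * \int[mu]_(s in `]t, +oo[) g s)%:E.
  have igt : mu.-integrable `]t, +oo[ (EFin \o g) by exact: integrableS ig.
  rewrite EFinM fineK; last exact: integrable_fin_num.
  rewrite -integralZl// integral_mkcond; apply: eq_integral => s _.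
  rewrite /K /= patchE mem_setE in_itv/= andbT.
  by case: ifP; rewrite ?mulr1 ?mulr0// EFinM muleC.
rewrite /Rintegral; congr fine.
under eq_integral do rewrite -in1.
under [RHS]eq_integral do rewrite -in2.
exact: (@Fubini _ _ _ _ _ mu mu (EFin \o K)).
Qed.

End FubiniTriangle.

Section AbsolutelyContinuous.
Variable R : realType.
Local Notation mu := (@lebesgue_measure R).
Local Notation I l := (`]0, l[%classic : set R).
Implicit Types (l x y : R) (f g h F G H : R -> R).

Lemma mI l : measurable (I l : set (measurableTypeR R)).
Proof. exact: measurable_itv. Qed.
Lemma finI l : (mu (I l) < +oo)%E.
Proof. by rewrite lebesgue_measure_itv/=; case: ifP => _; rewrite -?EFinB ltry. Qed.
Hint Resolve mI finI : core.

(** For x >= 0 this is the primitive of g vanishing at 0. *)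
Definition prim g x : R := \int[mu]_(t in I x) g t.

Lemma subI x l : x <= l -> I x `<=` I l.
Proof. by move=> xl; apply: subset_itvl; rewrite bnd_simp. Qed.

Lemma rsqS x l g : x <= l -> rsq (I l) g -> rsq (I x) g.
Proof.
move=> xl [mg g2]; split; first by apply: measurable_funS mg; [exact: measurable_itv|exact: subI].
by apply: integrableS g2 => //; exact: subI.
Qed.

Lemma integrableI x l g : x <= l -> mu.-integrable (I l) (EFin \o g) ->
  mu.-integrable (I x) (EFin \o g).
Proof. by move=> xl; apply: integrableS => //; exact: subI. Qed.

Lemma prim0 g : prim g 0 = 0.
Proof. by rewrite /prim set_itv_ge ?Rintegral_set0//= bnd_simp ltxx. Qed.

Lemma prim_cst x (a : R) : 0 <= x -> prim (fun=> a) x = x * a.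
Proof.
move=> x0; rewrite /prim Rintegral_cst// mulrC; congr (_ * _).
have E : mu (I x) = x%:E.
  rewrite lebesgue_measure_itv/= lte_fin -EFinB subr0.
  by have [//|x0'] := ltP 0 x; congr EFin; apply/eqP; rewrite eq_le x0 x0'.
exact: (congr1 fine E).
Qed.

Lemma prim_continuous l g : 0 <= l -> mu.-integrable (I l) (EFin \o g) ->
  {within `[0, l], continuous (prim g)}.
Proof.
move=> l0 ig; pose g' := g \_ (I l).
have ig' : mu.-integrable `[0, l] (EFin \o g').
  rewrite -restrict_EFin; apply/integrable_restrict => //.
  rewrite setIidr//; exact: subset_itv_oo_cc.
have := parameterized_integral_continuous l0 ig'.
apply: subspace_eq_continuous => x /set_mem/=; rewrite in_itv/= => /andP[x0 xl].
rewrite /parameterized_integral /prim.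
have ix : mu.-integrable `[0, x] (EFin \o g').
  by apply: integrableS ig' => //; apply: subset_itvl; rewrite bnd_simp.
transitivity (\int[mu]_(t in `]0, x[) g' t).
  rewrite Rintegral_itv_bndo_bndc; last first.
    by apply: integrableS ix => //; apply: subset_itv; rewrite bnd_simp.
  rewrite Rintegral_itv_obnd_cbnd//.
  by apply: integrableS ix => //; apply: subset_itv; rewrite bnd_simp.
apply: eq_Rintegral => t /set_mem tx; rewrite /g' patchE mem_set//.
exact: subI tx.
Qed.

Lemma within_measurable l F : {within `[0, l], continuous F} ->
  measurable_fun (I l) F.
Proof.
move=> cF; have : measurable_fun (`[0, l]%classic : set R) F.
  by apply: subspace_continuous_measurable_fun => //; exact: measurable_itv.
apply: measurable_funS; [exact: measurable_itv|exact: subset_itv_oo_cc].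
Qed.

Lemma prim_bound l g x : 0 <= x <= l -> mu.-integrable (I l) (EFin \o g) ->
  `|prim g x| <= \int[mu]_(t in I l) `|g t|.
Proof.
move=> /andP[x0 xl] ig; have igx := integrableI xl ig.
apply: (le_trans (le_normr_Rintegral (mI x) igx)).
have iag : mu.-integrable (I l) (EFin \o (fun t => `|g t|)) by exact: integrable_norm.
have iagx := integrableI xl iag.
rewrite -lee_fin !fineK; [|exact: integrable_fin_num..].
apply: ge0_subset_integral => //; last exact: subI.
by have /measurable_int := iag.
Qed.

Lemma primB l g x y : 0 <= x -> x <= y -> y <= l -> mu.-integrable (I l) (EFin \o g) ->
  prim g y - prim g x = \int[mu]_(t in `]x, y[) g t.
Proof.
move=> x0 xy yl ig; have igy := integrableI yl ig.
have [<-|ynx] := eqVneq x y; first by rewrite subrr set_itv_ge ?Rintegral_set0//= bnd_simp ltxx.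
rewrite /prim [X in _ - X]Rintegral_itv_bndo_bndc; last exact: integrableI igy.
apply: Rintegral_itvB => //; rewrite bnd_simp//.
by rewrite lt_neqAle ynx.
Qed.

(** Integration by parts is Fubini's theorem on the triangle 0 < t < s < l,
    with g and h extended by 0. *)
Lemma prim_parts l g h : 0 <= l ->
  mu.-integrable (I l) (EFin \o g) -> mu.-integrable (I l) (EFin \o h) ->
  mu.-integrable (I l) (EFin \o (fun x => h x * prim g x)) ->
  \int[mu]_(x in I l) (g x * prim h x) + \int[mu]_(x in I l) (h x * prim g x)
  = prim g l * prim h l.
Proof.
move=> l0 ig ih ihg.
have iT f : mu.-integrable (I l) (EFin \o f) -> mu.-integrable setT (EFin \o (f \_ (I l))).
  by move=> i; rewrite -restrict_EFin; apply/integrable_restrict => //; rewrite setTI.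
have T := fubini_triangle (iT _ ig) (iT _ ih).
have E1 : \int[mu]_s ((g \_ (I l)) s * \int[mu]_(t in `]-oo, s[) (h \_ (I l)) t) =
    \int[mu]_(x in I l) (g x * prim h x).
  rewrite [RHS]Rintegral_mkcond; apply: eq_Rintegral => s _.
  rewrite !patchE; case: ifPn => [/set_mem|_]; last by rewrite mul0r.
  rewrite /= in_itv/= => /andP[s0 sl]; congr (_ * _).
  rewrite -Rintegral_mkcondr /prim; congr (Rintegral _ _ _).
  apply/seteqP; split => t /=; rewrite !in_itv/=; first by move=> [-> /andP[->]].
  by move=> /andP[-> ts]; rewrite ts (lt_trans ts sl).
have E2 : \int[mu]_t ((h \_ (I l)) t * \int[mu]_(s in `]t, +oo[) (g \_ (I l)) s) =
    \int[mu]_(x in I l) (h x * (prim g l - prim g x)).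
  rewrite [RHS]Rintegral_mkcond; apply: eq_Rintegral => s _.
  rewrite !patchE; case: ifPn => [/set_mem|_]; last by rewrite mul0r.
  rewrite /= in_itv/= => /andP[s0 sl]; congr (_ * _).
  rewrite (primB (ltW s0) (ltW sl) (lexx _) ig).
  rewrite -Rintegral_mkcondr; congr (Rintegral _ _ _).
  apply/seteqP; split => t /=; rewrite !in_itv/= ?andbT; first by move=> [-> /andP[_ ->]].
  by move=> /andP[st ->]; rewrite st (lt_trans s0 st).
rewrite -E1 T E2.
have -> : (fun x => h x * (prim g l - prim g x)) =
    (fun x => prim g l * h x - h x * prim g x) by apply/funext => x; ring.
rewrite RintegralB//; last first.
  by have := integrableZl (mI l) (prim g l) ih; apply: eq_integrable.
by rewrite subrK RintegralZl.
Qed.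

(** By Lebesgue's differentiation theorem. *)
Lemma prim_eq0 l g : mu.-integrable (I l) (EFin \o g) ->
  (forall x, 0 <= x <= l -> prim g x = 0) ->
  {ae mu, forall x, I l x -> g x = 0}.
Proof.
move=> ig g0; pose g' := g \_ (I l).
have ig' : mu.-integrable setT (EFin \o g').
  by rewrite -restrict_EFin; apply/integrable_restrict => //; rewrite setTI.
have igl : locally_integrable setT g' by exact: integrable_locally.
have iy y : mu.-integrable [set` Interval (BRight 0) (BRight y)] (EFin \o g').
  by apply: integrableS ig'.
have := @FTC1 _ g' (BRight 0) iy igl.
apply: ae_imp => x /= H.
rewrite in_itv/= => /andP[x0 xl].
have {H} [_ H] := H x0.
have <- : g' x = g x by rewrite /g' patchE mem_set//= in_itv/= x0.
rewrite -H; rewrite derive1E.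
have E : \forall y \near x, \int[mu]_(t in `]0, y]) g' t = cst 0 y.
  near=> y.
  have y0 : 0 < y by near: y; exact: lt_nbhsr.
  have yl : y < l by near: y; exact: lt_nbhsl.
  rewrite -Rintegral_itv_bndo_bndc; last exact: integrableS ig'.
  rewrite -[RHS](g0 y) ?(ltW y0) ?ltW//; apply: eq_Rintegral => t /set_mem ty.
  by rewrite /g' patchE mem_set//; apply: subI ty; exact: ltW.
rewrite (near_eq_derive _ E)//; exact: derive_cst.
Unshelve. all: by end_near. Qed.

Lemma within_cont_dist l h x e : {within `[0, l], continuous h} -> 0 <= x <= l -> 0 < e ->
  exists2 d, 0 < d & forall y, 0 <= y <= l -> `|x - y| < d -> `|h x - h y| < e.
Proof.
move=> /subspace_continuousP ch xl e0.
have xI : `[0, l]%classic x by rewrite /= in_itv/=.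
have /cvgrPdist_lt/(_ _ e0) := ch x xI.
move=> /nbhs_ballP[d /= d0 dP]; exists d => // y yl xy.
by apply: dP => //; rewrite /= in_itv/=.
Qed.

(** A point where F and G differ has a neighbourhood in [c, d] where they differ,
    and this neighbourhood has positive measure. *)
Lemma continuous_ae_eq l c d F G : 0 <= c -> c < d -> d <= l ->
  {within `[0, l], continuous F} -> {within `[0, l], continuous G} ->
  {ae mu, forall x, `]c, d[%classic x -> F x = G x} ->
  forall x, c <= x <= d -> F x = G x.
Proof.
move=> c0 cd dl cF cG FG x /andP[cx xd]; apply/eqP/negPn/negP => nFG.
have cH := within_continuousB cF cG.
have e0 : 0 < `|F x - G x| by rewrite normr_gt0 subr_eq0.
have xl : 0 <= x <= l by rewrite (le_trans c0 cx) (le_trans xd dl).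
have [r r0 rP] := within_cont_dist cH xl e0.
pose a := Num.max c (x - r); pose b := Num.min d (x + r).
have ab : a < b.
  rewrite /a /b lt_min !gt_max.
  by apply/andP; split; apply/andP; split; lra.
have neg : mu.-negligible (`]a, b[%classic : set R).
  apply: negligibleS FG => y /=; rewrite in_itv/= /a /b gt_max lt_min.
  move=> /andP[/andP[y0 xdy] /andP[yl yxd]] H.
  have E : F y = G y by apply: H; rewrite in_itv/= y0.
  have yl' : 0 <= y <= l by apply/andP; split; lra.
  have xyr : `|x - y| < r by rewrite ltr_norml; apply/andP; split; lra.
  have := rP y yl' xyr.
  rewrite /= -[(F - G) x]/(F x - G x) -[(F - G) y]/(F y - G y).
  by rewrite E subrr subr0 ltxx.
have mab : measurable (`]a, b[%classic : set (measurableTypeR R)) by exact: measurable_itv.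
have := measure_negligible mab neg.
rewrite /= lebesgue_measure_itv/= lte_fin ab -EFinB => -[] /eqP.
by rewrite subr_eq0 gt_eqF.
Qed.

Lemma prim_ae l g h x : x <= l -> rsq (I l) g -> rsq (I l) h ->
  {ae mu, forall x, I l x -> g x = h x} -> prim g x = prim h x.
Proof.
move=> xl rg rh gh; have [mg _] := rsqS xl rg; have [mh _] := rsqS xl rh.
rewrite /prim /Rintegral; congr fine; apply: ae_eq_integral => //.
- exact: measurable_funE mg.
- exact: measurable_funE mh.
- move: gh; apply: ae_imp => y H yx.
  by rewrite H//; exact: subI yx.
Qed.

(** F is absolutely continuous on [0, l] with a square integrable derivative
    g. *)
Definition rac l F g : Prop :=
  rsq (I l) g /\ forall x, 0 <= x <= l -> F x = F 0 + prim g x.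

Section Rac.
Variable l : R.
Hypothesis l0 : 0 < l.
Let intI f (rf : rsq (I l) f) : mu.-integrable (I l) (EFin \o f) :=
  rsq_int (mI l) (finI l) rf.

Lemma rac_prim g c : rsq (I l) g -> rac l (fun x => c + prim g x) g.
Proof. by move=> rg; split=> // x _; rewrite prim0 addr0. Qed.

Lemma rac_continuous F g : rac l F g -> {within `[0, l], continuous F}.
Proof.
move=> [rg FE].
have c1 := prim_continuous (ltW l0) (intI rg).
have c0 : {within `[0, l], continuous (cst (F 0) : R -> R)}.
  by apply: continuous_subspaceT => z; exact: cst_continuous.
have := within_continuousD c0 c1.
apply: subspace_eq_continuous => x /set_mem/=; rewrite in_itv/= => xl.
exact/esym/(FE _ xl).
Qed.

Lemma rac_bound F g : rac l F g -> exists M, forall x, 0 <= x <= l -> `|F x| <= M.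
Proof.
move=> [rg FE]; exists (`|F 0| + \int[mu]_(t in I l) `|g t|) => x xl.
rewrite (FE _ xl) (le_trans (ler_normD _ _))// lerD2l.
by apply: (prim_bound xl); exact: intI.
Qed.

Lemma rac_measurable F g : rac l F g -> measurable_fun (I l) F.
Proof. by move=> /rac_continuous; exact: within_measurable. Qed.

Lemma Ibnd (P : R -> Prop) : (forall x, 0 <= x <= l -> P x) -> forall x, I l x -> P x.
Proof. by move=> H x; rewrite /= in_itv/= => /andP[x0 xl]; apply: H; rewrite !ltW. Qed.

Lemma rac_rsq F g : rac l F g -> rsq (I l) F.
Proof.
move=> rF; have [M MP] := rac_bound rF.
by apply: (rsq_bounded (mI l) (finI l) (rac_measurable rF) (M := M)); exact: Ibnd.
Qed.

Lemma rac_ae F g h : rac l F g -> rsq (I l) h ->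
  {ae mu, forall x, I l x -> g x = h x} -> rac l F h.
Proof.
move=> [rg FE] rh gh; split=> // x xl; rewrite (FE _ xl); congr (_ + _).
by apply: prim_ae gh => //; case/andP: xl.
Qed.

Lemma primD f g x : x <= l -> rsq (I l) f -> rsq (I l) g ->
  prim (fun t => f t + g t) x = prim f x + prim g x.
Proof.
move=> xl rf rg; rewrite /prim RintegralD//; apply: (integrableI xl); exact: intI.
Qed.

Lemma primZ a f x : x <= l -> rsq (I l) f ->
  prim (fun t => a * f t) x = a * prim f x.
Proof.
move=> xl rf; rewrite /prim RintegralZl//; apply: (integrableI xl); exact: intI.
Qed.

Lemma racD F g H h : rac l F g -> rac l H h ->
  rac l (fun x => F x + H x) (fun x => g x + h x).
Proof.
move=> [rg FE] [rh HE]; split; first exact: rsqD.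
move=> x xl; rewrite (FE _ xl) (HE _ xl) primD//; [ring|by case/andP: xl].
Qed.

Lemma racZ a F g : rac l F g -> rac l (fun x => a * F x) (fun x => a * g x).
Proof.
move=> [rg FE]; split; first exact: rsqZ.
move=> x xl; rewrite (FE _ xl) primZ//; [ring|by case/andP: xl].
Qed.

Lemma rac_cst c : rac l (fun=> c) (fun=> 0).
Proof.
split; first exact: rsq_cst.
by move=> x _; rewrite /prim Rintegral_cst// mul0r addr0.
Qed.

Lemma rac_id : rac l id (fun=> 1).
Proof.
split; first exact: rsq_cst.
by move=> x /andP[x0 _]; rewrite prim_cst// mulr1 add0r.
Qed.

(** The product rule in integrated form: expand both primitives and apply
    [prim_parts]. *)
Lemma racM F g H h : rac l F g -> rac l H h ->
  rac l (fun x => F x * H x) (fun x => g x * H x + F x * h x).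
Proof.
move=> rF rH; have [rg FE] := rF; have [rh HE] := rH.
have [MF FM] := rac_bound rF; have [MH HM] := rac_bound rH.
have r1 : rsq (I l) (fun x => H x * g x).
  by apply: (rsqM_bounded (mI l) (rac_measurable rH) (M := MH)) => //; exact: Ibnd.
have r2 : rsq (I l) (fun x => F x * h x).
  by apply: (rsqM_bounded (mI l) (rac_measurable rF) (M := MF)) => //; exact: Ibnd.
have r1' : rsq (I l) (fun x => g x * H x).
  by move: r1; congr rsq; apply/funext => x; rewrite mulrC.
split; first exact: rsqD.
move=> x xl; have /andP[x0 xl'] := xl.
have rp k : rsq (I l) k -> rsq (I l) (prim k).
  move=> rk; have := rac_rsq (rac_prim 0 rk).
  by congr rsq; apply/funext => t; rewrite add0r.
have ixg := integrableI xl' (intI rg); have ixh := integrableI xl' (intI rh).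
have rb k m : rsq (I l) k -> rsq (I l) m ->
    rsq (I l) (fun t => k t * prim m t).
  move=> rk rm; have := rac_prim 0 rm => rm0.
  have [M MP] := rac_bound rm0.
  have := rsqM_bounded (mI l) (rac_measurable rm0) (M := M) (Ibnd MP) rk.
  by congr rsq; apply/funext => t; rewrite add0r mulrC.
have P := prim_parts x0 ixg ixh (integrableI xl' (intI (rb _ _ rh rg))).
rewrite primD//.
have E1 : prim (fun t => g t * H t) x = H 0 * prim g x + prim (fun t => g t * prim h t) x.
  rewrite -primZ// -primD//; [|exact: rsqZ|exact: rb].
  apply: eq_Rintegral => t /set_mem; rewrite /= in_itv/= => /andP[t0 tx].
  by rewrite (HE t) ?(ltW t0) ?(ltW (lt_le_trans tx xl'))//; ring.
have E2 : prim (fun t => F t * h t) x = F 0 * prim h x + prim (fun t => h t * prim g t) x.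
  rewrite -primZ// -primD//; [|exact: rsqZ|exact: rb].
  apply: eq_Rintegral => t /set_mem; rewrite /= in_itv/= => /andP[t0 tx].
  by rewrite (FE t) ?(ltW t0) ?(ltW (lt_le_trans tx xl'))//; ring.
rewrite E1 E2 (FE _ xl) (HE _ xl).
move: P; rewrite -/(prim _ x) -/(prim (fun t => h t * prim g t) x) => P.
have -> : (F 0 + prim g x) * (H 0 + prim h x) =
  F 0 * H 0 + F 0 * prim h x + H 0 * prim g x + prim g x * prim h x by ring.
rewrite -P; ring.
Qed.

Lemma rac_unique F g h : rac l F g -> rac l F h ->
  {ae mu, forall x, I l x -> g x = h x}.
Proof.
move=> [rg FE] [rh FE'].
have rgh : rsq (I l) (fun x => g x + -1 * h x) by apply: rsqD => //; exact: rsqZ.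
have := prim_eq0 (intI rgh).
have P0 x : 0 <= x <= l -> prim (fun x => g x + -1 * h x) x = 0.
  move=> xl; have /andP[_ xl'] := xl.
  rewrite primD ?primZ//; last exact: rsqZ.
  by have := FE _ xl; rewrite (FE' _ xl) => /addrI ->; ring.
move=> /(_ P0); apply: ae_imp => x H Ix.
by apply/eqP; rewrite -subr_eq0 -mulN1r; apply/eqP; exact: H.
Qed.

Lemma rac_ae_eq F g G h : rac l F g -> rac l G h ->
  {ae mu, forall x, I l x -> F x = G x} -> forall x, 0 <= x <= l -> F x = G x.
Proof.
by move=> rF rG; apply: (@continuous_ae_eq l 0 l) => //; [exact: rac_continuous rF|exact: rac_continuous rG].
Qed.

End Rac.
End AbsolutelyContinuous.

(** * Complex square integrable functions on an interval *)

Section ComplexL2.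
Variable R : realType.
Local Notation mu := (@lebesgue_measure R).
Local Notation I l := (`]0, l[%classic : set R).
Implicit Types (l x : R) (f g h F G H : R -> R[i]).
Hint Resolve mI finI : core.

Definition re_part f : R -> R := fun x => ReC (f x).
Definition im_part f : R -> R := fun x => ImC (f x).

Lemma sqiP l f :
  square_integrable l f <-> rsq (I l) (re_part f) /\ rsq (I l) (im_part f).
Proof.
split=> [[mr mi i]|[[mr ir] [mi ii]]]; last first.
  split=> //; have := integrableD (mI l) ir ii.
  by apply: eq_integrable.
split; (apply: (@rsq_le _ _ (mI l) _ (fun x => ReC (f x) ^+ 2 + ImC (f x) ^+ 2)) => //).
- by move=> x _; rewrite lerDl sqr_ge0.
- by move=> x _; rewrite lerDr sqr_ge0.
Qed.

Definition cintg l f : Prop :=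
  mu.-integrable (I l) (EFin \o re_part f) /\ mu.-integrable (I l) (EFin \o im_part f).

Lemma Re_cintegral l f : ReC (cintegral l f) = prim (re_part f) l. Proof. by []. Qed.
Lemma Im_cintegral l f : ImC (cintegral l f) = prim (im_part f) l. Proof. by []. Qed.

Lemma integrable_eqfun l (f g : R -> R) : f =1 g ->
  mu.-integrable (I l) (EFin \o f) -> mu.-integrable (I l) (EFin \o g).
Proof. by move=> fg; have -> : f = g by exact/funext. Qed.

Lemma cintegralD l f g : cintg l f -> cintg l g ->
  cintegral l (fun x => f x + g x) = cintegral l f + cintegral l g.
Proof.
move=> [fr fi] [gr gi]; apply: complex_eq.
- rewrite cReD !Re_cintegral /prim -RintegralD//; apply: eq_Rintegral => x _; exact: cReD.
- rewrite cImD !Im_cintegral /prim -RintegralD//; apply: eq_Rintegral => x _; exact: cImD.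
Qed.

Lemma cintgZ l a f : cintg l f -> cintg l (fun x => a * f x).
Proof.
move=> [fr fi]; split.
- have := integrableB (mI l) (integrableZl (mI l) (ReC a) fr) (integrableZl (mI l) (ImC a) fi).
  by apply: integrable_eqfun => x; rewrite /re_part cReM.
- have := integrableD (mI l) (integrableZl (mI l) (ReC a) fi) (integrableZl (mI l) (ImC a) fr).
  by apply: integrable_eqfun => x; rewrite /im_part cImM.
Qed.

Lemma cintegralZ l a f : cintg l f ->
  cintegral l (fun x => a * f x) = a * cintegral l f.
Proof.
move=> [fr fi]; have Zi (b : R) (k : R -> R) : mu.-integrable (I l) (EFin \o k) ->
    mu.-integrable (I l) (EFin \o (fun x => b * k x)).
  by move=> ik; have := integrableZl (mI l) b ik; exact: integrable_eqfun.
apply: complex_eq.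
- rewrite cReM !Re_cintegral !Im_cintegral /prim -!RintegralZl// -RintegralB//; [|exact: Zi..].
  by apply: eq_Rintegral => x _; exact: cReM.
- rewrite cImM !Re_cintegral !Im_cintegral /prim -!RintegralZl// -RintegralD//; [|exact: Zi..].
  by apply: eq_Rintegral => x _; exact: cImM.
Qed.

Lemma cintegral_cj l f : cintg l f ->
  cintegral l (fun x => cj (f x)) = cj (cintegral l f).
Proof.
move=> [fr fi]; apply: complex_eq.
- by rewrite Re_cj !Re_cintegral; apply: eq_Rintegral => x _; exact: Re_cj.
- rewrite Im_cj !Im_cintegral /prim -mulN1r -RintegralZl//; apply: eq_Rintegral => x _.
  by rewrite /im_part Im_cj mulN1r.
Qed.

Lemma sqi_mul l f g : square_integrable l f -> square_integrable l g ->
  cintg l (fun x => f x * g x).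
Proof.
move=> /sqiP[fr fi] /sqiP[gr gi]; split.
- have := integrableB (mI l) (rsq_mulint (mI l) fr gr) (rsq_mulint (mI l) fi gi).
  by apply: integrable_eqfun => x; rewrite /re_part cReM.
- have := integrableD (mI l) (rsq_mulint (mI l) fr gi) (rsq_mulint (mI l) fi gr).
  by apply: integrable_eqfun => x; rewrite /im_part cImM.
Qed.

Lemma sqi_cst l a : square_integrable l (fun=> a).
Proof. by apply/sqiP; split; apply: rsq_cst. Qed.

Lemma sqi_int l f : square_integrable l f -> cintg l f.
Proof. by move=> /sqiP[rr ri]; split; apply: rsq_int. Qed.

Lemma sqi_cj l f : square_integrable l f -> square_integrable l (fun x => cj (f x)).
Proof.
move=> /sqiP[fr fi]; apply/sqiP; split.
- by move: fr; congr rsq; apply/funext => x; rewrite /re_part Re_cj.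
- by move: (rsqN (mI l) fi); congr rsq; apply/funext => x; rewrite /im_part Im_cj.
Qed.

Lemma sqiD l f g : square_integrable l f -> square_integrable l g ->
  square_integrable l (fun x => f x + g x).
Proof.
move=> /sqiP[fr fi] /sqiP[gr gi]; apply/sqiP; split.
- by move: (rsqD (mI l) fr gr); congr rsq; apply/funext => x; rewrite /re_part cReD.
- by move: (rsqD (mI l) fi gi); congr rsq; apply/funext => x; rewrite /im_part cImD.
Qed.

Lemma sqiZ l a f : square_integrable l f -> square_integrable l (fun x => a * f x).
Proof.
move=> /sqiP[fr fi]; apply/sqiP; split.
- have := rsqB (mI l) (rsqZ (mI l) (ReC a) fr) (rsqZ (mI l) (ImC a) fi).
  by congr rsq; apply/funext => x; rewrite /re_part cReM.
- have := rsqD (mI l) (rsqZ (mI l) (ReC a) fi) (rsqZ (mI l) (ImC a) fr).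
  by congr rsq; apply/funext => x; rewrite /im_part cImM.
Qed.

Lemma sqiM_real l (q : R -> R) M f : measurable_fun (I l) q ->
  (forall x, I l x -> `|q x| <= M) -> square_integrable l f ->
  square_integrable l (fun x => (q x)%:C * f x).
Proof.
move=> mq qM /sqiP[fr fi]; apply/sqiP; split.
- have := rsqM_bounded (mI l) mq qM fr.
  by congr rsq; apply/funext => x; rewrite /re_part cReM Im_real mul0r subr0.
- have := rsqM_bounded (mI l) mq qM fi.
  by congr rsq; apply/funext => x; rewrite /im_part cImM Im_real mul0r addr0.
Qed.

Definition ipI l f g : R[i] := cintegral l (fun x => f x * cj (g x)).

Lemma semi_inner_ipI l : semi_inner (square_integrable l : set (R -> R[i])) (ipI l).
Proof.
split.
- exact: sqi_cst.
- by move=> a f g sf sg; apply: sqiD => //; exact: sqiZ.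
- move=> a f g h sf sg sh; rewrite /ipI.
  rewrite -cintegralZ; last by apply: sqi_mul => //; exact: sqi_cj.
  rewrite -cintegralD; first by congr cintegral; apply/funext => x; rewrite mulrA -mulrDl.
- by apply: cintgZ; apply: sqi_mul => //; exact: sqi_cj.
- by apply: sqi_mul => //; exact: sqi_cj.
- move=> f g sf sg; rewrite /ipI -cintegral_cj; last by apply: sqi_mul => //; exact: sqi_cj.
  by congr cintegral; apply/funext => x; rewrite cjM conjcK mulrC.
- move=> f sf; rewrite Re_cintegral; apply: Rintegral_ge0 => x _.
  by rewrite /re_part mul_cj Re_real sqmod_ge0.
Qed.

Lemma sqn_ipI l f : square_integrable l f ->
  sqn (ipI l) f = rsqn (I l) (re_part f) + rsqn (I l) (im_part f).
Proof.
move=> /sqiP[[_ fr] [_ fi]]; rewrite /sqn Re_cintegral /rsqn -RintegralD//.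
by apply: eq_Rintegral => x _; rewrite /re_part mul_cj.
Qed.

Lemma sqnE l f : sqn (ipI l) f = prim (fun x => sqmod (f x)) l.
Proof. by rewrite /sqn Re_cintegral; apply: eq_Rintegral => x _; rewrite /re_part mul_cj. Qed.

Lemma sqmod_integrable l f : square_integrable l f ->
  mu.-integrable (I l) (EFin \o (fun x => sqmod (f x))).
Proof.
move=> sf; have [+ _] := sqi_mul sf (sqi_cj sf).
by apply: integrable_eqfun => x; rewrite /re_part mul_cj.
Qed.

Lemma sqn_le l f g : square_integrable l f -> square_integrable l g ->
  (forall x, I l x -> sqmod (f x) <= sqmod (g x)) -> sqn (ipI l) f <= sqn (ipI l) g.
Proof. by move=> sf sg fg; rewrite !sqnE; apply: le_Rintegral => //; exact: sqmod_integrable. Qed.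

Lemma sqn_cst l a : 0 <= l -> sqn (ipI l) (fun=> a) = l * sqmod a.
Proof. by move=> l0; rewrite sqnE prim_cst. Qed.

(** Real and imaginary parts converge separately by [rsq_complete]. *)
Lemma complete_ipI l : complete_ip (square_integrable l : set (R -> R[i])) (ipI l).
Proof.
move=> u_ su cu; have HS := semi_inner_ipI l.
have sB m n : square_integrable l (u_ m - u_ n) by exact: (siB HS).
have [hr rr hrP] : exists2 h, rsq (I l) h & forall e, 0 < e -> exists N,
    forall n, (N <= n)%N -> rsqn (I l) (fun x => re_part (u_ n) x - h x) <= e.
  apply: (@rsq_complete _ _ (mI l) (finI l) (fun n => re_part (u_ n))).
    by move=> n; have /sqiP[] := su n.
  move=> e e0; have [N NP] := cu e e0; exists N => m n Nm Nn.
  apply: le_lt_trans (NP _ _ Nm Nn); rewrite sqn_ipI//.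
  rewrite (_ : (fun x => _) = re_part (u_ m - u_ n)) ?lerDl ?rsqn_ge0//.
  by apply/funext => x; rewrite /re_part -cReB.
have [hi ri hiP] : exists2 h, rsq (I l) h & forall e, 0 < e -> exists N,
    forall n, (N <= n)%N -> rsqn (I l) (fun x => im_part (u_ n) x - h x) <= e.
  apply: (@rsq_complete _ _ (mI l) (finI l) (fun n => im_part (u_ n))).
    by move=> n; have /sqiP[] := su n.
  move=> e e0; have [N NP] := cu e e0; exists N => m n Nm Nn.
  apply: le_lt_trans (NP _ _ Nm Nn); rewrite sqn_ipI//.
  rewrite (_ : (fun x => _) = im_part (u_ m - u_ n)) ?lerDr ?rsqn_ge0//.
  by apply/funext => x; rewrite /im_part -cImB.
pose u x := hr x +i* hi x.
have su' : square_integrable l u by apply/sqiP.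
exists u => //; apply/cvgr0Pnorm_le => e e0.
have e2 : 0 < e / 2 by rewrite divr_gt0.
have [N1 N1P] := hrP _ e2; have [N2 N2P] := hiP _ e2.
exists (maxn N1 N2) => // n /=; rewrite geq_max => /andP[n1 n2].
have sB' : square_integrable l (u_ n - u) by exact: (siB HS).
rewrite ger0_norm; last by apply: (sqn_ge0 HS).
rewrite sqn_ipI//.
have := N1P _ n1; have := N2P _ n2.
rewrite (_ : (fun x => _) = im_part (u_ n - u)); last first.
  by apply/funext => x; rewrite /im_part cImB.
rewrite (_ : (fun x => _) = re_part (u_ n - u)); last first.
  by apply/funext => x; rewrite /re_part cReB.
lra.
Qed.

(** The primitive of the nonnegative function |f|^2 vanishes at l, hence
    everywhere, and so does its density. *)
Lemma sqn_ipI_eq0 l f : square_integrable l f -> sqn (ipI l) f = 0 ->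
  ae_equal l f (fun=> 0).
Proof.
move=> sf; rewrite sqnE => E; have im := sqmod_integrable sf.
apply: (ae_imp _ (prim_eq0 im _)) => [x Hx Ix|x /andP[x0 xl]].
  by apply: sqmod_eq0; exact: Hx.
apply/eqP; rewrite eq_le; apply/andP; split; last first.
  by apply: Rintegral_ge0 => t _; exact: sqmod_ge0.
rewrite -E -subr_ge0 (primB x0 xl (lexx _) im).
by apply: Rintegral_ge0 => t _; exact: sqmod_ge0.
Qed.

Lemma cintegral_ae l f g : cintg l f -> cintg l g -> ae_equal l f g ->
  cintegral l f = cintegral l g.
Proof.
move=> [fr fi] [gr gi] fg; apply: complex_eq.
- rewrite !Re_cintegral /prim /Rintegral; congr fine; apply: ae_eq_integral => //.
  + by have /measurable_int := fr.
  + by have /measurable_int := gr.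
  + by move: fg; apply: ae_imp => x H /H; rewrite /= /re_part => ->.
- rewrite !Im_cintegral /prim /Rintegral; congr fine; apply: ae_eq_integral => //.
  + by have /measurable_int := fi.
  + by have /measurable_int := gi.
  + by move: fg; apply: ae_imp => x H /H; rewrite /= /im_part => ->.
Qed.

Lemma ae_equal_sqn0 l f : square_integrable l f -> ae_equal l f (fun=> 0) ->
  sqn (ipI l) f = 0.
Proof.
move=> sf f0; rewrite /sqn /ipI (@cintegral_ae l _ (fun=> 0)).
- by rewrite Re_cintegral /prim Rintegral_cst// mul0r.
- by apply: sqi_mul => //; exact: sqi_cj.
- by apply: sqi_int; exact: sqi_cst.
- move: f0; apply: ae_imp => x H /H ->.
  by rewrite mul0r.
Qed.

End ComplexL2.

(** * Test functions and the lemma of du Bois-Reymond *)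

Section DuBoisReymond.
Variable R : realType.
Local Notation mu := (@lebesgue_measure R).
Local Notation I l := (`]0, l[%classic : set R).
Implicit Types (l x a b : R) (v h : R -> R).
Hint Resolve mI finI : core.

Lemma prim_vanish v x a : x <= a -> (forall t, t < a -> v t = 0) -> prim v x = 0.
Proof.
move=> xa v0; rewrite /prim (@eq_Rintegral _ _ _ _ _ (fun=> 0)).
  by rewrite Rintegral_cst// mul0r.
by move=> t /set_mem; rewrite /= in_itv/= => /andP[_ tx]; apply: v0; exact: lt_le_trans xa.
Qed.

Lemma prim_const v x b : 0 <= b -> b <= x -> (forall t, b < t -> v t = 0) ->
  mu.-integrable (I x) (EFin \o v) -> prim v x = prim v b.
Proof.
move=> b0 bx v0 iv; apply/eqP; rewrite -subr_eq0 (primB b0 bx (lexx _) iv); apply/eqP.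
rewrite (@eq_Rintegral _ _ _ _ _ (fun=> 0)); first by rewrite Rintegral_cst// mul0r.
by move=> t /set_mem; rewrite /= in_itv/= => /andP[bt _]; apply: v0.
Qed.

Lemma prim_continuous_at v x : 0 < x ->
  (forall y, mu.-integrable (I y) (EFin \o v)) -> {for x, continuous (prim v)}.
Proof.
move=> x0 iv; have l0 : 0 < x + 1 by lra.
have /(continuous_within_itvP _ l0)[c _ _] := prim_continuous (ltW l0) (iv (x + 1)).
by apply: c; rewrite in_itv/= x0 ltrDl ltr01.
Qed.

Lemma prim_derivable v x : 0 < x ->
  (forall y, mu.-integrable (I y) (EFin \o v)) -> {for x, continuous v} ->
  derivable (prim v) x 1 /\ derive1 (prim v) x = v x.
Proof.
move=> x0 iv cv.
have -> : prim v = (fun y => \int[mu]_(t in [set` Interval (BRight 0) (BRight y)]) v t).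
  apply/funext => y; rewrite /prim Rintegral_itv_bndo_bndc//; exact: iv.
apply: (@continuous_FTC1 _ v (BRight 0) x (x + 1)) => //; first by rewrite ltrDl ltr01.
have := iv (x + 2); apply: integrableS => //.
by apply: subset_itvl; rewrite bnd_simp ltrD2l ltr1n.
Qed.

Lemma near0_derivable (F : R -> R) x : (\forall y \near x, F y = 0) ->
  derivable F x 1 /\ derive1 F x = 0.
Proof.
move=> F0; have E : {near x, cst 0 =1 F} by apply: filterS F0.
split; first by apply: (near_eq_derivable E); exact: derivable_cst.
by rewrite derive1E -(near_eq_derive _ E); exact: derive_cst.
Qed.

(** Test functions are obtained by integrating v twice: the vanishing moments
    say that the first and second primitives return to 0 to the right of the
    support of v.  As test functions are only of class C^1, the density v may
    be any square integrable function. *)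
Lemma moment_free_test l a b v : 0 < a -> a <= b -> b < l ->
  rsq (I l) v -> (forall t, ~ (a <= t <= b) -> v t = 0) ->
  prim v l = 0 -> prim (fun t => t * v t) l = 0 ->
  exists phi, test_function l phi /\ derive1 phi = prim v.
Proof.
move=> a0 ab bl rv v0 m0 m1.
have l0 : 0 < l by lra.
have va t : t < a -> v t = 0 by move=> ta; apply: v0 => /andP[]; lra.
have vb t : b < t -> v t = 0 by move=> ta; apply: v0 => /andP[]; lra.
have iv y : mu.-integrable (I y) (EFin \o v).
  have ivl := rsq_int (mI l) (finI l) rv.
  have : mu.-integrable setT (EFin \o (v \_ (I l))).
    by rewrite -restrict_EFin; apply/integrable_restrict => //; rewrite setTI.
  have -> : v \_ (I l) = v.
    apply/funext => t; rewrite patchE; case: ifPn => // /negP tl.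
    apply/esym/v0 => /andP[a1 b1]; apply: tl; apply/mem_set.
    by rewrite /= in_itv/= (lt_le_trans a0 a1) (le_lt_trans b1 bl).
  by apply: integrableS.
have psi_a x : x <= a -> prim v x = 0 by move=> xa; exact: prim_vanish va.
have psi_b x : b <= x -> prim v x = 0.
  have b0 : 0 <= b by lra.
  move=> bx; rewrite (prim_const b0 bx vb (iv _)).
  by rewrite -(prim_const b0 (ltW bl) vb (iv _)).
have cpsi : continuous (prim v).
  move=> x; have [x0|x0] := ltP 0 x; first exact: prim_continuous_at.
  have xa : x < a by lra.
  have n0 : \forall y \near x, prim v y = 0.
    by near=> y; apply/psi_a/ltW; near: y; exact: lt_nbhsl.
  apply: near_cst_continuous; exact: n0.
have ipsi y : mu.-integrable (I y) (EFin \o prim v).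
  have : mu.-integrable `[0, y] (EFin \o prim v).
    apply: continuous_compact_integrable; first exact: segment_compact.
    exact: continuous_subspaceT.
  by apply: integrableS => //; exact: subset_itv_oo_cc.
have phi_a x : x <= a -> prim (prim v) x = 0.
  by move=> xa; apply: (prim_vanish xa) => t /ltW; exact: psi_a.
have phi_l : prim (prim v) l = 0.
  have rp := rac_prim 0 rv.
  have [_ /(_ l)] := racM l0 (rac_id l) rp.
  rewrite lexx ltW//= => /(_ isT).
  rewrite prim0 m0 addr0 !mulr0 add0r => E.
  have : prim (fun x => 1 * (0 + prim v x)) l + prim (fun x => x * v x) l = 0.
    rewrite -(@primD _ l)//.
    - by move: (rac_rsq l0 rp); congr rsq; apply/funext => t; rewrite mul1r.
    - have [M MP] := rac_bound (rac_id l).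
      apply: (rsqM_bounded (mI l) (rac_measurable l0 (rac_id l)) (M := M)) => //.
      exact: Ibnd.
  rewrite m1 addr0 => <-; congr prim; apply/funext => t; by rewrite mul1r add0r.
have phi_b x : b <= x -> prim (prim v) x = 0.
  have b0 : 0 <= b by lra.
  have psib t : b < t -> prim v t = 0 by move=> /ltW; exact: psi_b.
  move=> bx; rewrite (prim_const b0 bx psib (ipsi _)).
  by rewrite -(prim_const b0 (ltW bl) psib (ipsi _)).
have dphi x : derivable (prim (prim v)) x 1 /\ derive1 (prim (prim v)) x = prim v x.
  have [x0|x0] := ltP 0 x; first by apply: prim_derivable => //; exact: cpsi.
  have xa : x < a by lra.
  rewrite (psi_a _ (ltW xa)); apply: near0_derivable.
  by near=> y; apply/phi_a/ltW; near: y; exact: lt_nbhsl.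
have Ephi : derive1 (prim (prim v)) = prim v by apply/funext => x; have [] := dphi x.
exists (prim (prim v)); split=> //; split.
- by move=> x; have [] := dphi x.
- by rewrite Ephi.
- exists a, b; split=> // x /negP; rewrite negb_and -!ltNge => /orP[/ltW xa|/ltW xb].
    exact: phi_a.
  exact: phi_b.
Unshelve. all: by end_near. Qed.

Lemma rsq_null_ae l v : rsq (I l) v -> prim (fun t => v t * v t) l = 0 ->
  {ae mu, forall x, I l x -> v x = 0}.
Proof.
move=> rv v0; pose f x : R[i] := (v x)%:C.
have sf : square_integrable l f.
  by apply/sqiP; split; [exact: rv|exact: (rsq_cst (mI l) (finI l) 0)].
have f0 : sqn (ipI l) f = 0.
  rewrite /sqn Re_cintegral -[RHS]v0; apply: eq_Rintegral => x _.
  by rewrite /re_part /f mul_cj sqmod_real Re_real expr2.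
have := sqn_ipI_eq0 sf f0; apply: ae_imp.
by move=> x H Ix; have := H Ix; rewrite /f => -[].
Qed.

(** Let w be the residual of the primitive H of h after least squares
    approximation by affine functions on [a, b].  Cut off to [a, b], it has two
    vanishing moments, so it is the second derivative of a test function; hence
    it is orthogonal to H, and being orthogonal to affine functions it is
    orthogonal to itself. *)
Lemma prim_affine l a b h : 0 < a -> a < b -> b < l -> rsq (I l) h ->
  (forall phi, test_function l phi -> prim (fun t => h t * derive1 phi t) l = 0) ->
  exists c0 c1, forall x, a <= x <= b -> prim h x = c0 + c1 * x.
Proof.
move=> a0 ab bl rh hphi; have l0 : 0 < l by lra.
pose ch x : R := if (a <= x <= b) then 1 else 0.
have chM f : measurable_fun (I l) f -> measurable_fun (I l) (fun x => ch x * f x).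
  move=> mf; apply: rmeasM => //.
  have -> : ch = \1_(`[a, b]%classic : set R).
    apply/funext => x; rewrite indicE /ch mem_setE in_itv/=.
    by case: ifP.
  by apply: measurable_funTS; apply: measurable_indic; exact: measurable_itv.
have ch2 x : ch x * ch x = ch x by rewrite /ch; case: ifP; rewrite ?mulr1 ?mulr0.
have chb f M : (forall x, I l x -> `|f x| <= M) -> forall x, I l x -> `|ch x * f x| <= M.
  move=> fM x Ix; rewrite /ch; case: ifP => _; first by rewrite mul1r fM.
  by rewrite mul0r normr0 (le_trans _ (fM x Ix)).
have chr f g : rac l f g -> rsq (I l) (fun x => ch x * f x).
  move=> rf; have [M MP] := rac_bound rf.
  apply: (rsq_bounded (mI l) (finI l) (M := M)).
    by apply: chM; exact: rac_measurable rf.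
  by apply: chb; exact: Ibnd.
have rH : rac l (prim h) h by split=> // x _; rewrite prim0 add0r.
(* the functions 1 and x, cut off to [a, b] *)
pose e k x : R[i] := (ch x * (if k is 0%N then 1 else x))%:C.
have toC f : rsq (I l) f -> square_integrable l (fun x => (f x)%:C).
  by move=> rf; apply/sqiP; split; [exact: rf|exact: (rsq_cst (mI l) (finI l) 0)].
have Le k : square_integrable l (e k).
  apply: toC; case: k => [|k]; [exact: chr (rac_cst l 1)|exact: chr (rac_id l)].
have Lu : square_integrable l (fun x => (ch x * prim h x)%:C).
  by apply: toC; exact: chr rH.
have [c cP] := finite_projection (semi_inner_ipI l) 2 Le Lu.
pose p x := ReC (c 0%N) + ReC (c 1%N) * x.
have rp : rac l p (fun x => 0 + ReC (c 1%N) * 1).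
  by apply: racD; [exact: rac_cst|apply: racZ; exact: rac_id].
pose w x := prim h x - p x.
have rw : rac l w (fun x => h x + -1 * (0 + ReC (c 1%N) * 1)).
  have := racD rH (racZ (-1) rp); congr rac.
  by apply/funext => x; rewrite /w mulN1r.
pose v x := ch x * w x.
have rv : rsq (I l) v by exact: chr rw.
have orth k : (k < 2)%N -> prim (fun x => v x * (if k is 0%N then 1 else x)) l = 0.
  move=> k2; have := congr1 (@complex.Re R) (cP k k2).
  rewrite Re0 /ipI Re_cintegral => E; rewrite -[RHS]E; apply: eq_Rintegral => x _.
  rewrite /re_part !big_ord_recr big_ord0 /= add0r.
  rewrite -[(_ - _) x]/(_ x - (c 0%N * e 0%N x + c 1%N * e 1%N x)).
  rewrite /e cReM [ReC (_ -i* _)]/= [ImC (_ -i* _)]/= oppr0 mulr0 subr0 /v /w /p.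
  rewrite cReB cReD !cReM !Im_real !mulr0 !subr0 !Re_real.
  transitivity ((ch x * ch x) * (prim h x - (ReC (c 0%N) + ReC (c 1%N) * x)) *
     (if k is 0%N then 1 else x)); first by rewrite ch2.
  by case: (k) => [|?]; ring.
have v0 t : ~ (a <= t <= b) -> v t = 0.
  by rewrite /v /ch; case: ifP => // _ _; rewrite mul0r.
have m0 : prim v l = 0.
  by rewrite -[RHS](orth 0%N isT); apply: eq_Rintegral => x _; rewrite mulr1.
have m1 : prim (fun t => t * v t) l = 0.
  by rewrite -[RHS](orth 1%N isT); apply: eq_Rintegral => x _; rewrite mulrC.
have [phi [tphi dphi]] := moment_free_test a0 (ltW ab) bl rv v0 m0 m1.
have hv := hphi _ tphi; rewrite dphi in hv.
have rv0 : rac l (prim v) v by split=> // x _; rewrite prim0 add0r.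
have rMv f g : rac l f g -> rsq (I l) (fun x => v x * f x).
  move=> rf; have [M MP] := rac_bound rf.
  have := rsqM_bounded (mI l) (rac_measurable l0 rf) (M := M) (Ibnd MP) rv.
  by congr rsq; apply/funext => t; rewrite mulrC.
have vH : prim (fun x => v x * prim h x) l = 0.
  have [_ /(_ l)] := racM l0 rH rv0.
  rewrite lexx ltW// => /(_ isT); rewrite m0 !prim0 !mulr0 add0r => E.
  have E' : prim (fun x => h x * prim v x) l + prim (fun x => prim h x * v x) l = 0.
    rewrite -(@primD _ l)//.
    - have [M MP] := rac_bound rv0.
      have := rsqM_bounded (mI l) (rac_measurable l0 rv0) (M := M) (Ibnd MP) rh.
      by congr rsq; apply/funext => t; rewrite mulrC.
    - by move: (rMv _ _ rH); congr rsq; apply/funext => t; rewrite mulrC.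
  move: E'; rewrite hv add0r => <-; apply: eq_Rintegral => x _; by rewrite mulrC.
have vp : prim (fun x => v x * p x) l = 0.
  rewrite (_ : (fun x => _) = (fun x => ReC (c 0%N) * v x + ReC (c 1%N) * (x * v x))); last first.
    by apply/funext => x; rewrite /p; ring.
  have rxv : rsq (I l) (fun x => x * v x).
    by move: (rMv _ _ (rac_id l)); congr rsq; apply/funext => t; rewrite mulrC.
  rewrite (@primD _ l)// ?(@primZ _ l)//; [|exact: rsqZ..].
  by rewrite m0 m1 !mulr0 addr0.
have vv : prim (fun x => v x * v x) l = 0.
  rewrite (_ : (fun x => _) = (fun x => v x * prim h x + -1 * (v x * p x))); last first.
    apply/funext => x; transitivity ((ch x * ch x) * (w x * w x)).
      by rewrite /v; ring.
    by rewrite ch2 /v /w; ring.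
  rewrite (@primD _ l)// ?(@primZ _ l)//; [|exact: rMv rp|exact: rMv rH|].
    by rewrite vH vp mulr0 addr0.
  by apply: rsqZ => //; exact: rMv rp.
have ae0 := rsq_null_ae rv vv.
exists (ReC (c 0%N)), (ReC (c 1%N)).
apply: (@continuous_ae_eq _ l a b) => //; [exact: ltW|exact: ltW| | |].
- exact: (rac_continuous l0 rH).
- exact: (rac_continuous l0 rp).
- move: ae0; apply: ae_imp => x H.
  rewrite /= in_itv/= => /andP[ax xb].
  have Ix : I l x by rewrite /= in_itv/= (lt_trans a0 ax) (lt_trans xb bl).
  have := H Ix; rewrite /v /ch (ltW ax) (ltW xb) /= mul1r /w /p => /eqP.
  by rewrite subr_eq0 => /eqP.
Qed.

(** The primitive H of h is affine on each [e, l - e] by [prim_affine]; the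
    coefficients do not depend on e, being determined by the values of H at l / 3
    and 2 l / 3. *)
Lemma du_bois_reymond l h : 0 < l -> rsq (I l) h ->
  (forall phi, test_function l phi -> prim (fun t => h t * derive1 phi t) l = 0) ->
  exists c, {ae mu, forall x, I l x -> h x = c}.
Proof.
move=> l0 rh hphi; pose H := prim h.
pose s := l / 3; pose t := 2 * s.
have s3 : 3 * s = l by rewrite /s; field.
pose c1 := (H t - H s) / s; pose c0 := H s - c1 * s.
have s0 : 0 < s by rewrite divr_gt0.
have aff x : I l x -> H x = c0 + c1 * x.
  rewrite /= in_itv/= => /andP[x0 xl].
  pose e := Num.min s (Num.min x (l - x)).
  have e0 : 0 < e by rewrite /e !lt_min s0 x0 subr_gt0 xl.
  have es : e <= s by rewrite /e ge_min lexx.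
  have ex : e <= x by rewrite /e !ge_min lexx orbT.
  have exl : e <= l - x by rewrite /e !ge_min lexx !orbT.
  have [||d0 [d1 dP]] := @prim_affine l e (l - e) h e0 _ _ rh hphi; [lra|lra|].
  have Hs : H s = d0 + d1 * s by apply: dP; apply/andP; split; lra.
  have Ht : H t = d0 + d1 * t by apply: dP; apply/andP; rewrite /t; split; lra.
  have Hx : H x = d0 + d1 * x by apply: dP; apply/andP; split; lra.
  have c1E : c1 = d1 by rewrite /c1 Ht Hs /t; field; rewrite gt_eqF.
  by rewrite /c0 c1E Hs Hx; ring.
have rH : rac l H h by split=> // x _; rewrite /H prim0 add0r.
have rA : rac l (fun x => c0 + c1 * x) (fun x => 0 + c1 * 1).
  by apply: racD; [exact: rac_cst|apply: racZ; exact: rac_id].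
have affae : {ae mu, forall x, I l x -> H x = c0 + c1 * x} by exact: aeW.
have E := rac_ae_eq l0 rH rA affae.
exists c1; have rA' : rac l H (fun=> c1).
  split; first exact: (rsq_cst (mI l) (finI l)).
  move=> x xl; have [_ AE] := rA.
  rewrite (E _ xl) (E 0) ?lexx ?(ltW l0)// (AE _ xl).
  by congr (_ + _); apply: eq_Rintegral => y _; rewrite add0r mulr1.
exact: (rac_unique rH rA').
Qed.

End DuBoisReymond.

(** * Sobolev functions on an interval are primitives *)

Section Sobolev.
Variables (R : realType) (l : R).
Hypothesis l0 : 0 < l.
Local Notation mu := (@lebesgue_measure R).
Local Notation I l := (`]0, l[%classic : set R).
Implicit Types (x : R) (f g h F G H : R -> R[i]).
Hint Resolve mI finI : core.

(** The complex version of [rac]. *)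
Definition cac F g : Prop :=
  rac l (re_part F) (re_part g) /\ rac l (im_part F) (im_part g).

Lemma cac_sqr F g : cac F g -> square_integrable l g.
Proof. by move=> [[rr _] [ri _]]; apply/sqiP. Qed.

Lemma cac_sql F g : cac F g -> square_integrable l F.
Proof. by move=> [rr ri]; apply/sqiP; split; [exact: (rac_rsq l0 rr)|exact: (rac_rsq l0 ri)]. Qed.

Lemma cac_eq F F' g g' : F =1 F' -> g =1 g' -> cac F g -> cac F' g'.
Proof. by move=> /funext -> /funext ->. Qed.

Lemma rac_eq (F F' g g' : R -> R) : F =1 F' -> g =1 g' -> rac l F g -> rac l F' g'.
Proof. by move=> /funext -> /funext ->. Qed.

Lemma cacD F g H h : cac F g -> cac H h ->
  cac (fun x => F x + H x) (fun x => g x + h x).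
Proof.
move=> [Fr Fi] [Hr Hi]; split.
- by apply: rac_eq (racD Fr Hr) => x; rewrite /re_part cReD.
- by apply: rac_eq (racD Fi Hi) => x; rewrite /im_part cImD.
Qed.

Lemma cacM F g H h : cac F g -> cac H h ->
  cac (fun x => F x * H x) (fun x => g x * H x + F x * h x).
Proof.
move=> [Fr Fi] [Hr Hi]; split.
- apply: rac_eq (racD (racM l0 Fr Hr) (racZ (-1) (racM l0 Fi Hi))) => x.
    by rewrite /re_part /im_part cReM; ring.
  by rewrite /re_part /im_part cReD !cReM; ring.
- apply: rac_eq (racD (racM l0 Fr Hi) (racM l0 Fi Hr)) => x.
    by rewrite /re_part /im_part cImM; ring.
  by rewrite /re_part /im_part cImD !cImM; ring.
Qed.

Lemma cac_cst c : cac (fun=> c) (fun=> 0).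
Proof. by split; exact: rac_cst. Qed.

Lemma cacZ a F g : cac F g -> cac (fun x => a * F x) (fun x => a * g x).
Proof.
move=> cF; apply: cac_eq (cacM (cac_cst a) cF) => x //.
by rewrite mul0r add0r.
Qed.

Lemma cac_cj F g : cac F g -> cac (fun x => cj (F x)) (fun x => cj (g x)).
Proof.
move=> [Fr Fi]; split.
- by apply: rac_eq Fr => x; rewrite /re_part Re_cj.
- by apply: rac_eq (racZ (-1) Fi) => x; rewrite /im_part Im_cj mulN1r.
Qed.

Lemma cac_id : cac (fun x => x%:C) (fun=> 1).
Proof. by split; [exact: rac_id|exact: rac_cst]. Qed.

Lemma rac_within (F F' g : R -> R) : (forall x, 0 <= x <= l -> F x = F' x) ->
  rac l F g -> rac l F' g.
Proof.
move=> E [rg FE]; split=> // x xl; rewrite -(E _ xl) -(E 0) ?lexx ?(ltW l0)//.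
exact: FE.
Qed.

Lemma cac_prim c g : square_integrable l g -> cac (fun x => c + cintegral x g) g.
Proof.
move=> /sqiP[gr gi]; split.
- by apply: rac_eq (rac_prim (ReC c) gr) => x; rewrite /re_part ?cReD.
- by apply: rac_eq (rac_prim (ImC c) gi) => x; rewrite /im_part ?cImD.
Qed.

Lemma cac_FTC F g x : cac F g -> 0 <= x <= l -> F x = F 0 + cintegral x g.
Proof.
move=> [[_ Fr] [_ Fi]] xl; apply: complex_eq.
- by rewrite cReD; exact: Fr.
- by rewrite cImD; exact: Fi.
Qed.

Lemma cac_parts F g H h : cac F g -> cac H h ->
  cintegral l (fun x => g x * H x) + cintegral l (fun x => F x * h x)
  = F l * H l - F 0 * H 0.
Proof.
move=> cF cH; have := cac_FTC (cacM cF cH) (x := l).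
rewrite lexx (ltW l0) => /(_ isT) ->.
rewrite [RHS]addrC addKr cintegralD//; apply: sqi_mul.
- exact: cac_sqr cF.
- exact: cac_sql cH.
- exact: cac_sql cF.
- exact: cac_sqr cH.
Qed.

Lemma ae_re f g : ae_equal l f g ->
  {ae mu, forall x, I l x -> re_part f x = re_part g x}.
Proof. by apply: ae_imp => x H /H; rewrite /re_part => ->. Qed.
Lemma ae_im f g : ae_equal l f g ->
  {ae mu, forall x, I l x -> im_part f x = im_part g x}.
Proof. by apply: ae_imp => x H /H; rewrite /im_part => ->. Qed.
Lemma ae_complex f g :
  {ae mu, forall x, I l x -> re_part f x = re_part g x} ->
  {ae mu, forall x, I l x -> im_part f x = im_part g x} -> ae_equal l f g.
Proof.
move=> hr hi; apply: (ae_imp2 hr hi).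
by move=> x Hr Hi Ix; apply: complex_eq; [exact: Hr|exact: Hi].
Qed.
Lemma ae_equal_sym f g : ae_equal l f g -> ae_equal l g f.
Proof. exact: ae_eq_sym. Qed.
Lemma ae_equal_trans f g h : ae_equal l f g -> ae_equal l g h -> ae_equal l f h.
Proof. exact: ae_eq_trans. Qed.

Lemma cac_ae F g h : cac F g -> square_integrable l h -> ae_equal l g h -> cac F h.
Proof.
move=> [Fr Fi] /sqiP[hr hi] gh.
by split; [apply: rac_ae Fr hr (ae_re gh)|apply: rac_ae Fi hi (ae_im gh)].
Qed.

Lemma cac_unique F g h : cac F g -> cac F h -> ae_equal l g h.
Proof.
by move=> [Fr Fi] [Fr' Fi']; apply: ae_complex; [exact: rac_unique Fr Fr'|exact: rac_unique Fi Fi'].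
Qed.

Lemma cac_ae_eq F g G h x : cac F g -> cac G h -> ae_equal l F G ->
  0 <= x <= l -> F x = G x.
Proof.
move=> [Fr Fi] [Gr Gi] FG xl; apply: complex_eq.
- exact: (rac_ae_eq l0 Fr Gr (ae_re FG)).
- exact: (rac_ae_eq l0 Fi Gi (ae_im FG)).
Qed.

Lemma cac_within F F' g : (forall x, 0 <= x <= l -> F x = F' x) -> cac F g -> cac F' g.
Proof.
move=> E [Fr Fi]; split.
- by apply: rac_within Fr => x xl; rewrite /re_part E.
- by apply: rac_within Fi => x xl; rewrite /im_part E.
Qed.

Lemma test_rac phi : test_function l phi -> rac l phi (derive1 phi) /\ phi l = 0.
Proof.
move=> [dphi cphi [a [b [a0 bl phi0]]]].
have p0 : phi 0 = 0 by apply: phi0 => /andP[]; lra.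
have pl : phi l = 0 by apply: phi0 => /andP[]; lra.
split=> //; split.
  have : {within `[0, l], continuous (derive1 phi)} by exact: continuous_subspaceT.
  move=> cw; split; first exact: within_measurable.
  have : mu.-integrable `[0, l] (EFin \o (fun x => derive1 phi x ^+ 2)).
    apply: continuous_compact_integrable; first exact: segment_compact.
    apply: continuous_subspaceT => x.
    have -> : (fun x => derive1 phi x ^+ 2) = (fun x => derive1 phi x * derive1 phi x).
      by apply/funext => y; rewrite expr2.
    by apply: continuousM; exact: cphi.
  by apply: integrableS => //; exact: subset_itv_oo_cc.
move=> x /andP[x0 xl]; rewrite p0 add0r.
have [x00|x1] := eqVneq x 0; first by rewrite x00 prim0.
have {}x0 : 0 < x by rewrite lt_def x1.
have cw : {within `[0, x], continuous (derive1 phi)} by exact: continuous_subspaceT.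
have dd : derivable_oo_LRcontinuous phi 0 x.
  have cp y : {for y, continuous phi}.
    by apply: differentiable_continuous; apply/derivable1_diffP.
  split; first by move=> y _; exact: dphi.
  - by apply: cvg_at_right_filter; exact: cp.
  - by apply: cvg_at_left_filter; exact: cp.
have := continuous_FTC2 x0 cw dd (fun _ _ => erefl).
rewrite p0 -EFinB subr0 => E.
have ii : mu.-integrable `[0, x] (EFin \o derive1 phi).
  by apply: continuous_compact_integrable => //; exact: segment_compact.
rewrite /prim Rintegral_itv_bndo_bndc; last first.
  by apply: integrableS ii => //; exact: subset_itv_oo_cc.
rewrite Rintegral_itv_obnd_cbnd; last first.
  by apply: integrableS ii => //; exact: subset_itv_oc_cc.
by rewrite /Rintegral E.
Qed.

Lemma test_cac phi : test_function l phi ->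
  cac (fun x => (phi x)%:C) (fun x => (derive1 phi x)%:C).
Proof. by move=> /test_rac[rp _]; split; [exact: rp|exact: rac_cst]. Qed.

Lemma cac_weak f F g : square_integrable l f -> ae_equal l f F -> cac F g ->
  weak_derivative l f g.
Proof.
move=> sf fF cF; split=> //; first exact: cac_sqr cF.
move=> phi tphi; have cphi := test_cac tphi.
have [[_ pE] pl] := test_rac tphi.
have p0 : phi 0 = 0.
  by have [_ _ [a [b [a0 bl phi0]]]] := tphi; apply: phi0 => /andP[]; lra.
have := cac_parts cF cphi; rewrite pl p0 rmorph0 !mulr0 subrr => /eqP.
rewrite addrC addr_eq0 => /eqP <-.
apply: cintegral_ae.
- by apply: sqi_mul => //; exact: cac_sqr cphi.
- by apply: sqi_mul; [exact: cac_sql cF|exact: cac_sqr cphi].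
- by move: fF; apply: ae_imp => x H /H ->.
Qed.

(** The difference of f and the primitive of its weak derivative has weak
    derivative 0, so it is constant by [du_bois_reymond]. *)
Lemma weak_real (f g : R -> R) : rsq (I l) f -> rsq (I l) g ->
  (forall phi, test_function l phi ->
    prim (fun x => f x * derive1 phi x) l = - prim (fun x => g x * phi x) l) ->
  exists K : R -> R, rac l K g /\ {ae mu, forall x, I l x -> f x = K x}.
Proof.
move=> rf rg weak; have rG := rac_prim 0 rg.
have rh := rsqD (mI l) rf (rsqZ (mI l) (-1) (rac_rsq l0 rG)).
have Mi (k m : R -> R) : rsq (I l) k -> rsq (I l) m -> mu.-integrable (I l) (EFin \o (fun x => k x * m x)).
  by move=> rk rm; exact: rsq_mulint.
have [phi tphi|c cP] := du_bois_reymond l0 rh.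
  have [rp pl] := test_rac tphi; have [rd _] := rp.
  have [_ /(_ l)] := racM l0 rG rp.
  rewrite lexx (ltW l0) => /(_ isT).
  rewrite pl mulr0 prim0 addr0 mul0r add0r => E.
  have E' : 0 = prim (fun x => g x * phi x) l +
       prim (fun x => (0 + prim g x) * derive1 phi x) l.
    rewrite {1}E; apply: RintegralD => //; apply: Mi => //; first exact: (rac_rsq l0 rp).
    exact: (rac_rsq l0 rG).
  rewrite (_ : (fun t => _) = (fun t => f t * derive1 phi t +
      -1 * ((0 + prim g t) * derive1 phi t))); last by apply/funext => t; ring.
  rewrite {1}/prim RintegralD//; last 2 first.
  - exact: Mi.
  - have := Mi _ _ (rsqZ (mI l) (-1) (rac_rsq l0 rG)) rd.
    by apply: integrable_eqfun => t; rewrite mulrA.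
  rewrite RintegralZl//; last exact: Mi (rac_rsq l0 rG) rd.
  rewrite -!/(prim _ l) weak//; lra.
exists (fun x => c + prim g x); split; first exact: rac_prim.
move: cP; apply: ae_imp => x H /H <-; ring.
Qed.

Lemma weak_cac f g : weak_derivative l f g -> exists F, ae_equal l f F /\ cac F g.
Proof.
move=> [sf sg weak]; have /sqiP[fr fi] := sf; have /sqiP[gr gi] := sg.
have [|Fr [rFr aeFr]] := weak_real fr gr.
  move=> phi tphi; have := congr1 (@complex.Re R) (weak _ tphi).
  rewrite cReN !Re_cintegral => E.
  transitivity (prim (re_part (fun x => f x * (derive1 phi x)%:C)) l).
    by apply: eq_Rintegral => x _; rewrite /re_part cReM Im_real mulr0 subr0.
  rewrite E; congr (- _); apply: eq_Rintegral => x _.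
  by rewrite /re_part cReM Im_real mulr0 subr0.
have [|Fi [rFi aeFi]] := weak_real fi gi.
  move=> phi tphi; have := congr1 (@complex.Im R) (weak _ tphi).
  rewrite cImN !Im_cintegral => E.
  transitivity (prim (im_part (fun x => f x * (derive1 phi x)%:C)) l).
    by apply: eq_Rintegral => x _; rewrite /im_part cImM Im_real mulr0 add0r.
  rewrite E; congr (- _); apply: eq_Rintegral => x _.
  by rewrite /im_part cImM Im_real mulr0 add0r.
exists (fun x => Fr x +i* Fi x); split=> //.
exact: ae_complex.
Qed.

Lemma crep_eq f F g x : ae_equal l f F -> cac F g -> 0 <= x <= l -> crep l f x = F x.
Proof.
move=> fF cF xl; have [Fr Fi] := cF.
have ex : continuous_representative l f F.
  by split=> //; [exact: (rac_continuous l0 Fr)|exact: (rac_continuous l0 Fi)].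
have : continuous_representative l f (crep l f) by exact: (@xgetI _ 0 _ F ex).
move=> [cr ci fc]; have cF' := ae_equal_trans (ae_equal_sym fc) fF.
apply: complex_eq.
- apply: (@continuous_ae_eq _ l 0 l (re_part (crep l f)) (re_part F)) => //.
  + exact: (rac_continuous l0 Fr).
  + exact: ae_re cF'.
- apply: (@continuous_ae_eq _ l 0 l (im_part (crep l f)) (im_part F)) => //.
  + exact: (rac_continuous l0 Fi).
  + exact: ae_im cF'.
Qed.

Lemma wderiv_eq f F g : square_integrable l f -> ae_equal l f F -> cac F g ->
  ae_equal l (wderiv l f) g.
Proof.
move=> sf fF cF.
have : weak_derivative l f (wderiv l f) by exact: (@xgetI _ 0 _ g (cac_weak sf fF cF)).
move=> /weak_cac[F' [fF' cF']].
have FF' := ae_equal_trans (ae_equal_sym fF) fF'.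
have cw : cac F (wderiv l f).
  by apply: (cac_within _ cF') => x xl; exact: (esym (cac_ae_eq cF cF' FF' xl)).
exact: cac_unique cw cF.
Qed.

Lemma sobolev1P f : sobolev1 l f <->
  square_integrable l f /\ exists F F1, ae_equal l f F /\ cac F F1.
Proof.
split=> [[g wg]|[sf [F [F1 [fF cF]]]]].
  have [sf _ _] := wg; split=> //; have [F [fF cF]] := weak_cac wg.
  by exists F, g.
by exists F1; exact: (cac_weak sf fF cF).
Qed.

Lemma sobolev2P f : sobolev2 l f <->
  square_integrable l f /\ exists F F1 F2, [/\ ae_equal l f F, cac F F1 & cac F1 F2].
Proof.
split=> [[/sobolev1P[sf [F [F1 [fF cF]]]] /sobolev1P[sw [G [G1 [wG cG]]]]]|].
  split=> //; exists F, G, G1; split=> //; apply: (cac_ae cF); first exact: cac_sql cG.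
  exact: ae_equal_trans (ae_equal_sym (wderiv_eq sf fF cF)) wG.
move=> [sf [F [F1 [F2 [fF cF cF1]]]]]; split; first by apply/sobolev1P; split=> //; exists F, F1.
apply/sobolev1P; split; last by exists F1, F2; split=> //; exact: wderiv_eq cF.
have : weak_derivative l f (wderiv l f) by exact: (@xgetI _ 0 _ F1 (cac_weak sf fF cF)).
by case.
Qed.

(** The increment F y - F x is the inner product of F1 with the indicator
    function of ]x, y[. *)
Lemma hoelder_edge F F1 x y : cac F F1 -> 0 <= x -> x <= y -> y <= l ->
  sqmod (F y - F x) <= (y - x) * sqn (ipI l) F1.
Proof.
move=> cF x0 xy yl; have s1 := cac_sqr cF.
pose chi : R -> R := \1_(`]x, y[%classic : set R).
pose ch : R -> R[i] := fun t => (chi t)%:C.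
have rch : rsq (I l) chi.
  apply: (rsq_bounded (mI l) (finI l) (M := 1)).
    by apply: measurable_funTS; apply: measurable_indic; exact: measurable_itv.
  by move=> t _; rewrite /chi indicE; case: (_ \in _); rewrite ?normr1 ?normr0.
have sch : square_integrable l ch.
  by apply/sqiP; split; [exact: rch|exact: (rsq_cst (mI l) (finI l) 0)].
have Isub : I l `&` `]x, y[%classic = `]x, y[%classic :> set R.
  by apply: setIidr; apply: subset_itv; rewrite bnd_simp.
have primchi (g : R -> R) : rsq (I l) g ->
    prim g y - prim g x = prim (fun t => g t * chi t) l.
  move=> rg; rewrite (primB x0 xy yl (rsq_int (mI l) (finI l) rg)) -Isub.
  rewrite Rintegral_mkcondr; apply: eq_Rintegral => t _.
  by rewrite patchE /chi indicE; case: (_ \in _); rewrite ?mulr1 ?mulr0.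
have yl' : 0 <= y <= l by rewrite yl (le_trans x0).
have xl' : 0 <= x <= l by rewrite x0 (le_trans xy).
have [[rr Fr] [ri Fi]] := cF.
have E : F y - F x = ipI l F1 ch.
  apply: complex_eq.
    rewrite cReB -[ReC (F y)]/(re_part F y) -[ReC (F x)]/(re_part F x).
    rewrite (Fr _ yl') (Fr _ xl') opprD addrACA subrr add0r (primchi _ rr).
    rewrite Re_cintegral; apply: eq_Rintegral => t _.
    by rewrite /re_part /ch cj_real cReM Im_real mulr0 subr0.
  rewrite cImB -[ImC (F y)]/(im_part F y) -[ImC (F x)]/(im_part F x).
  rewrite (Fi _ yl') (Fi _ xl') opprD addrACA subrr add0r (primchi _ ri).
  rewrite Im_cintegral; apply: eq_Rintegral => t _.
  by rewrite /im_part /ch cj_real cImM Im_real mulr0 add0r.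
rewrite E mulrC; apply: (le_trans (cauchy_schwarz (semi_inner_ipI l) s1 sch)).
rewrite ler_wpM2l ?(sqn_ge0 (semi_inner_ipI l))//.
have -> : sqn (ipI l) ch = prim (fun t => 1 * chi t) l.
  rewrite sqnE; apply: eq_Rintegral => t _; rewrite /ch sqmod_real /chi indicE mul1r.
  by case: (_ \in _); rewrite ?expr1n ?expr0n.
by rewrite -primchi ?prim_cst ?mulr1 ?(le_trans x0)//; exact: (rsq_cst (mI l) (finI l) 1).
Qed.

Lemma sqn_le_sup F B : square_integrable l F -> (forall x, 0 <= x <= l -> sqmod (F x) <= B) ->
  sqn (ipI l) F <= l * B.
Proof.
move=> sF FB; have B0 : 0 <= B by apply: le_trans (sqmod_ge0 (F 0)) (FB 0 _); rewrite lexx ltW.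
rewrite -[B]sqr_sqrtr// -sqmod_real -sqn_cst ?(ltW l0)//.
apply: sqn_le => // [|x]; first exact: sqi_cst.
by rewrite /= in_itv/= sqmod_real sqr_sqrtr// => /andP[x0 xl]; apply: FB; rewrite !ltW.
Qed.

(** By [hoelder_edge] the supremum of |F|^2 is at most l |F1|^2 if F 0 = 0. *)
Lemma poincare_edge F F1 : cac F F1 -> F 0 = 0 ->
  sqn (ipI l) F <= l ^+ 2 * sqn (ipI l) F1.
Proof.
move=> cF F0; rewrite expr2 -mulrA; apply: sqn_le_sup; first exact: cac_sql cF.
move=> x /andP[x0 xl]; have := hoelder_edge cF (lexx 0) x0 xl.
rewrite F0 !subr0 => /le_trans; apply; rewrite ler_wpM2r//.
by apply: (sqn_ge0 (semi_inner_ipI l)); exact: cac_sqr cF.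
Qed.

End Sobolev.

(** * The Hilbert space of a metric graph *)

Section GraphL2.
Variables (R : realType) (G : metric_graph R).
Local Notation mu := (@lebesgue_measure R).
Implicit Types (f g h u v : gfun G).

Lemma inner_ipI f g : inner f g = \sum_e ipI (len e) (f e) (g e).
Proof. by []. Qed.

Lemma semi_inner_inner : semi_inner (@L2 R G) (@inner R G).
Proof.
have H e := semi_inner_ipI (len (e : edge G)).
split.
- by move=> e; exact: (si0 (H e)).
- by move=> a f g Lf Lg e; exact: (si_lin (H e) a (Lf e) (Lg e)).
- move=> a f g h Lf Lg Lh; rewrite !inner_ipI mulr_sumr -big_split/=.
  by apply: eq_bigr => e _; exact: (si_linl (H e)).
- move=> f g Lf Lg; rewrite !inner_ipI cj_sum; apply: eq_bigr => e _.
  exact: (si_conj (H e)).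
- move=> f Lf; rewrite inner_ipI Re_sum; apply: sumr_ge0 => e _.
  exact: (si_ge0 (H e)).
Qed.

Lemma sqn_inner f : sqn (@inner R G) f = \sum_e sqn (ipI (len e)) (f e).
Proof. by rewrite /sqn inner_ipI Re_sum. Qed.

Lemma sqn_edge_le f e : L2 f -> sqn (ipI (len e)) (f e) <= sqn (@inner R G) f.
Proof.
move=> Lf; rewrite sqn_inner (bigD1 e)//= lerDl; apply: sumr_ge0 => i _.
by apply: (sqn_ge0 (semi_inner_ipI (len i))); exact: Lf.
Qed.

Lemma norm2E f : norm2 f = Num.sqrt (sqn (@inner R G) f). Proof. by []. Qed.

Lemma eqaeP f g : L2 f -> L2 g -> eqae f g <-> sqn (@inner R G) (f - g) = 0.
Proof.
move=> Lf Lg; have Lfg : L2 (f - g) by exact: (siB semi_inner_inner).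
split=> [fg|fg0 e].
  rewrite sqn_inner big1// => e _; apply: ae_equal_sqn0; first exact: Lfg.
  move: (fg e); apply: ae_imp => x H /H E.
  by rewrite -[LHS]/(f e x - g e x) E subrr.
have H0 : sqn (ipI (len e)) ((f - g) e) = 0.
  apply/eqP; rewrite eq_le; apply/andP; split; last first.
    by apply: (sqn_ge0 (semi_inner_ipI (len e))); exact: Lfg.
  by rewrite -fg0; exact: sqn_edge_le.
have := sqn_ipI_eq0 (Lfg e) H0.
apply: ae_imp => x H /H /eqP.
by rewrite -[_ == 0]/(f e x - g e x == 0) subr_eq0 => /eqP.
Qed.

Lemma eqae_refl f : eqae f f. Proof. by move=> e; exact: ae_eq_refl. Qed.
Lemma eqae_sym f g : eqae f g -> eqae g f.
Proof. by move=> fg e; exact: ae_equal_sym. Qed.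
Lemma eqae_trans f g h : eqae f g -> eqae g h -> eqae f h.
Proof. by move=> fg gh e; exact: ae_equal_trans (fg e) (gh e). Qed.
Lemma eqae_lin (a : R[i]) f f' g g' : eqae f f' -> eqae g g' ->
  eqae (a *: f + g) (a *: f' + g').
Proof.
move=> ff gg e; apply: (ae_imp2 (ff e) (gg e)).
move=> x H1 H2 Ix; rewrite -[LHS]/(a * f e x + g e x) -[RHS]/(a * f' e x + g' e x).
by rewrite H1// H2.
Qed.
Lemma eqaeD f f' g g' : eqae f f' -> eqae g g' -> eqae (f + g) (f' + g').
Proof. by move=> ff gg; have := eqae_lin 1 ff gg; rewrite !scale1r. Qed.
Lemma eqaeZ (a : R[i]) f f' : eqae f f' -> eqae (a *: f) (a *: f').
Proof. by move=> ff; have := eqae_lin a ff (eqae_refl 0); rewrite !addr0. Qed.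
Lemma eqaeB f f' g g' : eqae f f' -> eqae g g' -> eqae (f - g) (f' - g').
Proof. by move=> ff gg; have := eqaeD ff (eqaeZ (-1) gg); rewrite !scaleN1r. Qed.
Lemma eqae_sum (J : finType) (F F' : J -> gfun G) : (forall i, eqae (F i) (F' i)) ->
  eqae (\sum_i F i) (\sum_i F' i).
Proof.
move=> H; rewrite -![\sum_i _]big_enum; elim: (enum J) => [|i r IH].
  by rewrite !big_nil; exact: eqae_refl.
by rewrite !big_cons; exact: eqaeD.
Qed.

Lemma inner_eqae_l f f' g : L2 f -> L2 f' -> L2 g -> eqae f f' -> inner f g = inner f' g.
Proof.
move=> Lf Lf' Lg /(eqaeP Lf Lf') ff; apply/eqP; rewrite -subr_eq0; apply/eqP.
have HS := semi_inner_inner.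
by rewrite -(ipBl HS)// (ip_null_l HS)//; exact: (siB HS).
Qed.
Lemma inner_eqae_r f g g' : L2 f -> L2 g -> L2 g' -> eqae g g' -> inner f g = inner f g'.
Proof.
move=> Lf Lg Lg' gg; have HS := semi_inner_inner.
by rewrite (ip_conj HS Lg Lf) (inner_eqae_l Lg Lg' Lf gg) -(ip_conj HS).
Qed.
Lemma sqn_eqae f g : L2 f -> L2 g -> eqae f g -> sqn (@inner R G) f = sqn (@inner R G) g.
Proof.
by move=> Lf Lg fg; rewrite /sqn (inner_eqae_l Lf Lg Lf fg) (inner_eqae_r Lg Lf Lg fg).
Qed.
Lemma eqae0P f : L2 f -> eqae f 0 <-> sqn (@inner R G) f = 0.
Proof. by move=> Lf; have := eqaeP Lf (si0 semi_inner_inner); rewrite subr0. Qed.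

Lemma complete_inner : complete_ip (@L2 R G) (@inner R G).
Proof.
move=> u_ Lu cu; have HS := semi_inner_inner.
have LB m n : L2 (u_ m - u_ n) by exact: (siB HS).
have ex e : exists v : R -> R[i], square_integrable (len e) v /\
    lim_to (ipI (len e)) (fun n => u_ n e) v.
  have [||v sv vP] := @complete_ipI R (len e) (fun n => u_ n e).
  - by move=> n; exact: Lu.
  - move=> eps e0; have [N NP] := cu _ e0; exists N => m n Nm Nn.
    exact: le_lt_trans (sqn_edge_le e (LB m n)) (NP _ _ Nm Nn).
  - by exists v.
have [v vP] := choice ex; exists v; first by move=> e; have [] := vP e.
rewrite /lim_to.
have -> : (fun n => sqn (@inner R G) (u_ n - v)) =
    (fun n => \sum_e sqn (ipI (len e)) (u_ n e - v e)).
  by apply/funext => n; rewrite sqn_inner.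
elim: (index_enum _) => [|e r IH].
  by under eq_fun do rewrite big_nil; exact: cvg_cst.
have -> : (fun n => \sum_(i <- e :: r) sqn (ipI (len i)) (u_ n i - v i)) =
  (fun n => sqn (ipI (len e)) (u_ n e - v e) +
      \sum_(i <- r) sqn (ipI (len i)) (u_ n i - v i)).
  by apply/funext => n; rewrite big_cons.
by rewrite -[X in _ --> X]addr0; apply: cvgD => //; exact: (vP e).2.
Qed.

End GraphL2.

(** * Boundary conditions *)

Section Boundary.
Variables (R : realType) (G : metric_graph R).
Local Notation mu := (@lebesgue_measure R).
Implicit Types (f g h u v F H : gfun G) (t d : endpoint G -> R[i]).

(** F represents an element of the broken Sobolev space of order two, with first
    and second derivatives F1 and F2. *)
Definition h2rep F F1 F2 : Prop := forall e,
  cac (len e) (F e) (F1 e) /\ cac (len e) (F1 e) (F2 e).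

Definition tr F : endpoint G -> R[i] := fun p => F p.1 (coordinate p).
(** Derivatives in the direction pointing towards the vertex. *)
Definition dn F1 : endpoint G -> R[i] := fun p => if p.2 then tr F1 p else - tr F1 p.

Lemma coordinate_itv (p : endpoint G) : 0 <= coordinate p <= len p.1.
Proof. by rewrite /coordinate; case: p.2; rewrite ?lexx ?ltW// ?len_gt0. Qed.

Lemma h2rep_L2 F F1 F2 : h2rep F F1 F2 -> [/\ L2 F, L2 F1 & L2 F2].
Proof.
move=> rF; split=> e; have [c1 c2] := rF e.
- exact: (cac_sql (len_gt0 e) c1).
- exact: (cac_sqr c1).
- exact: (cac_sqr c2).
Qed.

Lemma h2rep_lin (a : R[i]) F F1 F2 H H1 H2 : h2rep F F1 F2 -> h2rep H H1 H2 ->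
  h2rep (a *: F + H) (a *: F1 + H1) (a *: F2 + H2).
Proof.
move=> rF rH e; have [c1 c2] := rF e; have [k1 k2] := rH e.
by split; apply: cacD => //; apply: cacZ => //; exact: len_gt0.
Qed.

Lemma tr_lin (a : R[i]) F H p : tr (a *: F + H) p = a * tr F p + tr H p.
Proof. by []. Qed.

Lemma dn_lin (a : R[i]) F H p : dn (a *: F + H) p = a * dn F p + dn H p.
Proof. by rewrite /dn; case: p.2; rewrite tr_lin// opprD mulrN. Qed.

Lemma Htilde2P f : Htilde2 f <->
  L2 f /\ exists F F1 F2, h2rep F F1 F2 /\ eqae f F.
Proof.
split=> [Hf|[Lf [F [F1 [F2 [rF fF]]]]] e]; last first.
  apply/(sobolev2P (len_gt0 e)); split; first exact: Lf.
  by exists (F e), (F1 e), (F2 e); have [c1 c2] := rF e; split=> //; exact: fF.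
have ex e : exists T : (R -> R[i]) * (R -> R[i]) * (R -> R[i]),
    [/\ ae_equal (len e) (f e) T.1.1, cac (len e) T.1.1 T.1.2 & cac (len e) T.1.2 T.2].
  have /(sobolev2P (len_gt0 e))[_ [F [F1 [F2 ?]]]] := Hf e.
  by exists (F, F1, F2).
have [T TP] := choice ex; split.
  by move=> e; have /(sobolev2P (len_gt0 e))[] := Hf e.
exists (fun e => (T e).1.1), (fun e => (T e).1.2), (fun e => (T e).2).
by split=> e; have [] := TP e.
Qed.

Lemma trace_rep f F F1 F2 p : h2rep F F1 F2 -> eqae f F -> trace f p = tr F p.
Proof.
move=> rF fF; have [c1 _] := rF p.1.
exact: (crep_eq (len_gt0 _) (fF p.1) c1 (coordinate_itv p)).
Qed.

Lemma gderiv_rep f F F1 F2 : L2 f -> h2rep F F1 F2 -> eqae f F -> eqae (gderiv f) F1.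
Proof.
move=> Lf rF fF e; have [c1 _] := rF e.
exact: (wderiv_eq (len_gt0 e) (Lf e) (fF e) c1).
Qed.

Lemma gderiv_L2 f F F1 F2 : L2 f -> h2rep F F1 F2 -> eqae f F -> L2 (gderiv f).
Proof.
move=> Lf rF fF e; have [c1 _] := rF e.
have : weak_derivative (len e) (f e) (wderiv (len e) (f e)).
  exact: (@xgetI _ 0 _ (F1 e) (cac_weak (len_gt0 e) (Lf e) (fF e) c1)).
by case.
Qed.

Lemma gderiv2_rep f F F1 F2 : L2 f -> h2rep F F1 F2 -> eqae f F ->
  eqae (gderiv (gderiv f)) F2.
Proof.
move=> Lf rF fF e; have [_ c2] := rF e.
apply: (wderiv_eq (len_gt0 e) _ (gderiv_rep Lf rF fF e) c2).
exact: (gderiv_L2 Lf rF fF).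
Qed.

Lemma trace_gderiv_rep f F F1 F2 p : L2 f -> h2rep F F1 F2 -> eqae f F ->
  trace (gderiv f) p = tr F1 p.
Proof.
move=> Lf rF fF; have [_ c2] := rF p.1.
exact: (crep_eq (len_gt0 _) (gderiv_rep Lf rF fF p.1) c2 (coordinate_itv p)).
Qed.

Lemma normal_derivative_rep f F F1 F2 x : L2 f -> h2rep F F1 F2 -> eqae f F ->
  normal_derivative f x = \sum_(p : endpoint G | location p == x) dn F1 p.
Proof.
move=> Lf rF fF; apply: eq_bigr => p _.
by rewrite (trace_gderiv_rep p Lf rF fF).
Qed.

Lemma tr_unique F F1 F2 H H1 H2 p : h2rep F F1 F2 -> h2rep H H1 H2 -> eqae F H ->
  tr F p = tr H p.
Proof. by move=> rF rH FH; rewrite -(trace_rep p rF (eqae_refl F)) (trace_rep p rH FH). Qed.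

Definition boundary_condition := (endpoint G -> R[i]) -> (endpoint G -> R[i]) -> Prop.

(** All operators of the theorem that are given by local conditions have this
    form; passing to representatives turns the conditions on traces of classes of
    functions into conditions on the numbers [tr F] and [dn F1]. *)
Definition bcop (q : edge G -> R -> R) (B : boundary_condition) : operator G :=
  [set fg | [/\ L2 fg.1, L2 fg.2 & exists F F1 F2, [/\ h2rep F F1 F2, eqae fg.1 F,
    eqae fg.2 (fun e x => - F2 e x + (q e x)%:C * F e x) & B (tr F) (dn F1)]]].

Definition bc_min : boundary_condition := fun t d =>
  (forall p, t p = 0) /\
  forall x, \sum_(p : endpoint G | location p == x) d p = 0.
Definition bc_dir : boundary_condition := fun t d => forall p, t p = 0.
Definition bc_continuous : boundary_condition := fun t d =>
  forall p p', location p = location p' -> t p = t p'.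
Definition bc_standard : boundary_condition := fun t d => bc_continuous t d /\
  forall x, \sum_(p : endpoint G | location p == x) d p = 0.

Lemma schroedinger_bcop (q : edge G -> R -> R) (P : set (gfun G)) (B : boundary_condition) :
  (forall f F F1 F2, L2 f -> h2rep F F1 F2 -> eqae f F ->
     (P f <-> B (tr F) (dn F1))) ->
  (forall f, P f -> Htilde2 f) ->
  schroedinger q P = bcop q B.
Proof.
move=> PB PH; apply/seteqP; split=> [[f g] /= [Pf Lg gE]|[f g] /= [Lf Lg]].
  have /Htilde2P[Lf [F [F1 [F2 [rF fF]]]]] := PH _ Pf.
  split=> //; exists F, F1, F2; split=> //; last by apply/(PB f F F1 F2).
  apply: (eqae_trans gE) => e.
  apply: (ae_imp2 (gderiv2_rep Lf rF fF e) (fF e)).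
  by move=> x h1 h2 Ix; rewrite h1// h2.
move=> [F [F1 [F2 [rF fF gE BF]]]]; split=> //; first by apply/(PB f F F1 F2).
apply: (eqae_trans gE) => e.
apply: (ae_imp2 (gderiv2_rep Lf rF fF e) (fF e)).
by move=> x h1 h2 Ix; rewrite h1// h2.
Qed.

Lemma H1_rep f F F1 F2 : L2 f -> h2rep F F1 F2 -> eqae f F ->
  (Htilde2 f /\ H1 f) <-> bc_continuous (tr F) (dn F1).
Proof.
move=> Lf rF fF; split=> [[_ [_ h]] p p' pp|h].
  by rewrite -!(trace_rep _ rF fF); exact: h.
split; first by apply/Htilde2P; split=> //; exists F, F1, F2.
split=> [e|p p' pp]; last by rewrite !(trace_rep _ rF fF); exact: h.
apply/(sobolev1P (len_gt0 e)); split; first exact: Lf.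
by have [c1 _] := rF e; exists (F e), (F1 e); split=> //; exact: fF.
Qed.

Lemma minimal_bcop q : minimal_operator q = bcop q bc_min.
Proof.
apply: schroedinger_bcop => [f F F1 F2 Lf rF fF|f []//].
split=> [[_ _ h]|[t0 d0]].
  split=> [p|x]; last by rewrite -(normal_derivative_rep x Lf rF fF); have [] := h x.
  by have [v0 _] := h (location p); rewrite -(trace_rep _ rF fF); exact: v0.
have [_ /(_ _)[|Hf Hf1]] := H1_rep Lf rF fF; first by move=> p p' _; rewrite !t0.
split=> // x; split; last by rewrite (normal_derivative_rep x Lf rF fF).
by move=> p _; rewrite (trace_rep _ rF fF).
Qed.

Lemma dirichlet_bcop q : dirichlet_laplacian q = bcop q bc_dir.
Proof.
apply: schroedinger_bcop => [f F F1 F2 Lf rF fF|f []//].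
split=> [[_ _ h] p|t0].
  by rewrite -(trace_rep _ rF fF); exact: (h (location p)).
have [_ /(_ _)[|Hf Hf1]] := H1_rep Lf rF fF; first by move=> p p' _; rewrite !t0.
by split=> // x p _; rewrite (trace_rep _ rF fF).
Qed.

Lemma standard_bcop q : standard_laplacian q = bcop q bc_standard.
Proof.
apply: schroedinger_bcop => [f F F1 F2 Lf rF fF|f []//].
split=> [[Hf Hf1 h]|[tc d0]].
  split; first by apply/(H1_rep Lf rF fF).
  by move=> x; rewrite -(normal_derivative_rep x Lf rF fF).
have [_ /(_ tc)[Hf Hf1]] := H1_rep Lf rF fF.
by split=> // x; rewrite (normal_derivative_rep x Lf rF fF).
Qed.

Lemma sum_endpoint (X : endpoint G -> R[i]) :
  \sum_p X p = \sum_e (X (e, true) + X (e, false)).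
Proof.
transitivity (\sum_(e : edge G) \sum_(b : bool) X (e, b)).
  by rewrite pair_bigA/=; apply: eq_bigr => -[].
by apply: eq_bigr => e _; rewrite big_bool.
Qed.

End Boundary.

(** * Green's identity and interpolation of boundary data *)

Section Edge.
Variables (R : realType) (l : R).
Hypothesis l0 : 0 < l.
Local Notation I l := (`]0, l[%classic : set R).
Implicit Types (f g k w : R -> R[i]).

Lemma green_edge (F F1 F2 H H1 H2 : R -> R[i]) :
  cac l F F1 -> cac l F1 F2 -> cac l H H1 -> cac l H1 H2 ->
  ipI l F2 H - ipI l F H2 =
  F1 l * cj (H l) - F l * cj (H1 l) - (F1 0 * cj (H 0) - F 0 * cj (H1 0)).
Proof.
move=> cF cF1 cH cH1.
have e1 := cac_parts l0 cF1 (cac_cj cH); have e2 := cac_parts l0 cF (cac_cj cH1).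
rewrite /ipI.
transitivity ((F1 l * cj (H l) - F1 0 * cj (H 0)) - (F l * cj (H1 l) - F 0 * cj (H1 0))).
  by rewrite -e1 -e2; ring.
by ring.
Qed.

(** Cubic Hermite interpolation. *)
Lemma hermite_edge (a b c d : R[i]) : exists F F1 F2 : R -> R[i],
  [/\ cac l F F1, cac l F1 F2 & [/\ F 0 = a, F l = b, F1 0 = c & F1 l = d]].
Proof.
pose L : R[i] := l%:C; have L0 : L != 0.
  by rewrite /L -(rmorph0 (real_complex R)) (inj_eq (@complexI R)) gt_eqF.
pose A := 3 * (b - a) / L ^+ 2 - (2 * c + d) / L.
pose B := - 2 * (b - a) / L ^+ 3 + (c + d) / L ^+ 2.
have cX := cac_id l; have cXX := cacM l0 cX cX; have cXXX := cacM l0 cX cXX.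
exists (fun x => a + c * x%:C + A * (x%:C * x%:C) + B * (x%:C * (x%:C * x%:C))).
exists (fun x => c + 2 * A * x%:C + 3 * B * (x%:C * x%:C)).
exists (fun x => 2 * A + 6 * B * x%:C); split.
- apply: cac_eq (cacD (cacD (cacD (cac_cst l a) (cacZ l0 c cX)) (cacZ l0 A cXX)) (cacZ l0 B cXXX)) => x //.
  by ring.
- apply: cac_eq (cacD (cacD (cac_cst l c) (cacZ l0 (2 * A) cX)) (cacZ l0 (3 * B) cXX)) => x //.
  by ring.
- split; rewrite ?rmorph0 -/L; [by ring| |by ring|].
    by rewrite /A /B; field.
  by rewrite /A /B; field.
Qed.

(** Let K be a second primitive of k.  The residual r of f - K after least
    squares approximation by affine functions is orthogonal to 1 and x, so it is
    the second derivative of a function U that vanishes to first order at both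
    ends; by assumption and by Green's identity r is orthogonal to f - K, hence to
    itself.  So f - K is affine. *)
Lemma second_primitive f k : square_integrable l f -> square_integrable l k ->
  (forall U U1 w, cac l U U1 -> cac l U1 w -> U 0 = 0 -> U l = 0 -> U1 0 = 0 ->
    U1 l = 0 -> ipI l w f = ipI l U k) ->
  exists F F1, [/\ ae_equal l f F, cac l F F1 & cac l F1 k].
Proof.
move=> sf sk H; have HS := semi_inner_ipI l.
pose K1 x := 0 + cintegral x k; have cK1 : cac l K1 k by exact: cac_prim.
have sK1 := cac_sql l0 cK1.
pose K x := 0 + cintegral x K1; have cK : cac l K K1 by exact: cac_prim.
have sK := cac_sql l0 cK.
pose e (j : nat) : R -> R[i] := if j is 0%N then (fun=> 1) else (fun x => x%:C).
have Le j : square_integrable l (e j).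
  by case: j => [|j]; [exact: sqi_cst|exact: (cac_sql l0 (cac_id l))].
have sfK : square_integrable l (f - K) by exact: (siB HS).
have [c cP] := finite_projection HS 2 Le sfK.
set S := \sum_(j < 2) _ in cP; set r := f - K - S.
have sS : square_integrable l S by apply: (si_sum HS) => j _; exact: (siZ HS).
have sr : square_integrable l r by exact: (siB HS).
have SE x : S x = c 0%N + c 1%N * x%:C.
  by rewrite /S !big_ord_recr big_ord0 /= add0r -[LHS]/(c 0%N * 1 + c 1%N * x%:C) mulr1.
pose U1 x := 0 + cintegral x r; have cU1 : cac l U1 r by exact: cac_prim.
have sU1 := cac_sql l0 cU1.
pose U x := 0 + cintegral x U1; have cU : cac l U U1 by exact: cac_prim.
have ci0 g : cintegral 0 g = 0.
  by apply: complex_eq; rewrite ?Re_cintegral ?Im_cintegral prim0.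
have U10 : U1 0 = 0 by rewrite /U1 ci0 addr0.
have U0 : U 0 = 0 by rewrite /U ci0 addr0.
have r0 : cintegral l r = 0.
  rewrite -[RHS](cP 0%N isT) /ipI; congr cintegral; apply/funext => x.
  by rewrite -[e 0%N x]/(1 : R[i]) conjc1 mulr1.
have r1 : cintegral l (fun x => x%:C * r x) = 0.
  rewrite -[RHS](cP 1%N isT) /ipI; congr cintegral; apply/funext => x.
  by rewrite -[e 1%N x]/(x%:C) cj_real mulrC.
have U1l : U1 l = 0 by rewrite /U1 r0 addr0.
have Ul : U l = 0.
  have := cac_parts l0 (cac_id l) cU1; rewrite U1l U10 !mulr0 subr0 r1 addr0 => E.
  rewrite /U add0r -[RHS]E; congr cintegral; apply/funext => x; by rewrite mul1r.
have HK : ipI l r K = ipI l U k.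
  have := green_edge cU cU1 cK cK1; rewrite U1l Ul U10 U0 !mul0r !subr0 => /eqP.
  by rewrite subr_eq0 => /eqP.
have rfK : ipI l r (f - K) = 0.
  by rewrite (ipBr HS)// HK (H U U1 r)// subrr.
have rS : ipI l r S = 0.
  rewrite (ip_sumr HS)//; last by move=> j _; exact: (siZ HS).
  by rewrite big1// => j _; rewrite (ipZr HS)// cP// mulr0.
have rr : sqn (ipI l) r = 0.
  by rewrite /sqn {2}/r (ipBr HS)// rfK rS subr0.
have aer := sqn_ipI_eq0 sr rr.
exists (fun x => K x + (c 0%N + c 1%N * x%:C)), (fun x => K1 x + (0 + c 1%N * 1)).
split.
- move: aer; apply: ae_imp => x h Ix.
  have := h Ix; rewrite /r -[(_ - _ - _) x]/(f x - K x - S x) SE => /eqP.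
  by rewrite -addrA -opprD subr_eq0 => /eqP.
- by apply: cacD => //; apply: cacD; [exact: cac_cst|apply: cacZ => //; exact: cac_id].
- apply: cac_eq (cacD cK1 (cac_cst l (0 + c 1%N * 1))) => x //.
  by rewrite addr0.
Qed.

End Edge.

Section Green.
Variables (R : realType) (G : metric_graph R).
Implicit Types (f g h u v F H : gfun G) (t d : endpoint G -> R[i]).

(** The boundary form in Green's identity. *)
Definition symp (t d t' d' : endpoint G -> R[i]) : R[i] :=
  \sum_p (d p * cj (t' p) - t p * cj (d' p)).

Lemma green F F1 F2 H H1 H2 : h2rep F F1 F2 -> h2rep H H1 H2 ->
  inner F2 H - inner F H2 = symp (tr F) (dn F1) (tr H) (dn H1).
Proof.
move=> rF rH; rewrite /symp sum_endpoint !inner_ipI -sumrB.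
apply: eq_bigr => e _; have [c1 c2] := rF e; have [k1 k2] := rH e.
rewrite (green_edge (len_gt0 e) c1 c2 k1 k2).
by rewrite /dn /tr /coordinate /= cjN; ring.
Qed.

Lemma hermite t d : exists F F1 F2, [/\ h2rep F F1 F2, tr F = t & dn F1 = d].
Proof.
have ex (e : edge G) : exists T : (R -> R[i]) * (R -> R[i]) * (R -> R[i]),
    [/\ cac (len e) T.1.1 T.1.2, cac (len e) T.1.2 T.2 &
      [/\ T.1.1 0 = t (e, false), T.1.1 (len e) = t (e, true),
          T.1.2 0 = - d (e, false) & T.1.2 (len e) = d (e, true)]].
  have [F [F1 [F2 ?]]] := hermite_edge (len_gt0 e) (t (e, false)) (t (e, true))
    (- d (e, false)) (d (e, true)).
  by exists (F, F1, F2).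
have [T TP] := choice ex.
exists (fun e => (T e).1.1), (fun e => (T e).1.2), (fun e => (T e).2); split.
- by move=> e; have [] := TP e.
- apply/funext => -[e b]; have [_ _ [e1 e2 e3 e4]] := TP e.
  by rewrite /tr /coordinate; case: b.
- apply/funext => -[e b]; have [_ _ [e1 e2 e3 e4]] := TP e.
  by rewrite /dn /tr /coordinate; case: b => //=; rewrite e3 opprK.
Qed.

End Green.

(** * Adjoints *)

Section Adjoint.
Variables (R : realType) (G : metric_graph R) (q : edge G -> R -> R) (M : R).
Local Notation mu := (@lebesgue_measure R).
Hypothesis q_meas : forall e, measurable_fun (`]0, len e[%classic : set R) (q e).
Hypothesis q_bound : forall e x, (`]0, len e[%classic : set R) x -> `|q e x| <= M.
Implicit Types (f g h u v F H : gfun G) (t d : endpoint G -> R[i]).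
Let HS := @semi_inner_inner R G.

Definition qmul f : gfun G := fun e x => (q e x)%:C * f e x.

Lemma L2_qmul f : L2 f -> L2 (qmul f).
Proof. by move=> Lf e; apply: sqiM_real => //; exact: q_bound. Qed.

Lemma inner_qmul f g : inner (qmul f) g = inner f (qmul g).
Proof.
rewrite !inner_ipI; apply: eq_bigr => e _; rewrite /ipI; congr cintegral.
by apply/funext => x; rewrite /qmul cjM cj_real; ring.
Qed.

Lemma eqae_qmul f g : eqae f g -> eqae (qmul f) (qmul g).
Proof.
move=> fg e; move: (fg e); apply: ae_imp.
by move=> x H /H; rewrite /qmul => ->.
Qed.

Lemma bcop_rep B f g : bcop q B (f, g) <-> [/\ L2 f, L2 g & exists F F1 F2,
  [/\ h2rep F F1 F2, eqae f F, eqae g (qmul F - F2) & B (tr F) (dn F1)]].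
Proof.
have E F F2 : (fun e x => - F2 e x + (q e x)%:C * F e x) = qmul F - F2 :> gfun G.
  by apply/funext => e; apply/funext => x; rewrite addrC.
split=> [[Lf Lg [F [F1 [F2 [rF fF gE BF]]]]]|[Lf Lg [F [F1 [F2 [rF fF gE BF]]]]]].
  by split=> //; exists F, F1, F2; split=> //; rewrite -E.
by split=> //; exists F, F1, F2; split=> //; rewrite E.
Qed.

Lemma h2rep_bcop (B : boundary_condition G) F F1 F2 : h2rep F F1 F2 -> B (tr F) (dn F1) ->
  bcop q B (F, qmul F - F2).
Proof.
move=> rF BF; have [LF LF1 LF2] := h2rep_L2 rF.
apply/bcop_rep; split=> //; first by apply: (siB HS) => //; exact: L2_qmul.
by exists F, F1, F2; split=> //; exact: eqae_refl.
Qed.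

Lemma bcop_mono (B B' : boundary_condition G) : (forall t d, B t d -> B' t d) ->
  bcop q B `<=` bcop q B'.
Proof.
move=> BB [f g] [Lf Lg [F [F1 [F2 [rF fF gE BF]]]]]; split=> //.
by exists F, F1, F2; split=> //; exact: BB.
Qed.

Lemma bcop_symp u v U U1 U2 f g F F1 F2 :
  L2 u -> L2 v -> h2rep U U1 U2 -> eqae u U -> eqae v (qmul U - U2) ->
  L2 f -> L2 g -> h2rep F F1 F2 -> eqae f F -> eqae g (qmul F - F2) ->
  inner v f - inner u g = - symp (tr U) (dn U1) (tr F) (dn F1).
Proof.
move=> Lu Lv rU uU vE Lf Lg rF fF gE.
have [LU _ LU2] := h2rep_L2 rU; have [LF _ LF2] := h2rep_L2 rF.
have LqU := L2_qmul LU; have LqF := L2_qmul LF.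
have LUU : L2 (qmul U - U2) by exact: (siB HS).
have LFF : L2 (qmul F - F2) by exact: (siB HS).
rewrite (inner_eqae_l Lv LUU Lf vE) (inner_eqae_r LUU Lf LF fF).
rewrite (inner_eqae_l Lu LU Lg uU) (inner_eqae_r LU Lg LFF gE).
rewrite (ipBl HS)// (ipBr HS)// inner_qmul -(green rU rF); ring.
Qed.

Definition perp (B : boundary_condition G) : boundary_condition G :=
  fun t' d' => forall t d, B t d -> symp t d t' d' = 0.

Definition on_edge (e0 : edge G) (w : R -> R[i]) : gfun G :=
  fun e => if e == e0 then w else fun=> 0.

Lemma on_edge_same e0 w : on_edge e0 w e0 = w.
Proof. by rewrite /on_edge eqxx. Qed.

Lemma on_edge_h2rep e0 U U1 w : cac (len e0) U U1 -> cac (len e0) U1 w ->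
  h2rep (on_edge e0 U) (on_edge e0 U1) (on_edge e0 w).
Proof.
move=> cU cU1 e; rewrite /on_edge; case: eqP => [->//|_].
by split; exact: cac_cst.
Qed.

Lemma on_edge_tr0 e0 U : U 0 = 0 -> U (len e0) = 0 -> tr (on_edge e0 U) = fun=> 0.
Proof.
move=> U0 Ul; apply/funext => -[e b]; rewrite /tr /on_edge /coordinate /=.
by case: eqP => [->|//]; case: b.
Qed.

Lemma on_edge_dn0 e0 U : U 0 = 0 -> U (len e0) = 0 -> dn (on_edge e0 U) = fun=> 0.
Proof.
by move=> U0 Ul; apply/funext => p; rewrite /dn on_edge_tr0// oppr0; case: p.2.
Qed.

Lemma inner_on_edge e0 w f : inner (on_edge e0 w) f = ipI (len e0) w (f e0).
Proof.
rewrite inner_ipI (bigD1 e0)//= on_edge_same big1 ?addr0// => e ne.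
rewrite /on_edge (negPf ne) /ipI; apply: complex_eq.
  rewrite Re_cintegral (_ : re_part _ = fun=> 0); last first.
    by apply/funext => x; rewrite /re_part mul0r.
  by rewrite /prim Rintegral_cst// mul0r.
rewrite Im_cintegral (_ : im_part _ = fun=> 0); last first.
  by apply/funext => x; rewrite /im_part mul0r.
by rewrite /prim Rintegral_cst// mul0r.
Qed.

(** Testing with functions supported on one edge, where all boundary data
    vanish, places f in the maximal domain. *)
Lemma adjoint_maximal (B : boundary_condition G) f g : B (fun=> 0) (fun=> 0) ->
  adjoint (bcop q B) (f, g) ->
  exists F F1, h2rep F F1 (qmul f - g) /\ eqae f F.
Proof.
move=> B0 [/= Lf Lg adj].
have Lk : L2 (qmul f - g) by apply: (siB HS) => //; exact: L2_qmul.
have ex (e : edge G) : exists T : (R -> R[i]) * (R -> R[i]),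
    [/\ ae_equal (len e) (f e) T.1, cac (len e) T.1 T.2 & cac (len e) T.2 ((qmul f - g) e)].
  have [U U1 w cU cU1 U0 Ul U10 U1l|F [F1 ?]] := second_primitive (len_gt0 e) (Lf e) (Lk e).
  - have rU := on_edge_h2rep cU cU1.
    have BU : B (tr (on_edge e U)) (dn (on_edge e U1)).
      by rewrite on_edge_tr0// on_edge_dn0.
    have [LU _ Lw] := h2rep_L2 rU.
    have := adj _ _ (h2rep_bcop rU BU).
    have LqU := L2_qmul LU; have Lqf := L2_qmul Lf.
    rewrite (ipBl HS)// inner_qmul !inner_on_edge => E.
    have sU := cac_sql (len_gt0 e) cU.
    have HI := semi_inner_ipI (len e).
    have -> : (qmul f - g) e = qmul f e - g e by [].
    rewrite (ipBr HI (Lqf e) (Lg e) sU).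
    by rewrite -E; ring.
  - by exists (F, F1).
have [T TP] := choice ex.
exists (fun e => (T e).1), (fun e => (T e).2); split=> e; have [] := TP e => //.
Qed.

(** Membership in the maximal domain is [adjoint_maximal]; by Green's identity
    and [hermite], which realises all boundary data, the remaining condition is
    orthogonality of the boundary data for the form [symp]. *)
Lemma adjoint_bcop (B : boundary_condition G) : B (fun=> 0) (fun=> 0) ->
  adjoint (bcop q B) = bcop q (perp B).
Proof.
move=> B0; apply/seteqP; split=> [[f g] adj|[f g]].
  have [/= Lf Lg h] := adj.
  have [F [F1 [rF fF]]] := adjoint_maximal B0 adj.
  have Lqf := L2_qmul Lf; have [LF _ _] := h2rep_L2 rF.
  have gE : eqae g (qmul F - (qmul f - g)).
    have := eqaeB (eqae_qmul fF) (eqae_refl (qmul f - g)).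
    by rewrite [X in eqae X](subKr (qmul f) g).
  apply/bcop_rep; split=> //; exists F, F1, (qmul f - g); split=> // t d Btd.
  have [U [U1 [U2 [rU trU dnU]]]] := hermite t d.
  have BU : B (tr U) (dn U1) by rewrite trU dnU.
  have opU := h2rep_bcop rU BU; have [LU _ LU2] := h2rep_L2 rU.
  have LUU : L2 (qmul U - U2) by apply: (siB HS) => //; exact: L2_qmul.
  have := bcop_symp LU LUU rU (eqae_refl _) (eqae_refl _) Lf Lg rF fF gE.
  by rewrite (h _ _ opU) subrr trU dnU => /esym/eqP; rewrite oppr_eq0 => /eqP.
move=> /bcop_rep[Lf Lg [F [F1 [F2 [rF fF gE perpF]]]]].
split=> // u v /bcop_rep[Lu Lv [U [U1 [U2 [rU uU vE BU]]]]].
apply/eqP; rewrite -subr_eq0 (bcop_symp Lu Lv rU uU vE Lf Lg rF fF gE).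
by rewrite perpF// oppr0.
Qed.

(** A continuous representative is determined everywhere on the closed edge, and
    so are those of its derivatives. *)
Lemma h2rep_unique F F1 F2 H H1 H2 : h2rep F F1 F2 -> h2rep H H1 H2 -> eqae F H ->
  [/\ tr F = tr H, dn F1 = dn H1 & eqae F2 H2].
Proof.
move=> rF rH FH.
have E e x : 0 <= x <= len e -> F e x = H e x.
  have [c1 _] := rF e; have [k1 _] := rH e.
  exact: (cac_ae_eq (len_gt0 e) c1 k1 (FH e)).
have E1 e x : 0 <= x <= len e -> F1 e x = H1 e x.
  have [c1 c2] := rF e; have [k1 k2] := rH e.
  apply: (cac_ae_eq (len_gt0 e) c2 k2).
  apply: (cac_unique c1); apply: (cac_within (len_gt0 e) _ k1) => y yl.
  exact/esym/E.
split.
- by apply/funext => p; rewrite /tr; apply: E; exact: coordinate_itv.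
- by apply/funext => p; rewrite /dn /tr E1//; exact: coordinate_itv.
- move=> e; have [c1 c2] := rF e; have [k1 k2] := rH e.
  apply: (cac_unique c2); apply: (cac_within (len_gt0 e) _ k2) => y yl.
  exact/esym/E1.
Qed.

Definition linear_bc (B : boundary_condition G) : Prop :=
  B (fun=> 0) (fun=> 0) /\ forall a t d t' d', B t d -> B t' d' ->
    B (fun p => a * t p + t' p) (fun p => a * d p + d' p).

Lemma h2rep0 : h2rep (0 : gfun G) 0 0.
Proof. by move=> e; split; exact: cac_cst. Qed.

Lemma qmul_lin (a : R[i]) f g : qmul (a *: f + g) = a *: qmul f + qmul g.
Proof.
apply/funext => e; apply/funext => x.
rewrite -[LHS]/((q e x)%:C * (a * f e x + g e x)).
by rewrite -[RHS]/(a * ((q e x)%:C * f e x) + (q e x)%:C * g e x); ring.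
Qed.

Lemma bcop_linear (B : boundary_condition G) : linear_bc B ->
  linear_operator (bcop q B).
Proof.
move=> [B0 Blin]; split.
- by move=> f g [].
- move=> f g f' g' /bcop_rep[Lf Lg [F [F1 [F2 [rF fF gE BF]]]]] Lf' Lg' ff gg.
  apply/bcop_rep; split=> //; exists F, F1, F2; split=> //.
    exact: eqae_trans (eqae_sym ff) fF.
  exact: eqae_trans (eqae_sym gg) gE.
- have := h2rep_bcop (B := B) h2rep0; rewrite subr0.
  have -> : qmul 0 = 0.
    by apply/funext => e; apply/funext => x; rewrite /qmul mulr0.
  have -> : tr (0 : gfun G) = fun=> 0 by [].
  have -> : dn (0 : gfun G) = fun=> 0.
    by apply/funext => p; rewrite /dn; case: p.2 => //; rewrite /tr oppr0.
  exact.
- move=> a f g f' g' /bcop_rep[Lf Lg [F [F1 [F2 [rF fF gE BF]]]]].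
  move=> /bcop_rep[Lf' Lg' [F' [F1' [F2' [rF' fF' gE' BF']]]]].
  apply/bcop_rep; split; [exact: (si_lin HS)|exact: (si_lin HS)|].
  exists (a *: F + F'), (a *: F1 + F1'), (a *: F2 + F2'); split.
  + exact: h2rep_lin.
  + exact: eqae_lin.
  + apply: eqae_trans (eqae_lin a gE gE') _.
    rewrite qmul_lin scalerBr opprD addrACA; exact: eqae_refl.
  + have -> : tr (a *: F + F') = fun p => a * tr F p + tr F' p by [].
    have -> : dn (a *: F1 + F1') = fun p => a * dn F1 p + dn F1' p.
      by apply/funext => p; exact: dn_lin.
    exact: Blin.
- move=> f g g' /bcop_rep[Lf Lg [F [F1 [F2 [rF fF gE BF]]]]].
  move=> /bcop_rep[Lf' Lg' [F' [F1' [F2' [rF' fF' gE' BF']]]]].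
  have FF := eqae_trans (eqae_sym fF) fF'.
  have [_ _ F22] := h2rep_unique rF rF' FF.
  apply: (eqae_trans gE); apply: eqae_trans (eqae_sym gE').
  by apply: eqaeB => //; exact: eqae_qmul.
Qed.

Lemma sum_location (X : endpoint G -> R[i]) :
  \sum_p X p = \sum_x \sum_(p | location p == x) X p.
Proof. by rewrite (partition_big (@location R G) xpredT). Qed.

Lemma perp_min t d : perp (@bc_min R G) t d <-> bc_continuous t d.
Proof.
split=> [h p p' pp|tc t' d' [t0 d0]].
  apply/eqP/negPn/negP => tpp.
  have pp' : p != p' by apply: contraNN tpp => /eqP ->.
  (* opposite unit fluxes through two endpoints at the same vertex *)
  pose d' r : R[i] := (r == p)%:R - (r == p')%:R.
  have := h (fun=> 0) d' _; rewrite /symp (bigD1 p)//= (bigD1 p') ?(eq_sym p')//=.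
  rewrite big1 ?addr0 => [|r /andP[rp rp']]; last first.
    by rewrite /d' (negPf rp) (negPf rp') subrr !mul0r subrr.
  rewrite /d' !eqxx (negPf pp') eq_sym (negPf pp') !mul0r !subr0 sub0r mul1r mulN1r.
  move=> E; have {}E : cj (t p) - cj (t p') = 0.
    apply: E; split=> // x; rewrite sumrB.
    have S r : \sum_(i : endpoint G | location i == x) (i == r)%:R =
        (location r == x)%:R :> R[i].
      have [lr|lr] := boolP (location r == x).
        by rewrite (bigD1 r)//= eqxx big1 ?addr0// => i /andP[_ /negPf ->].
      rewrite big1// => i li; case: eqP => // ir; by rewrite -ir li in lr.
    by rewrite !S pp subrr.
  move: tpp; rewrite -subr_eq0 => /eqP; apply.
  by rewrite -[LHS]conjcK rmorphB /= E conjc0.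
rewrite /symp sum_location big1// => x _.
have [p0 /eqP lp0|none] := pickP (fun p : endpoint G => location p == x); last first.
  by rewrite big_pred0.
rewrite (eq_bigr (fun p => d' p * cj (t p0))) => [|p /eqP lp].
  by rewrite -mulr_suml d0 mul0r.
by rewrite t0 mul0r subr0 (tc p p0) // lp lp0.
Qed.

Lemma bcop_ext (B B' : boundary_condition G) : (forall t d, B t d <-> B' t d) ->
  bcop q B = bcop q B'.
Proof. by move=> BB; apply/seteqP; split; apply: bcop_mono => t d /BB. Qed.

Lemma bc0 (B : boundary_condition G) : (forall t d, bc_min t d -> B t d) ->
  B (fun=> 0) (fun=> 0).
Proof. by apply; split=> // x; rewrite big1. Qed.

Definition delta (p : endpoint G) : endpoint G -> R[i] := fun r => (r == p)%:R.

Lemma symp_delta p t' d' : symp (fun=> 0) (delta p) t' d' = cj (t' p).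
Proof.
rewrite /symp (bigD1 p)//= big1 => [|r rp].
  by rewrite /delta eqxx mul0r subr0 mul1r addr0.
by rewrite /delta (negPf rp) !mul0r subrr.
Qed.

Lemma symp_vertex x t' d' :
  symp (fun p => (location p == x)%:R) (fun=> 0) t' d' =
  - cj (\sum_(p : endpoint G | location p == x) d' p).
Proof.
rewrite /symp cj_sum -sumrN [RHS]big_mkcond/=; apply: eq_bigr => p _.
by rewrite mul0r sub0r; case: eqP => _; rewrite ?mul1r ?mul0r ?oppr0.
Qed.

Lemma cj_eq0 (z : R[i]) : cj z = 0 -> z = 0.
Proof. by move=> /(congr1 (@conjc R)); rewrite conjcK conjc0. Qed.

Lemma perp_continuous t d : perp (@bc_continuous R G) t d <-> bc_min t d.
Proof.
split=> [h|[t0 d0] t' d' tc].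
  split=> [p|x].
    by apply: cj_eq0; rewrite -(symp_delta p t d); apply: h.
  apply: cj_eq0; apply/eqP; rewrite -oppr_eq0 -(symp_vertex x t d); apply/eqP.
  by apply: h => p p' ->.
have [_ /(_ tc)] := perp_min t' d'.
move=> /(_ t d (conj t0 d0)) E; apply/eqP; rewrite -oppr_eq0; apply/eqP.
apply: cj_eq0; rewrite -[RHS]E cjN /symp cj_sum -sumrN; apply: eq_bigr => p _.
by rewrite cjD cjN !cjM !conjcK; ring.
Qed.

Lemma perp_dir t d : perp (@bc_dir R G) t d <-> bc_dir t d.
Proof.
split=> [h p|t0 t' d' t0'].
  by apply: cj_eq0; rewrite -(symp_delta p t d); apply: h.
by rewrite /symp big1// => p _; rewrite t0 t0' conjc0 mulr0 mul0r subrr.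
Qed.

Lemma perp_standard t d : perp (@bc_standard R G) t d <-> bc_standard t d.
Proof.
split=> [h|[tc d0] t' d' [tc' d0']].
  split.
    apply/perp_min => t' d' [t0' d0']; apply: h; split=> // p p' _.
    by rewrite !t0'.
  move=> x; apply: cj_eq0; apply/eqP; rewrite -oppr_eq0 -(symp_vertex x t d); apply/eqP.
  apply: h; split; first by move=> p p' ->.
  by move=> y; rewrite big1.
rewrite /symp sum_location big1// => x _.
have [p0 /eqP lp0|none] := pickP (fun p : endpoint G => location p == x); last first.
  by rewrite big_pred0.
rewrite (eq_bigr (fun p => d' p * cj (t p0) - t' p0 * cj (d p))) => [|p /eqP lp].
  by rewrite sumrB -mulr_suml d0' mul0r sub0r -mulr_sumr -cj_sum d0 conjc0 mulr0 oppr0.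
by rewrite (tc p p0) ?(tc' p p0)// lp lp0.
Qed.

Lemma min_sub_dir t d : bc_min t d -> bc_dir t d. Proof. by case. Qed.
Lemma min_sub_continuous t d : bc_min t d -> bc_continuous t d.
Proof. by move=> [t0 _] p p' _; rewrite !t0. Qed.
Lemma min_sub_standard t d : bc_min t d -> bc_standard t d.
Proof. by move=> m; split; [exact: min_sub_continuous|exact: m.2]. Qed.

Lemma adjoint_min : adjoint (bcop q (@bc_min R G)) = bcop q (@bc_continuous R G).
Proof. by rewrite adjoint_bcop; [apply: bcop_ext; exact: perp_min|exact: bc0]. Qed.
Lemma adjoint_continuous : adjoint (bcop q (@bc_continuous R G)) = bcop q (@bc_min R G).
Proof.
by rewrite adjoint_bcop; [apply: bcop_ext; exact: perp_continuous|exact: bc0 min_sub_continuous].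
Qed.
Lemma adjoint_dir : adjoint (bcop q (@bc_dir R G)) = bcop q (@bc_dir R G).
Proof. by rewrite adjoint_bcop; [apply: bcop_ext; exact: perp_dir|exact: bc0 min_sub_dir]. Qed.
Lemma adjoint_standard : adjoint (bcop q (@bc_standard R G)) = bcop q (@bc_standard R G).
Proof.
by rewrite adjoint_bcop; [apply: bcop_ext; exact: perp_standard|exact: bc0 min_sub_standard].
Qed.

Lemma linear_min : linear_bc (@bc_min R G).
Proof.
split; first exact: bc0.
move=> a t d t' d' [t0 d0] [t0' d0']; split=> [p|x].
  by rewrite t0 t0' mulr0 addr0.
by rewrite big_split/= -mulr_sumr d0 d0' mulr0 addr0.
Qed.
Lemma linear_continuous : linear_bc (@bc_continuous R G).
Proof.
split; first exact: bc0 min_sub_continuous.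
by move=> a t d t' d' tc tc' p p' pp; rewrite (tc p p')// (tc' p p').
Qed.
Lemma linear_dir : linear_bc (@bc_dir R G).
Proof.
split; first exact: bc0 min_sub_dir.
by move=> a t d t' d' t0 t0' p; rewrite t0 t0' mulr0 addr0.
Qed.
Lemma linear_standard : linear_bc (@bc_standard R G).
Proof.
split; first exact: bc0 min_sub_standard.
move=> a t d t' d' [tc d0] [tc' d0']; split.
  exact: (linear_continuous.2 a t d t' d' tc tc').
by move=> x; rewrite big_split/= -mulr_sumr d0 d0' mulr0 addr0.
Qed.

(** * Energy *)

Lemma energy F F1 F2 : h2rep F F1 F2 ->
  inner F2 F + inner F1 F1 = \sum_p dn F1 p * cj (tr F p).
Proof.
move=> rF; rewrite sum_endpoint !inner_ipI -big_split/=; apply: eq_bigr => e _.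
have [c1 c2] := rF e.
rewrite /ipI (cac_parts (len_gt0 e) c2 (cac_cj c1)).
by rewrite /dn /tr /coordinate /=; ring.
Qed.

Hypothesis q_ge0 : forall e x, (`]0, len e[%classic : set R) x -> 0 <= q e x.

Lemma Re_inner_qmul_ge0 f : L2 f -> 0 <= ReC (inner (qmul f) f).
Proof.
move=> Lf; rewrite inner_ipI Re_sum; apply: sumr_ge0 => e _.
rewrite Re_cintegral; apply: Rintegral_ge0 => x Ix.
rewrite /re_part /qmul -mulrA mul_cj cReM Im_real mulr0 subr0 !Re_real.
by rewrite mulr_ge0 ?q_ge0 ?sqmod_ge0.
Qed.

(** Integration by parts; the potential contributes a nonnegative term. *)
Lemma energy_ge F F1 F2 : h2rep F F1 F2 ->
  \sum_p dn F1 p * cj (tr F p) = 0 ->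
  sqn (@inner R G) F1 <= ReC (inner (qmul F - F2) F).
Proof.
move=> rF b0; have [LF LF1 LF2] := h2rep_L2 rF; have LqF := L2_qmul LF.
have := energy rF; rewrite b0 => /eqP; rewrite addr_eq0 => /eqP E.
rewrite (ipBl HS)// E opprK cReD lerDr.
exact: Re_inner_qmul_ge0.
Qed.

(** The sum bounds the maximum of the constants of the edges. *)
Definition poincare_constant : R := \sum_(e : edge G) len e ^+ 2.

Lemma poincare_constant_gt0 : 0 < poincare_constant.
Proof.
have /card_gt0P[e _] := edge_nonempty G.
rewrite /poincare_constant (bigD1 e)//= ltr_pwDl ?exprn_gt0 ?len_gt0//.
by apply: sumr_ge0 => i _; rewrite sqr_ge0.
Qed.

Lemma poincare F F1 F2 : h2rep F F1 F2 -> bc_dir (tr F) (dn F1) ->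
  sqn (@inner R G) F <= poincare_constant * sqn (@inner R G) F1.
Proof.
move=> rF t0; have [LF LF1 LF2] := h2rep_L2 rF.
rewrite sqn_inner mulr_suml; apply: ler_sum => e _.
have [c1 _] := rF e.
apply: (le_trans (poincare_edge (len_gt0 e) c1 (t0 (e, false)))).
by rewrite ler_wpM2l ?sqr_ge0//; exact: sqn_edge_le.
Qed.

Lemma dirichlet_energy u v : bcop q (@bc_dir R G) (u, v) ->
  exists F F1 F2, [/\ h2rep F F1 F2, eqae u F, bc_dir (tr F) (dn F1) &
    sqn (@inner R G) F1 <= ReC (inner v u)].
Proof.
move=> /bcop_rep[Lu Lv [F [F1 [F2 [rF uF vE BF]]]]].
exists F, F1, F2; split=> //; have [LF LF1 LF2] := h2rep_L2 rF.
have LE : L2 (qmul F - F2) by apply: (siB HS) => //; exact: L2_qmul.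
rewrite (inner_eqae_l Lv LE Lu vE) (inner_eqae_r LE Lu LF uF).
apply: energy_ge => //; rewrite big1// => p _.
by rewrite BF conjc0 mulr0.
Qed.

Lemma dirichlet_coercive u v : bcop q (@bc_dir R G) (u, v) ->
  sqn (@inner R G) u <= poincare_constant * ReC (inner v u).
Proof.
move=> uv; have [F [F1 [F2 [rF uF BF le]]]] := dirichlet_energy uv.
have [LF _ _] := h2rep_L2 rF; have [Lu _ _] := uv.
rewrite (sqn_eqae Lu LF uF) (le_trans (poincare rF BF))//.
by rewrite ler_pM2l// poincare_constant_gt0.
Qed.

End Adjoint.

(** * Closed operators, closed range, and the Krein-von Neumann extension *)

Section Operators.
Variables (R : realType) (G : metric_graph R).
Implicit Types (A S : operator G) (f g h u v k : gfun G).
Let HS := @semi_inner_inner R G.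
Local Notation sqN := (sqn (@inner R G)).
Local Notation limN := (lim_to (@inner R G)).

Lemma lim_to_cauchy (u_ : nat -> gfun G) u : (forall n, L2 (u_ n)) -> L2 u ->
  limN u_ u -> cauchy (@inner R G) u_.
Proof.
move=> Lu_ Lu uu eps e0.
have e4 : 0 < eps / 4 by rewrite divr_gt0.
have /cvgr0Pnorm_lt/(_ _ e4)[N _ NP] := uu.
exists N => m n Nm Nn.
have hm := NP m Nm; have hn := NP n Nn.
have -> : u_ m - u_ n = (u_ m - u) - (u_ n - u).
  by rewrite opprB addrA subrK.
have LB j : L2 (u_ j - u) by exact: (siB HS).
have := sqnD_le HS (LB m) (siN HS (LB n)).
rewrite (sqnN HS (LB n)).
rewrite ger0_norm ?(sqn_ge0 HS)// in hm; rewrite ger0_norm ?(sqn_ge0 HS)// in hn.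
lra.
Qed.

Definition in_L2 A : Prop := forall f g, A (f, g) -> L2 f /\ L2 g.

Lemma adjoint_closed A (f_ g_ : nat -> gfun G) f g : in_L2 A ->
  (forall n, adjoint A (f_ n, g_ n)) -> L2 f -> L2 g ->
  limN f_ f -> limN g_ g -> adjoint A (f, g).
Proof.
move=> AL adj Lf Lg ff gg; split=> // u v uv; have [Lu Lv] := AL _ _ uv.
have Lf_ n : L2 (f_ n) by have [] := adj n.
have Lg_ n : L2 (g_ n) by have [] := adj n.
rewrite (ip_conj HS Lf Lv) (ip_conj HS Lg Lu); congr (conjc _).
apply: (lim_ip_eq HS Lf_ Lg_) => // n; have [_ _ h] := adj n.
by rewrite (ip_conj HS Lv (Lf_ n)) (ip_conj HS Lu (Lg_ n)); congr (conjc _); exact: h.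
Qed.

(** The difference of f and its projection on the domain is orthogonal to the
    domain, hence null. *)
Lemma dense_of_trivial_complement A : linear_operator A ->
  (forall g, L2 g -> (forall u v, A (u, v) -> inner u g = 0) -> eqae g 0) ->
  densely_defined A.
Proof.
move=> [AL Aext A0 Alin _] triv f Lf eps e0.
have [|||w_ [h [Ww Lh wh hW]]] := projection HS (W := dom A) (@complete_inner R G) _ _ _ Lf.
- by exists 0.
- by move=> a v w [v' vv] [w' ww]; exists (a *: v' + w'); exact: Alin.
- by move=> w [w' /AL[]].
have Lfh : L2 (f - h) by exact: (siB HS).
have fh0 : eqae (f - h) 0.
  apply: triv => // u v uv; have [Lu _] := AL _ _ uv.
  by rewrite (ip_conj HS Lfh Lu) hW ?conjc0//; exists v.
have /cvgr0Pnorm_lt/(_ _ (exprn_gt0 2 e0))[N _ /(_ N (leqnn _)) /= NP] := wh.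
exists (w_ N) => //; have [w' /AL[Lw _]] := Ww N.
rewrite norm2E -(ger0_norm (ltW e0)) -sqrtr_sqr ltr_sqrt ?exprn_gt0//.
have -> : f - w_ N = (f - h) + (h - w_ N) by rewrite addrA subrK.
rewrite (sqn_null_add HS) //; [|exact: (siB HS)|by apply/eqae0P].
rewrite (sqnBC HS)//; apply: le_lt_trans NP; exact: ler_norm.
Qed.

Definition coercive A (C : R) : Prop :=
  forall u v, A (u, v) -> sqN u <= C * ReC (inner v u).

Lemma coercive_bound A C u v : 0 < C -> in_L2 A -> coercive A C -> A (u, v) ->
  sqN u <= C ^+ 2 * sqN v.
Proof.
move=> C0 AL cA uv; have [Lu Lv] := AL _ _ uv.
have h1 := cA _ _ uv; have h2 := cauchy_schwarz HS Lv Lu.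
have h3 := Re_sqr_le_sqmod (inner v u).
have s0 := sqn_ge0 HS Lu.
have [->|sn0] := eqVneq (sqN u) 0; first by rewrite mulr_ge0 ?sqr_ge0 ?(sqn_ge0 HS).
have {}s0 : 0 < sqN u by rewrite lt_def sn0.
rewrite -(ler_pM2r s0).
apply: (@le_trans _ _ ((C * ReC (inner v u)) ^+ 2)).
  have cp := le_trans (ltW s0) h1.
  by rewrite -expr2 ler_sqr ?nnegrE ?(ltW s0).
rewrite exprMn -[leRHS]mulrA ler_pM2l ?exprn_gt0//; exact: le_trans h3 h2.
Qed.

Lemma coercive_kernel A C u v : in_L2 A -> coercive A C -> A (u, v) -> eqae v 0 -> eqae u 0.
Proof.
move=> AL cA uv v0; have [Lu Lv] := AL _ _ uv; apply/(eqae0P Lu).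
apply/eqP; rewrite eq_le (sqn_ge0 HS)// andbT.
have := cA _ _ uv; rewrite (ip_null_l HS) ?mulr0//; exact/eqae0P.
Qed.

(** Preimages of a Cauchy sequence in the range form a Cauchy sequence by
    coercivity, and an adjoint operator is closed; so the projection of g on the
    closure of the range lies in the range. *)
Lemma closed_range A A' C g : 0 < C -> linear_operator A -> in_L2 A' ->
  A = adjoint A' -> coercive A C -> L2 g ->
  exists u v, A (u, v) /\ forall u' v', A (u', v') -> inner (g - v) v' = 0.
Proof.
move=> C0 linA AL' AE cA Lg; have [AL Aext A0 Alin _] := linA.
pose W := [set v | exists u, A (u, v)].
have [|||w_ [h [Ww Lh wh hW]]] := projection HS (W := W) (@complete_inner R G) _ _ _ Lg.
- by exists 0.
- by move=> a v w [v' vv] [w' ww]; exists (a *: v' + w'); exact: Alin.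
- by move=> w [w' /AL[]].
have [u_ uP] := choice Ww.
have Lu_ n : L2 (u_ n) by have [] := AL _ _ (uP n).
have Lw_ n : L2 (w_ n) by have [] := AL _ _ (uP n).
have cu : cauchy (@inner R G) u_.
  move=> eps e0; have C2 : 0 < C ^+ 2 by rewrite exprn_gt0.
  have [N NP] := lim_to_cauchy Lw_ Lh wh (divr_gt0 e0 C2).
  exists N => m n Nm Nn.
  have Amn : A (u_ m - u_ n, w_ m - w_ n).
    have := Alin (-1) _ _ _ _ (uP n) (uP m); rewrite !scaleN1r addrC.
    by rewrite [- w_ n + _]addrC.
  apply: (le_lt_trans (coercive_bound C0 AL cA Amn)).
  by rewrite mulrC -ltr_pdivlMr//; exact: NP.
have [u Lu uu] := complete_inner Lu_ cu.
exists u, h; split; last by move=> u' v' uv'; apply: hW; exists u'.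
rewrite AE; apply: (adjoint_closed AL' _ Lu Lh uu wh) => n.
by rewrite -AE; exact: uP.
Qed.

End Operators.

Section Krein.
Variables (R : realType) (G : metric_graph R) (S : operator G) (C : R).
Implicit Types (f g h u v k : gfun G).
Let HS := @semi_inner_inner R G.
Local Notation sqN := (sqn (@inner R G)).
Local Notation T := (adjoint S).
Local Notation K := (krein_von_neumann S).
Hypothesis S_linear : linear_operator S.
Hypothesis T_linear : linear_operator T.
Hypothesis S_closed : S = adjoint T.
Hypothesis S_sub_T : S `<=` T.
Hypothesis C_gt0 : 0 < C.
Hypothesis S_coercive : coercive S C.

Let SL : in_L2 S. Proof. by case: S_linear. Qed.
Let TL : in_L2 T. Proof. by case: T_linear. Qed.

Lemma ker_T k : ker T k <-> T (k, 0).
Proof.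
split=> [[g Tkg g0]|Tk]; last by exists 0 => //; exact: eqae_refl.
have [_ Text _ _ _] := T_linear; have [Lk Lg] := TL Tkg.
apply: (Text _ _ _ _ Tkg Lk (si0 HS) (eqae_refl k) g0).
Qed.

(** The orthogonal complement of the range of S is the kernel of its adjoint. *)
Lemma range_complement g : L2 g -> exists u v k, [/\ S (u, v), T (k, 0) & g = v + k].
Proof.
move=> Lg; have [u [v [Suv orth]]] := closed_range C_gt0 S_linear TL S_closed S_coercive Lg.
have [Lu Lv] := SL Suv; have Lgv : L2 (g - v) by exact: (siB HS).
exists u, v, (g - v); split=> //; last by rewrite addrC subrK.
split=> //; first exact: (si0 HS).
move=> u' v' Suv'; have [Lu' Lv'] := SL Suv'.
by rewrite (ip_conj HS Lgv Lv') (orth _ _ Suv') conjc0 (ip0r HS).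
Qed.

(** If f = u + k with T k = 0, then T f = S u. *)
Lemma kreinP f g : K (f, g) <-> [/\ T (f, g), L2 g &
  exists u v k, [/\ S (u, v), T (k, 0), eqae f (u + k) & eqae g v]].
Proof.
have [_ _ _ Tlin Tfun] := T_linear; have [_ Text _ _ _] := T_linear.
split=> [[Tfg [u [k [[v Suv] /ker_T kT fE]]]]|[Tfg Lg [u [v [k [Suv Tk fE gE]]]]]].
  have [Lf Lg] := TL Tfg; have [Lu Lv] := SL Suv; have [Lk _] := TL kT.
  split=> //; exists u, v, k; split=> //.
  have := Tlin 1 _ _ _ _ (S_sub_T Suv) kT; rewrite !scale1r addr0 => Tuk.
  apply: (Tfun f) => //.
  apply: (Text _ _ _ _ Tuk) => //; [exact: eqae_sym|exact: eqae_refl].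
split=> //; exists u, k; split=> //; first by exists v.
exact/ker_T.
Qed.

Lemma krein_symmetric f g f' g' : K (f, g) -> K (f', g') -> inner g f' = inner f g'.
Proof.
move=> /kreinP[Tfg Lg [u [v [k [Suv Tk fE gE]]]]].
move=> /kreinP[Tfg' Lg' [u' [v' [k' [Suv' Tk' fE' gE']]]]].
have [Lf _] := TL Tfg; have [Lf' _] := TL Tfg'.
have [Lu Lv] := SL Suv; have [Lu' Lv'] := SL Suv'.
have [Lk _] := TL Tk; have [Lk' _] := TL Tk'.
have Luk : L2 (u + k) by exact: (siD HS).
have Luk' : L2 (u' + k') by exact: (siD HS).
have TS w z a b : S (w, z) -> T (a, b) -> inner z a = inner w b.
  by move=> Swz [_ _ h]; exact: h.
rewrite (inner_eqae_l Lg Lv Lf' gE) (inner_eqae_r Lv Lf' Luk' fE').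
rewrite (inner_eqae_l Lf Luk Lg' fE) (inner_eqae_r Luk Lg' Lv' gE').
rewrite (ipDr HS)// (ipDl HS)// (TS _ _ _ _ Suv Tk') (ip0r HS)// addr0.
rewrite (ip_conj HS Lv' Lk) (TS _ _ _ _ Suv' Tk) (ip0r HS)// conjc0 addr0.
exact: (TS _ _ _ _ Suv (S_sub_T Suv')).
Qed.

Lemma krein_linear : linear_operator K.
Proof.
have [TL' Text T0 Tlin Tfun] := T_linear; have [_ _ S0 Slin _] := S_linear.
split.
- by move=> f g [/TL].
- move=> f g f' g' [Tfg [u [k [Su kT fE]]]] Lf' Lg' ff gg; split.
    exact: Text Tfg Lf' Lg' ff gg.
  by exists u, k; split=> //; exact: eqae_trans (eqae_sym ff) fE.
- split=> //; exists 0, 0; split; [by exists 0|exact/ker_T|].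
  by rewrite addr0; exact: eqae_refl.
- move=> a f g f' g' [Tfg [u [k [[v Su] /ker_T kT fE]]]] [Tfg' [u' [k' [[v' Su'] /ker_T kT' fE']]]].
  split; first exact: Tlin.
  exists (a *: u + u'), (a *: k + k'); split.
  + by exists (a *: v + v'); exact: Slin.
  + by apply/ker_T; have := Tlin a _ _ _ _ kT kT'; rewrite scaler0 addr0.
  + apply: eqae_trans (eqae_lin a fE fE') _.
    by rewrite scalerDr addrACA; exact: eqae_refl.
- by move=> f g g' [Tfg _] [Tfg' _]; exact: (Tfun f).
Qed.

Lemma S_sub_krein : S `<=` K.
Proof.
have [_ _ T0 _ _] := T_linear.
move=> [u v] Suv; split; first exact: S_sub_T.
exists u, 0; split; [by exists v|exact/ker_T|].
by rewrite addr0; exact: eqae_refl.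
Qed.

Lemma S_dense : densely_defined S.
Proof.
apply: dense_of_trivial_complement => // g Lg orth.
have [_ _ T0 _ Tfun] := T_linear.
have : T (0, g).
  split=> //; first exact: (si0 HS).
  move=> u v Suv; have [Lu Lv] := SL Suv.
  by rewrite /= (ip0r HS)// (orth _ _ Suv).
by move=> /Tfun/(_ T0).
Qed.

(** Let (f, g) belong to the adjoint of K, and write g = S u + k with T k = 0.
    Testing with k, which lies in the kernel of K, gives k = 0; then T (f - u) = 0,
    so f lies in the domain of K. *)
Lemma krein_self_adjoint : self_adjoint K.
Proof.
split; first exact: krein_linear.
  move=> f Lf eps e0; have [u [v Suv] lt] := S_dense Lf e0.
  by exists u => //; exists v; exact: S_sub_krein.
apply/seteqP; split=> [[f g] [/= Lf Lg adj]|[f g] Kfg].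
  have [u [v [k [Suv Tk gE]]]] := range_complement Lg.
  have [Lu Lv] := SL Suv; have [Lk _] := TL Tk.
  have Kk : K (k, 0).
    apply/kreinP; split=> //; first exact: (si0 HS).
    have [_ _ S0 _ _] := S_linear.
    by exists 0, 0, k; split=> //; rewrite ?add0r; exact: eqae_refl.
  have TS w z a b : S (w, z) -> T (a, b) -> inner z a = inner w b.
    by move=> Swz [_ _ h]; exact: h.
  have k0 : sqN k = 0.
    have := adj _ _ Kk; rewrite (ip0l HS)// gE (ipDr HS)//.
    rewrite (ip_conj HS Lv Lk) (TS _ _ _ _ Suv Tk) (ip0r HS)// conjc0 add0r.
    by rewrite /sqn => <-.
  have gv : eqae g v.
    apply/(eqaeP Lg Lv); rewrite gE addrC addKr//.
  have Lfu : L2 (f - u) by exact: (siB HS).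
  have Tfu : T (f - u, 0).
    split=> //; first exact: (si0 HS).
    move=> u' v' Suv'; have [Lu' Lv'] := SL Suv'.
    rewrite /= (ip0r HS)// (ipBr HS)// (adj _ _ (S_sub_krein Suv')).
    rewrite (inner_eqae_r Lu' Lg Lv gv) -(TS _ _ _ _ Suv' (S_sub_T Suv)).
    by rewrite subrr.
  have [_ Text _ Tlin _] := T_linear.
  have Tfv : T (f, v).
    have := Tlin 1 _ _ _ _ Tfu (S_sub_T Suv).
    by rewrite !scale1r add0r subrK.
  apply/kreinP; split=> //.
    apply: (Text _ _ _ _ Tfv Lf Lg) => //; [exact: eqae_refl|exact: eqae_sym].
  exists u, v, (f - u); split=> //.
  by rewrite addrC subrK; exact: eqae_refl.
have [/= Tfg _] := Kfg; have [Lf Lg] := TL Tfg.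
by split=> // u v Kuv; exact: krein_symmetric.
Qed.

Lemma ker_krein k : ker K k <-> T (k, 0).
Proof.
split=> [[g [Tkg _] g0]|Tk]; first by apply/ker_T; exists g.
exists 0; last exact: eqae_refl.
split=> //; have [_ _ S0 _ _] := S_linear.
exists 0, k; split; [by exists 0|exact/ker_T|].
by rewrite add0r; exact: eqae_refl.
Qed.

(** In the decomposition f = u + k, the image under the adjoint of S only sees
    u; for lam <> 0 the function u solves the buckling problem. *)
Lemma krein_eigen f (lam : R) : K (f, lam%:C *: f) ->
  exists u k, [/\ S (u, lam%:C *: f), T (k, 0) & eqae f (u + k)].
Proof.
move=> /kreinP[Tfg Lg [u [v [k [Suv Tk fE gE]]]]].
exists u, k; split=> //; have [_ Sext _ _ _] := S_linear.
have [Lu Lv] := SL Suv.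
by apply: (Sext _ _ _ _ Suv) => //; [exact: eqae_refl|exact: eqae_sym].
Qed.

Lemma krein_ge0 f g : K (f, g) -> 0 <= ReC (inner g f).
Proof.
move=> /kreinP[Tfg Lg [u [v [k [Suv Tk fE gE]]]]].
have [Lf _] := TL Tfg; have [Lu Lv] := SL Suv; have [Lk _] := TL Tk.
have Luk : L2 (u + k) by exact: (siD HS).
rewrite (inner_eqae_l Lg Lv Lf gE) (inner_eqae_r Lv Lf Luk fE) (ipDr HS)//.
have [_ _ h] := Tk; rewrite (h _ _ Suv) (ip0r HS)// addr0.
rewrite -(pmulr_rge0 _ C_gt0); apply: le_trans (S_coercive Suv).
exact: (sqn_ge0 HS).
Qed.

End Krein.

(** * Compactness *)

Section EdgeBound.
Variables (R : realType) (l : R).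
Hypothesis l0 : 0 < l.
Local Notation I l := (`]0, l[%classic : set R).
Local Notation sqI := (sqn (ipI l)).
Let HI := semi_inner_ipI l.
Implicit Types (F : R -> R[i]).

Let sqn_one : sqI (fun=> 1) = l.
Proof. by rewrite sqn_cst ?ltW// -[1]/((1 : R)%:C) sqmod_real expr1n mulr1. Qed.

(** Subtract from F the affine function p with the same value and derivative
    at 0.  The remainder is controlled by F2, applying [poincare_edge] twice; hence p is
    controlled in L^2, and its coefficients by p, the affine functions being finite
    dimensional. *)
Lemma edge_bound : exists2 C, 0 < C & forall F F1 F2, cac l F F1 -> cac l F1 F2 ->
  sqmod (F 0) + sqI F1 <= C * (sqI F + sqI F2).
Proof.
pose X : R -> R[i] := fun x => x%:C; pose one : R -> R[i] := fun=> 1.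
have s1 : square_integrable l one by exact: sqi_cst.
have cX : cac l X one := cac_id l.
have sX : square_integrable l X := cac_sql l0 cX.
(* xp is the part of X orthogonal to 1; it extracts the coefficient c1 from p *)
have [c cP] := finite_projection HI 1 (fun=> s1) sX.
have {cP} := cP 0%N isT; rewrite big_ord1; set a := c 0%N; set xp := X - a *: one => xp1.
have sa1 : square_integrable l (a *: one) by exact: (siZ HI).
have sxp : square_integrable l xp by exact: (siB HI).
pose D := sqI xp.
have D0 : 0 < D.
  rewrite lt_def (sqn_ge0 HI) ?andbT//; apply/eqP => d0.
  have := sqn_ipI_eq0 sxp d0 => xp0.
  have XA : ae_equal l X (fun=> a).
    move: xp0; apply: ae_imp => x h Ix.
    have := h Ix; rewrite -[xp x]/(X x - a * 1) mulr1 => /eqP.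
    by rewrite subr_eq0 => /eqP.
  have E := cac_ae_eq l0 cX (cac_cst l a) XA.
  have El : X l = a by apply: E; rewrite lexx ltW.
  have E0 : X 0 = a by apply: E; rewrite lexx ltW.
  have := congr1 (@complex.Re R) (etrans El (esym E0)); rewrite /= => ll.
  by move: (l0); rewrite ll ltxx.
pose A : R := 2 + 2 * l ^+ 4.
have A0 : 0 < A by rewrite /A; have := exprn_gt0 4 l0; lra.
have K0 : 0 < A / D by rewrite divr_gt0.
have sX0 : 0 <= sqI X by exact: (sqn_ge0 HI).
pose C := (2 * A + 2 * (A / D) * sqI X) / l + (2 * l ^+ 2 + 2 * (A / D) * l).
have C0 : 0 < C.
  have h1 : 0 <= A / D * sqI X by rewrite mulr_ge0// ltW.
  have h2 : 0 < l ^+ 2 by rewrite exprn_gt0.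
  have h3 : 0 < A / D * l by rewrite mulr_gt0.
  have h4 : 0 < (2 * A + 2 * (A / D) * sqI X) / l by rewrite divr_gt0//; lra.
  by rewrite /C; lra.
exists C => // F F1 F2 cF cF1.
have sF := cac_sql l0 cF; have sF1 := cac_sqr cF; have sF2 := cac_sqr cF1.
pose c0 := F 0; pose c1 := F1 0.
pose N := sqI F + sqI F2.
have F0 : 0 <= sqI F by exact: (sqn_ge0 HI).
have F20 : 0 <= sqI F2 by exact: (sqn_ge0 HI).
pose p : R -> R[i] := c0 *: one + c1 *: X.
have sp : square_integrable l p by apply: (siD HI); exact: (siZ HI).
pose r := F - p; have sr : square_integrable l r by exact: (siB HI).
pose r1 := F1 - c1 *: one.
have sc1 : square_integrable l (c1 *: one) by exact: (siZ HI).
have sr1 : square_integrable l r1 by exact: (siB HI).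
have cr1 : cac l r1 F2.
  apply: cac_eq (cacD cF1 (cac_cst l (- c1))) => x; last by rewrite addr0.
  by rewrite -[RHS]/(F1 x - c1 * 1) mulr1.
have cr : cac l r r1.
  apply: cac_eq (cacD cF (cacD (cac_cst l (- c0)) (cacZ l0 (- c1) cX))) => x.
    by rewrite -[RHS]/(F x - (c0 * 1 + c1 * X x)); ring.
  by rewrite -[RHS]/(F1 x - c1 * 1) add0r mulNr.
have r10 : r1 0 = 0 by rewrite -[LHS]/(F1 0 - c1 * 1) mulr1 subrr.
have r0 : r 0 = 0.
  by rewrite -[LHS]/(F 0 - (c0 * 1 + c1 * 0%:C)) rmorph0 mulr0 addr0 mulr1 subrr.
have b1 := poincare_edge l0 cr1 r10.
have b2 := poincare_edge l0 cr r0.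
have b3 : sqI p <= A * N.
  have -> : p = F - r by rewrite /r opprB addrC subrK.
  apply: (le_trans (sqnD_le HI sF (siN HI sr))); rewrite (sqnN HI sr).
  have : sqI r <= l ^+ 4 * sqI F2.
    rewrite (le_trans b2)// (_ : l ^+ 4 = l ^+ 2 * l ^+ 2); last by ring.
    by rewrite -mulrA ler_wpM2l ?sqr_ge0.
  have : 0 <= l ^+ 4 * sqI F by rewrite mulr_ge0// exprn_ge0// ltW.
  rewrite /A /N; move: (l ^+ 4) => L4; nra.
have ipp : ipI l p xp = c1 * D%:C.
  have e1 : ipI l one xp = 0 by rewrite (ip_conj HI sxp s1) xp1 conjc0.
  have e2 : ipI l X xp = D%:C.
    have XE : X = xp + a *: one by rewrite subrK.
    by rewrite {1}XE (ipDl HI)// (ipZl HI)// e1 mulr0 addr0 (ip_sqn HI).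
  by rewrite (ipDl HI) ?(ipZl HI) ?e1 ?e2 ?mulr0 ?add0r//; exact: (siZ HI).
have bc1 : sqmod c1 <= A / D * N.
  have := cauchy_schwarz HI sp sxp; rewrite ipp sqmodM sqmod_real -/D => h.
  rewrite mulrAC ler_pdivlMr//.
  have : sqmod c1 * D <= sqI p by rewrite -(ler_pM2r D0) -mulrA -expr2.
  by move=> /le_trans; apply.
have m1 := sqmod_ge0 c1; have m0 := sqmod_ge0 c0.
have bc0 : sqmod c0 <= (2 * A + 2 * (A / D) * sqI X) / l * N.
  have sc0 : square_integrable l (c0 *: one) by exact: (siZ HI).
  have scX : square_integrable l (c1 *: X) by exact: (siZ HI).
  have : sqI (c0 *: one) <= 2 * sqI p + 2 * sqI (c1 *: X).
    rewrite -[sqI (c1 *: X)](sqnN HI)//.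
    have -> : c0 *: one = p + - (c1 *: X) by rewrite /p addrK.
    exact: (sqnD_le HI sp (siN HI scX)).
  rewrite !(sqnZ HI)// sqn_one => h.
  rewrite mulrAC ler_pdivlMr//; apply: (le_trans h).
  have : sqmod c1 * sqI X <= A / D * N * sqI X by rewrite ler_wpM2r.
  lra.
have bF1 : sqI F1 <= (2 * l ^+ 2 + 2 * (A / D) * l) * N.
  have -> : F1 = r1 + c1 *: one by rewrite subrK.
  apply: (le_trans (sqnD_le HI sr1 sc1)).
  rewrite (sqnZ HI)// sqn_one.
  have : sqmod c1 * l <= A / D * N * l by rewrite ler_wpM2r// ltW.
  have : l ^+ 2 * sqI F2 <= l ^+ 2 * N by rewrite ler_wpM2l ?sqr_ge0// lerDr.
  lra.
rewrite /C mulrDl; exact: lerD.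
Qed.

End EdgeBound.

Section Ultra.
Variable R : realType.

(** The supremum of all t with t <= r n for U-almost all n is the limit of r
    along the ultrafilter U. *)
Lemma ultra_bounded_cauchy (U : set_system nat) (r : nat -> R) (B e : R) :
  UltraFilter U -> (forall n, `|r n| <= B) -> 0 < e ->
  exists2 A, U A & forall m n, A m -> A n -> `|r m - r n| < e.
Proof.
move=> UU rB e0.
pose Q : set R := [set t | U [set n | t <= r n]].
have Q0 : Q (- B).
  apply: filterS (@filterT _ U _) => n _ /=.
  by have := rB n; rewrite ler_norml => /andP[].
have Qub : ubound Q B.
  move=> t Qt; rewrite leNgt; apply/negP => Bt.
  have [n /= tn] := filter_ex Qt.
  by have := rB n; rewrite ler_norml => /andP[_ nB]; lra.
have hQ : has_sup Q by split; [exists (- B)|exists B].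
have e2 : 0 < e / 2 by rewrite divr_gt0.
have [t Qt tp] := sup_adherent e2 hQ.
have nQ : ~ Q (sup Q + e / 2).
  by move=> /(ub_le_sup hQ.2); rewrite gerDl leNgt e2.
have [//|UC] := in_ultra_setVsetC [set n | sup Q + e / 2 <= r n] UU.
exists ([set n | t <= r n] `&` ~` [set n | sup Q + e / 2 <= r n]).
  exact: filterI.
move=> m n [/= m1 /negP m2] [/= n1 /negP n2].
by rewrite -ltNge in m2; rewrite -ltNge in n2; rewrite ltr_norml; apply/andP; split; lra.
Qed.

Lemma ultra_bounded_cauchy_complex (U : set_system nat) (z : nat -> R[i]) (B e : R) :
  UltraFilter U -> (forall n, sqmod (z n) <= B) -> 0 < e ->
  exists2 A, U A & forall m n, A m -> A n -> sqmod (z m - z n) <= e.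
Proof.
move=> UU zB e0; have e2 : 0 < Num.sqrt (e / 2) by rewrite sqrtr_gt0 divr_gt0.
have B0 : 0 <= B := le_trans (sqmod_ge0 (z 0%N)) (zB 0%N).
have bnd (x : R) : x ^+ 2 <= B -> `|x| <= Num.sqrt B.
  by move=> xB; rewrite -sqrtr_sqr ler_sqrt.
have [A1 UA1 h1] := ultra_bounded_cauchy UU
  (fun n => bnd _ (le_trans (Re_sqr_le_sqmod _) (zB n))) e2.
have [A2 UA2 h2] := ultra_bounded_cauchy UU
  (fun n => bnd _ (le_trans (Im_sqr_le_sqmod _) (zB n))) e2.
exists (A1 `&` A2); first exact: filterI.
move=> m n [m1 m2] [n1 n2]; have := h1 _ _ m1 n1; have := h2 _ _ m2 n2.
have sq (x : R) : `|x| < Num.sqrt (e / 2) -> x ^+ 2 <= e / 2.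
  rewrite -sqrtr_sqr ltr_sqrt ?divr_gt0// => /ltW; exact.
by move=> /sq hi /sq hr; rewrite /sqmod cReB cImB; lra.
Qed.

Lemma ultra_finite (U : set_system nat) (n : nat) (P : nat -> set nat) :
  UltraFilter U -> (forall i, (i <= n)%N -> U (P i)) ->
  U [set k | forall i, (i <= n)%N -> P i k].
Proof.
move=> UU; elim: n => [|n IH] UP.
  by apply: filterS (UP 0%N (leqnn _)) => k Pk i; rewrite leqn0 => /eqP ->.
have h1 := IH (fun i ik => UP i (leq_trans ik (leqnSn n))).
apply: filterS2 h1 (UP n.+1 (leqnn _)) => k h hn i.
by rewrite leq_eqVlt => /predU1P[->//|]; rewrite ltnS; exact: h.
Qed.

(** The argument of Arzela and Ascoli: equicontinuity reduces uniform closeness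
    to closeness on a finite grid. *)
Lemma ultra_equicontinuous (U : set_system nat) (l B e : R) (F_ : nat -> R -> R[i]) :
  UltraFilter U -> 0 < l -> 0 <= B ->
  (forall n x, 0 <= x <= l -> sqmod (F_ n x) <= B) ->
  (forall n x y, 0 <= x -> x <= y -> y <= l -> sqmod (F_ n y - F_ n x) <= (y - x) * B) ->
  0 < e -> exists2 A, U A & forall m n, A m -> A n ->
    forall x, 0 <= x <= l -> sqmod (F_ m x - F_ n x) <= e.
Proof.
move=> UU l0 B0 FB FH e0.
have e8 : 0 < e / 16 by rewrite divr_gt0.
(* a mesh h = l / (K + 1) with h B <= e / 16 *)
pose K := Num.truncn (l * B / (e / 16)).
pose h := l / K.+1%:R.
have K0 : 0 < K.+1%:R :> R by rewrite ltr0n.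
have h0 : 0 < h by rewrite divr_gt0.
have hB : h * B <= e / 16.
  have /truncn_itv/andP[_] : 0 <= l * B / (e / 16).
    by rewrite divr_ge0 ?(ltW e8)// mulr_ge0// ltW.
  rewrite -/K ltr_pdivrMr// => /ltW lt.
  by rewrite /h mulrAC ler_pdivrMr// [leRHS]mulrC.
pose g (i : nat) := Num.min (i%:R * h) l.
have gl i : 0 <= g i <= l.
  rewrite /g; apply/andP; split; last by rewrite ge_min lexx orbT.
  by rewrite le_min (ltW l0) andbT mulr_ge0 ?ler0n// ltW.
have exA (i : nat) : exists A, U A /\ forall m n, A m -> A n ->
    sqmod (F_ m (g i) - F_ n (g i)) <= e / 16.
  have [A UA AP] := ultra_bounded_cauchy_complex UU (fun n => FB n _ (gl i)) e8.
  by exists A.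
have [A_ AP] := choice exA.
exists [set k | forall i, (i <= K.+1)%N -> A_ i k].
  by apply: ultra_finite => i _; have [] := AP i.
move=> m n Am An x /andP[x0 xl].
pose i := Num.truncn (x / h).
have /truncn_itv/andP[i1 i2] : 0 <= x / h by rewrite divr_ge0// (ltW h0).
rewrite -/i ler_pdivlMr// in i1; rewrite -/i ltr_pdivrMr// in i2.
have iK : (i <= K.+1)%N.
  rewrite -(ler_nat R) -(ler_pM2r h0) (le_trans i1)// (le_trans xl)//.
  by rewrite /h mulrC divfK// gt_eqF.
have gx : g i = i%:R * h by rewrite /g; apply/min_idPl; exact: le_trans xl.
have gi0 : 0 <= g i by have /andP[] := gl i.
have gix : g i <= x by rewrite gx.
have near k : sqmod (F_ k x - F_ k (g i)) <= e / 16.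
  apply: (le_trans (FH k _ _ gi0 gix xl)); apply: le_trans hB.
  rewrite ler_wpM2r// gx; move: i2; rewrite -natr1 mulrDl mul1r; lra.
have grid := (AP i).2 m n (Am i iK) (An i iK).
have -> : F_ m x - F_ n x = (F_ m x - F_ m (g i)) +
   ((F_ m (g i) - F_ n (g i)) - (F_ n x - F_ n (g i))) by ring.
have h1 := sqmodD_le (F_ m x - F_ m (g i))
  ((F_ m (g i) - F_ n (g i)) - (F_ n x - F_ n (g i))).
have h2 := sqmodD_le (F_ m (g i) - F_ n (g i)) (- (F_ n x - F_ n (g i))).
rewrite sqmodN in h2.
have := near m; have := near n; lra.
Qed.

(** Choose the n-th term in the intersection of the first n + 1 of the sets on
    which the sequence varies by at most 1 / (k + 1). *)
Lemma ultra_extract (T : Type) (dist : T -> T -> R) (U : set_system nat) (u_ : nat -> T) :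
  UltraFilter U -> (forall N, U [set n | (N <= n)%N]) ->
  (forall e, 0 < e -> exists2 A, U A & forall m n, A m -> A n -> dist (u_ m) (u_ n) <= e) ->
  exists phi : nat -> nat, (forall n, (n <= phi n)%N) /\
    forall e, 0 < e -> exists N, forall m n, (N <= m)%N -> (N <= n)%N ->
      dist (u_ (phi m)) (u_ (phi n)) < e.
Proof.
move=> UU Utail cau.
have ex (k : nat) : exists A, U A /\
    forall m n, A m -> A n -> dist (u_ m) (u_ n) <= k.+1%:R^-1.
  have [|A UA AP] := cau k.+1%:R^-1; first by rewrite invr_gt0.
  by exists A.
have [A_ AP] := choice ex.
have ex2 (k : nat) : exists n, (k <= n)%N /\ forall i, (i <= k)%N -> A_ i n.
  have UI : U [set n | forall i, (i <= k)%N -> A_ i n].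
    by apply: ultra_finite => i _; have [] := AP i.
  have [n [/= n1 n2]] := filter_ex (filterI (Utail k) UI).
  by exists n.
have [phi phiP] := choice ex2.
exists phi; split; first by move=> n; have [] := phiP n.
move=> e e0; have [N _ NP] := near_infty_natSinv_lt (PosNum e0).
exists N => m n Nm Nn; apply: le_lt_trans (NP N (leqnn _)).
by apply: (AP N).2; [exact: (phiP m).2|exact: (phiP n).2].
Qed.

End Ultra.

Section Precompact.
Variables (R : realType) (G : metric_graph R).
Implicit Types (f g : gfun G).
Let HS := @semi_inner_inner R G.
Local Notation sqN := (sqn (@inner R G)).

(** Compactness of the embedding of the domain, with its graph norm, in L^2; for
    self-adjoint A this amounts to compactness of the resolvent. *)
Definition compact_domain (A : operator G) : Prop :=
  forall (f_ g_ : nat -> gfun G) (C : R), (forall n, A (f_ n, g_ n)) ->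
  (forall n, sqN (f_ n) <= C) -> (forall n, sqN (g_ n) <= C) ->
  exists phi : nat -> nat, (forall n, (n <= phi n)%N) /\
    cauchy (@inner R G) (fun n => f_ (phi n)).

Lemma compact_domain_sub (A A' : operator G) : A `<=` A' ->
  compact_domain A' -> compact_domain A.
Proof. by move=> AA cA f_ g_ C Afg; apply: cA => n; exact: AA. Qed.

(** By [edge_bound] the derivatives F1_ are bounded in L^2, so the F_ are equicontinuous. *)
Lemma rep_compact (F_ F1_ F2_ : nat -> gfun G) (C : R) :
  (forall n, h2rep (F_ n) (F1_ n) (F2_ n)) ->
  (forall n, sqN (F_ n) <= C) -> (forall n, sqN (F2_ n) <= C) ->
  exists phi : nat -> nat, (forall n, (n <= phi n)%N) /\
    cauchy (@inner R G) (fun n => F_ (phi n)).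
Proof.
move=> rF FC F2C.
have LF n : L2 (F_ n) by have [] := h2rep_L2 (rF n).
have C0 : 0 <= C := le_trans (sqn_ge0 HS (LF 0%N)) (FC 0%N).
have [U [UU tailU]] := @ultraFilterLemma _ (\oo : set_system nat) _.
have Utail N : U [set n | (N <= n)%N] by apply: tailU; exists N.
apply: (@ultra_extract R (gfun G) (fun u v => sqN (u - v)) U F_ UU Utail) => e e0.
pose Ltot : R := \sum_(j : edge G) len j.
have Lj j : len (j : edge G) <= Ltot.
  rewrite /Ltot (bigD1 j)//= lerDl; apply: sumr_ge0 => i _; exact/ltW/len_gt0.
have Ltot0 : 0 < Ltot.
  have /card_gt0P[j _] := edge_nonempty G; exact: lt_le_trans (len_gt0 j) (Lj j).
have eL : 0 < e / Ltot by rewrite divr_gt0.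
have ex (j : edge G) : exists A, U A /\ forall m n, A m -> A n ->
    forall x, 0 <= x <= len j -> sqmod (F_ m j x - F_ n j x) <= e / Ltot.
  have lj := len_gt0 j.
  have [K K0 KP] := edge_bound lj.
  have bnd n : sqmod (F_ n j 0) + sqn (ipI (len j)) (F1_ n j) <= K * (2 * C).
    have [c1 c2] := rF n j; apply: (le_trans (KP _ _ _ c1 c2)); rewrite ler_pM2l//.
    have [_ _ LF2] := h2rep_L2 (rF n).
    have := sqn_edge_le j (LF n); have := sqn_edge_le j LF2.
    have := FC n; have := F2C n; lra.
  have KC : 0 <= K * (2 * C) by rewrite mulr_ge0 ?mulr_ge0// ltW.
  have F1b n : sqn (ipI (len j)) (F1_ n j) <= K * (2 * C).
    by have := bnd n; have := sqmod_ge0 (F_ n j 0); lra.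
  have F0b n : sqmod (F_ n j 0) <= K * (2 * C).
    have [_ LF1 _] := h2rep_L2 (rF n).
    have := bnd n; have := sqn_ge0 (semi_inner_ipI (len j)) (LF1 j); lra.
  have hold n x y : 0 <= x -> x <= y -> y <= len j ->
      sqmod (F_ n j y - F_ n j x) <= (y - x) * (K * (2 * C)).
    move=> x0 xy yl; have [c1 _] := rF n j.
    apply: (le_trans (hoelder_edge c1 x0 xy yl)).
    by rewrite ler_wpM2l ?subr_ge0.
  pose B := 2 * (len j * (K * (2 * C))) + 2 * (K * (2 * C)) + K * (2 * C).
  have lKC : 0 <= len j * (K * (2 * C)) by rewrite mulr_ge0// ltW.
  have [|n x xl|n x y x0 xy yl|A UA AP] :=
      @ultra_equicontinuous R U (len j) B (e / Ltot) (fun n => F_ n j) UU lj _ _ _ eL.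
  - by rewrite /B; lra.
  - move: xl => /andP[x0 xl].
    have -> : F_ n j x = (F_ n j x - F_ n j 0) + F_ n j 0 by ring.
    apply: (le_trans (sqmodD_le _ _)).
    have := hold n 0 x (lexx _) x0 xl; rewrite subr0 => h1.
    have h2 := F0b n.
    have h3 : x * (K * (2 * C)) <= len j * (K * (2 * C)) by rewrite ler_wpM2r.
    by rewrite /B; lra.
  - apply: (le_trans (hold n x y x0 xy yl)); rewrite ler_wpM2l ?subr_ge0//.
    by rewrite /B; lra.
  - by exists A.
have [A_ AP] := choice ex.
exists [set n | forall j, A_ j n].
  have US (r : seq (edge G)) : U [set n | forall j, j \in r -> A_ j n].
    elim: r => [|a r IH].
      by apply: filterS (@filterT _ U _) => n _ j; rewrite in_nil.
    apply: filterS2 IH (AP a).1 => n h ha j; rewrite in_cons => /predU1P[->//|].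
    exact: h.
  by apply: filterS (US (enum (edge G))) => n h j; apply: h; rewrite mem_enum.
move=> m n Am An; rewrite sqn_inner.
have -> : e = \sum_(j : edge G) len j * (e / Ltot).
  by rewrite -mulr_suml -/Ltot mulrC divfK// gt_eqF.
apply: ler_sum => j _.
apply: (sqn_le_sup (len_gt0 j)); first exact: (siB HS (LF m) (LF n) j).
by move=> x xl; apply: (AP j).2.
Qed.

End Precompact.

(** * Eigenvalues of self-adjoint operators with compact domain embedding *)

(** The parallelogram law S + D = 2 m + 2 k for two almost minimisers with m
    and k close to the infimum c: their sum has squared norm 4 - d, which bounds S from
    below, so their distance D is small. *)
Lemma parallelogram_arith (R : realType) (c D S m k im ik eps d : R) :
  S + D = 2 * m + 2 * k -> c * 4 - c * d <= S -> m <= c + im -> k <= c + ik ->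
  im < eps / 8 -> ik < eps / 8 -> c * d <= eps / 2 -> D < eps.
Proof. lra. Qed.

Section Spectral.
Variables (R : realType) (G : metric_graph R) (A : operator G).
Implicit Types (f g h u v w : gfun G) (p : nat -> gfun G * R).
Let HS := @semi_inner_inner R G.
Local Notation sqN := (sqn (@inner R G)).
Hypothesis A_sa : self_adjoint A.
Hypothesis A_compact : compact_domain A.

Let AL : in_L2 A. Proof. by case: A_sa => -[]. Qed.
Let Alin : forall (a : R[i]) f g f' g', A (f, g) -> A (f', g') ->
  A (a *: f + f', a *: g + g').
Proof. by case: A_sa => -[]. Qed.
Let Aext : forall f g f' g', A (f, g) -> L2 f' -> L2 g' -> eqae f f' -> eqae g g' -> A (f', g').
Proof. by case: A_sa => -[]. Qed.
Let A0 : A (0, 0). Proof. by case: A_sa => -[]. Qed.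
Let AZ (a : R[i]) f g : A (f, g) -> A (a *: f, a *: g).
Proof. by move=> Afg; have := Alin a Afg A0; rewrite !addr0. Qed.
Let AD f g f' g' : A (f, g) -> A (f', g') -> A (f + f', g + g').
Proof. by move=> a b; have := Alin 1 a b; rewrite !scale1r. Qed.
Let AB f g f' g' : A (f, g) -> A (f', g') -> A (f - f', g - g').
Proof. by move=> a b; have := Alin (-1) b a; rewrite !scaleN1r ![- _ + _]addrC. Qed.
Let Asum (n : nat) (F F' : 'I_n -> gfun G) : (forall i, A (F i, F' i)) ->
  A (\sum_i F i, \sum_i F' i).
Proof.
elim: n F F' => [|n IH] F F' h; first by rewrite !big_ord0.
by rewrite !big_ord_recr/=; apply: AD => //; apply: IH => i; exact: h.
Qed.
Lemma sa_symmetric f g u v : A (f, g) -> A (u, v) -> inner g u = inner f v.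
Proof.
move=> Afg; case: A_sa => _ _ AE; rewrite -[X in X (u, v)]AE => -[_ _ h].
exact: h.
Qed.

(** Sequences are used instead of tuples so that a family can be extended without
    changing its type. *)
Definition eigenfamily (n : nat) p : Prop :=
  (forall i, (i < n)%N -> A ((p i).1, (p i).2%:C *: (p i).1)) /\
  forall i j, (i < n)%N -> (j < n)%N -> inner (p i).1 (p j).1 = (i == j)%:R.

Definition perp_family (n : nat) p f : Prop :=
  forall i, (i < n)%N -> inner f (p i).1 = 0.

Lemma eigenfamily_L2 n p i : eigenfamily n p -> (i < n)%N -> L2 (p i).1.
Proof. by move=> [h _] /h/AL[]. Qed.

Lemma eigenfamily_orthonormal n p : eigenfamily n p ->
  orthonormal (@L2 R G) (@inner R G) (fun i : 'I_n => (p i).1).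
Proof.
move=> ep; split=> [i|i j]; first exact: (eigenfamily_L2 ep).
by case: ep => _ ->.
Qed.

Lemma perp_family_lin n p (a : R[i]) f g : eigenfamily n p -> L2 f -> L2 g ->
  perp_family n p f -> perp_family n p g -> perp_family n p (a *: f + g).
Proof.
move=> ep Lf Lg pf pg i ni; have Li := eigenfamily_L2 ep ni.
by rewrite (si_linl HS)// pf// pg// mulr0 addr0.
Qed.

Section Minimizer.
Variables (n : nat) (p : nat -> gfun G * R) (s : R).
Hypothesis ep : eigenfamily n p.

Let shift (fg : gfun G * gfun G) : gfun G := fg.2 - s%:C *: fg.1.
Let D : set (gfun G * gfun G) := [set fg | A fg /\ perp_family n p fg.1].

Let D_L2 fg : D fg -> [/\ L2 fg.1, L2 fg.2 & L2 (shift fg)].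
Proof.
case: fg => f g [/AL[Lf Lg] _]; split=> //.
by apply: (siB HS) => //; exact: (siZ HS).
Qed.

Let D_lin (a : R[i]) fg fg' : D fg -> D fg' -> D (a *: fg + fg').
Proof.
case: fg fg' => [f g] [f' g'] [Afg pf] [Afg' pf']; split; first exact: Alin.
have [Lf _] := AL Afg; have [Lf' _] := AL Afg'.
exact: perp_family_lin.
Qed.

Let D0 : D 0.
Proof. by split=> // i ni; rewrite (ip0l HS)//; exact: (eigenfamily_L2 ep). Qed.

Let shift_lin (a : R[i]) fg fg' : shift (a *: fg + fg') = a *: shift fg + shift fg'.
Proof.
rewrite /shift /= scalerDr scalerBr opprD !scalerA [s%:C * a]mulrC.
by rewrite addrACA.
Qed.

Let reduce v w : A (v, w) -> exists v' w', [/\ D (v', w'),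
  v = v' + \sum_(i < n) inner v (p i).1 *: (p i).1 &
  w = w' + \sum_(i < n) inner v (p i).1 *: ((p i).2%:C *: (p i).1)].
Proof.
move=> Avw; have [Lv Lw] := AL Avw.
have on := eigenfamily_orthonormal ep.
exists (v - \sum_(i < n) inner v (p i).1 *: (p i).1).
exists (w - \sum_(i < n) inner v (p i).1 *: ((p i).2%:C *: (p i).1)).
split; rewrite ?subrK//; split.
  apply: AB => //; apply: Asum => i; apply: AZ; exact: ep.1.
by move=> i ni; have := orthonormal_residual HS (Ordinal ni) on Lv.
Qed.

Let scaleC_sqn (a : R) f : L2 f -> sqN (a%:C *: f) = a ^+ 2 * sqN f.
Proof. by move=> Lf; rewrite (sqnZ HS)// sqmod_real. Qed.

Lemma normalize f g : A (f, g) -> sqN f != 0 -> exists2 t : R, 0 < t &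
  sqN (t%:C *: f) = 1.
Proof.
move=> /AL[Lf _] f0; have fp : 0 < sqN f by rewrite lt_def f0 (sqn_ge0 HS).
exists (Num.sqrt (sqN f))^-1; first by rewrite invr_gt0 sqrtr_gt0.
by rewrite scaleC_sqn// exprVn sqr_sqrtr ?(sqn_ge0 HS)// mulVf.
Qed.

(** Let c be the infimum of |(A - s) f|^2 over the normalised f in the domain
    that are orthogonal to the family.  By compactness and the parallelogram law
    a minimising sequence converges, and the limit f is a minimiser.  Being a null
    vector of the nonnegative form |(A - s) v|^2 - c |v|^2, it is orthogonal to
    everything for this form, that is (A - s)^2 f = c f.  With r the square root
    of c this factors as (A - s - r) (A - s + r) f = 0, so either
    h = (A - s + r) f is an eigenfunction for s + r, or h = 0 and f is an
    eigenfunction for s - r. *)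
Lemma minimal_eigenfunction v0 w0 : A (v0, w0) -> perp_family n p v0 -> sqN v0 != 0 ->
  exists f (lam : R), [/\ A (f, lam%:C *: f), sqN f = 1, perp_family n p f &
    forall v w, A (v, w) -> perp_family n p v ->
      (lam - s) ^+ 2 * sqN v <= sqN (w - s%:C *: v)].
Proof.
move=> Av0 pv0 v0n.
pose Q := [set sqN (shift fg) | fg in [set fg | D fg /\ sqN fg.1 = 1]].
have normD fg : D fg -> sqN fg.1 != 0 -> exists2 t : R, 0 < t &
    D (t%:C *: fg) /\ sqN (t%:C *: fg).1 = 1.
  move=> Dfg f0; have Af : A (fg.1, fg.2) by case: (fg) Dfg => f g [].
  have [t t0 tf] := normalize Af f0.
  by exists t => //; split=> //; have := D_lin t%:C Dfg D0; rewrite addr0.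
have hQ : has_inf Q.
  split.
    have [t t0 [Dt tf]] := @normD (v0, w0) (conj Av0 pv0) v0n.
    by exists (sqN (shift (t%:C *: (v0, w0)))); exists (t%:C *: (v0, w0)).
  exists 0 => _ [fg [Dfg _] <-]; apply: (sqn_ge0 HS).
  by have [] := D_L2 Dfg.
pose c := inf Q.
have c0 : 0 <= c.
  apply: lb_le_inf hQ.1 _ => _ [fg [Dfg _] <-]; apply: (sqn_ge0 HS).
  by have [] := D_L2 Dfg.
have shiftZ (a : R[i]) fg : shift (a *: fg) = a *: shift fg.
  by have := shift_lin a fg 0; rewrite !addr0 /shift /= scaler0 subr0 addr0.
have cP fg : D fg -> c * sqN fg.1 <= sqN (shift fg).
  move=> Dfg; have [Lf Lg Ls] := D_L2 Dfg.
  have [f0|f0] := eqVneq (sqN fg.1) 0; first by rewrite f0 mulr0 (sqn_ge0 HS).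
  have [t t0 [Dt tf]] := normD fg Dfg f0.
  have le : c <= t ^+ 2 * sqN (shift fg).
    rewrite -scaleC_sqn// -shiftZ; apply: ge_inf; first exact: hQ.2.
    by exists (t%:C *: fg).
  have tf1 : t ^+ 2 * sqN fg.1 = 1 by rewrite -scaleC_sqn.
  have t2 : 0 < t ^+ 2 by rewrite exprn_gt0.
  by rewrite -(ler_pM2l t2) mulrCA tf1 mulr1.
have ex (k : nat) : exists fg, [/\ D fg, sqN fg.1 = 1 & sqN (shift fg) <= c + k.+1%:R^-1].
  have k0 : 0 < k.+1%:R^-1 :> R by rewrite invr_gt0 ltr0n.
  by have [_ [fg [Dfg f1] <-] /ltW lt] := inf_adherent k0 hQ; exists fg.
have [fg_ fgP] := choice ex.
have inv1 (k : nat) : k.+1%:R^-1 <= 1 :> R by rewrite invf_le1 ?ltr0n// ler1n.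
have [|||phi [phik cauf]] := @A_compact (fun k => (fg_ k).1) (fun k => (fg_ k).2)
    (1 + (2 * (c + 1) + 2 * s ^+ 2)).
- by move=> k; have [[+ _] _ _] := fgP k; case: (fg_ k).
- move=> k; have [_ -> _] := fgP k; rewrite lerDl.
  by have := sqr_ge0 s; lra.
- move=> k; have [Dk f1 le] := fgP k; have [Lf Lg Ls] := D_L2 Dk.
  have -> : (fg_ k).2 = shift (fg_ k) + s%:C *: (fg_ k).1 by rewrite subrK.
  have LsZ : L2 (s%:C *: (fg_ k).1) by exact: (siZ HS).
  apply: (le_trans (sqnD_le HS Ls LsZ)).
  rewrite scaleC_sqn// f1 mulr1; have := inv1 k.
  by move: (k.+1%:R^-1) le => i le i1; lra.
pose fg k := fg_ (phi k).
have Dk k : D (fg k) by have [] := fgP (phi k).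
have f1 k : sqN (fg k).1 = 1 by have [] := fgP (phi k).
have le k : sqN (shift (fg k)) <= c + k.+1%:R^-1.
  have [_ _ h] := fgP (phi k); apply: (le_trans h); rewrite lerD2l.
  by rewrite lef_pV2 ?posrE ?ltr0n// ler_nat ltnS.
have Lfk k : L2 (fg k).1 by have [] := D_L2 (Dk k).
have Lsk k : L2 (shift (fg k)) by have [] := D_L2 (Dk k).
have caus : cauchy (@inner R G) (fun k => shift (fg k)).
  move=> eps e0.
  have ec : 0 < eps / (2 * (c + 1)) by rewrite divr_gt0//; lra.
  have [N1 N1P] := cauf _ ec.
  have e8 : 0 < eps / 8 by rewrite divr_gt0.
  have [N2 _ N2P] := near_infty_natSinv_lt (PosNum e8).
  exists (maxn N1 N2) => m k; rewrite !geq_max => /andP[m1 m2] /andP[k1 k2].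
  have hf := N1P m k m1 k1.
  have hm := N2P m m2; have hk := N2P k k2; rewrite /= in hm hk.
  have par := parallelogram HS (Lsk m) (Lsk k).
  have parf := parallelogram HS (Lfk m) (Lfk k).
  rewrite !f1 in parf.
  have DD : D (1 *: fg m + fg k) by exact: D_lin.
  have := cP _ DD; rewrite shift_lin scale1r [(_ + _).1]/= scale1r.
  have lem := le m; have lek := le k.
  have hfc : c * sqN ((fg m).1 - (fg k).1) <= eps / 2.
    have h1 : c * sqN ((fg m).1 - (fg k).1) <= c * (eps / (2 * (c + 1))).
      by rewrite ler_wpM2l// ltW.
    apply: (le_trans h1).
    have c1 : 0 < c + 1 by rewrite ltr_pwDr.
    have -> : c * (eps / (2 * (c + 1))) = eps / 2 * (c / (c + 1)) by field; rewrite gt_eqF.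
    apply: ler_piMr; first by rewrite divr_ge0// ltW.
    by rewrite ler_pdivrMr// mul1r lerDl.
  move: (m.+1%:R^-1) (k.+1%:R^-1) lem lek hm hk => im ik lem lek hm hk.
  have -> : sqN ((fg m).1 + (fg k).1) = 4 - sqN ((fg m).1 - (fg k).1).
    by apply/eqP; rewrite eq_sym subr_eq parf; apply/eqP; ring.
  rewrite mulrBr => hS; exact: (parallelogram_arith par hS lem lek hm hk hfc).
have [f Lf limf] := complete_inner Lfk cauf.
have [b Lb limb] := complete_inner Lsk caus.
pose g := b + s%:C *: f.
have Lsf : L2 (s%:C *: f) by exact: (siZ HS).
have Lg : L2 g by exact: (siD HS).
have Afg : A (f, g).
  case: (A_sa) => _ _ AE; rewrite -AE.
  apply: (@adjoint_closed _ _ A (fun k => (fg k).1) (fun k => (fg k).2)) => //.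
  - by move=> k; rewrite AE; have [+ _] := Dk k; case: (fg k).
  - have -> : (fun k => (fg k).2) = (fun k => shift (fg k) + s%:C *: (fg k).1).
      by apply/funext => k; rewrite subrK.
    apply: (lim_toD HS) => //; first by move=> k; exact: (siZ HS).
    exact: (lim_toZ HS).
have pf : perp_family n p f.
  move=> i ni; have Li := eigenfamily_L2 ep ni.
  rewrite -[RHS](ip0r HS Lf); apply: (lim_ip_eq HS Lfk Lfk) => //; first exact: (si0 HS).
  by move=> k; rewrite (ip0r HS)//; have [_ ->] := Dk k.
have fn : sqN f = 1.
  have h := lim_to_sqn HS Lfk Lf limf.
  have E : (fun k => sqN (fg k).1) = fun=> 1 by apply/funext => k.
  rewrite E in h.
  by apply: (cvg_unique (@Rhausdorff R) h); exact: cvg_cst.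
have bE : shift (f, g) = b by rewrite /shift /g /= addrK.
have Df : D (f, g) by split.
have bn : sqN b = c.
  apply/eqP; rewrite eq_le; apply/andP; split; last first.
    by have := cP _ Df; rewrite bE /= fn mulr1.
  have h := lim_to_sqn HS Lsk Lb limb.
  have hc : (fun k : nat => c + k.+1%:R^-1 : R) @ \oo --> c.
    rewrite -[X in _ --> X]addr0; apply: cvgD; first exact: cvg_cst.
    exact: (@cvg_harmonic R).
  by apply: (ler_cvg_to h hc); apply: nearW => k; exact: le.
(* the form |(A - s) v|^2 - c |v|^2 on pairs (v, A v) *)
pose ipQ (x y : gfun G * gfun G) : R[i] :=
  inner (shift x) (shift y) - c%:C * inner x.1 y.1.
have SQ : semi_inner D ipQ.
  split=> //.
  - move=> a x y z Dx Dy Dz; rewrite /ipQ shift_lin.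
    have [Lx1 _ Lx] := D_L2 Dx; have [Ly1 _ Ly] := D_L2 Dy; have [Lz1 _ Lz] := D_L2 Dz.
    rewrite (si_linl HS)// [(_ + _).1]/= (si_linl HS)//; ring.
  - move=> x y Dx Dy; rewrite /ipQ.
    have [Lx1 _ Lx] := D_L2 Dx; have [Ly1 _ Ly] := D_L2 Dy.
    rewrite cjD cjN cjM cj_real.
    by rewrite -(ip_conj HS Lx Ly) -(ip_conj HS Lx1 Ly1).
  - move=> x Dx; rewrite /ipQ cReB cReM Im_real mul0r subr0 Re_real subr_ge0.
    exact: cP.
have Qn : sqn ipQ (f, g) = 0.
  rewrite /sqn /ipQ cReB cReM Im_real mul0r subr0 Re_real bE.
  by rewrite -/(sqn _ b) -/(sqn _ f) bn fn mulr1 subrr.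
have ortho v w : D (v, w) -> inner b (w - s%:C *: v) = c%:C * inner f v.
  move=> Dv; have := ip_null_l SQ Df Dv Qn; rewrite /ipQ bE => /eqP.
  by rewrite subr_eq0 => /eqP.
have bp : perp_family n p b.
  move=> i ni; have Li := eigenfamily_L2 ep ni.
  rewrite -bE /shift (ipBl HS)// (ipZl HS)// pf// mulr0 subr0.
  by rewrite (sa_symmetric Afg (ep.1 i ni)) (ipZr HS)// pf// mulr0.
(* b = (A - s) f lies in the domain, since A is its own adjoint *)
have Ab : A (b, c%:C *: f + s%:C *: b).
  case: (A_sa) => _ _ AE; rewrite -AE; split=> //=.
    by apply: (siD HS); exact: (siZ HS).
  move=> v w Avw; have [Lv Lw] := AL Avw.
  have [v' [w' [Dv' vE wE]]] := reduce Avw.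
  have [Lv' Lw' _] := D_L2 Dv'.
  have Lsv : L2 (s%:C *: v) by exact: (siZ HS).
  have Lsv' : L2 (s%:C *: v') by exact: (siZ HS).
  have sumL (F : 'I_n -> R[i]) : L2 (\sum_(i < n) F i *: (p i).1).
    by apply: (si_sum HS) => i _; apply: (siZ HS); exact: (eigenfamily_L2 ep).
  have sum0 (F : 'I_n -> R[i]) h : L2 h -> perp_family n p h ->
      inner h (\sum_(i < n) F i *: (p i).1) = 0.
    move=> Lh ph; rewrite (ip_sumr HS)//; last first.
      by move=> i _; apply: (siZ HS); exact: (eigenfamily_L2 ep).
    rewrite big1// => i _; rewrite (ipZr HS)//; last exact: (eigenfamily_L2 ep).
    by rewrite ph// mulr0.
  have e1 : inner f v = inner f v'.
    by rewrite {1}vE (ipDr HS)// sum0// addr0.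
  have e2 : inner b (w - s%:C *: v) = inner b (w' - s%:C *: v').
    have bv : inner b v = inner b v' by rewrite {1}vE (ipDr HS)// sum0// addr0.
    have bw : inner b w = inner b w'.
      rewrite {1}wE (_ : \sum_(i < n) _ *: (_ *: _) =
         \sum_(i < n) (inner v (p i).1 * (p i).2%:C) *: (p i).1); last first.
        by apply: eq_bigr => i _; rewrite scalerA.
      by rewrite (ipDr HS)// sum0// addr0.
    by rewrite !(ipBr HS)// !(ipZr HS)// bv bw.
  have := ortho _ _ Dv'; rewrite -e1 -e2 => E.
  have E' : inner (w - s%:C *: v) b = c%:C * inner v f.
    have Lws : L2 (w - s%:C *: v) by exact: (siB HS).
    by rewrite (ip_conj HS Lb Lws) E cjM cj_real -(ip_conj HS Lf Lv).
  rewrite (ipBl HS)// (ipZl HS)// in E'.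
  rewrite (ipDr HS) ?(ipZr HS) ?cj_real//; [|exact: (siZ HS)..].
  by rewrite -E' subrK.
pose r := Num.sqrt c.
have r2 : r ^+ 2 = c by rewrite sqr_sqrtr.
pose h := b + r%:C *: f.
have Lrf : L2 (r%:C *: f) by exact: (siZ HS).
have Lh : L2 h by exact: (siD HS).
have Ah : A (h, (s + r)%:C *: h).
  have := AD Ab (AZ r%:C Afg); rewrite -/h.
  suff -> : c%:C *: f + s%:C *: b + r%:C *: g = (s + r)%:C *: h by [].
  apply/funext => e; apply/funext => x; rewrite -r2.
  rewrite -[LHS]/((r ^+ 2)%:C * f e x + s%:C * b e x + r%:C * (b e x + s%:C * f e x)).
  rewrite -[RHS]/((s + r)%:C * (b e x + r%:C * f e x)).
  by rewrite rmorphXn rmorphD /=; ring.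
have ph : perp_family n p h.
  have := perp_family_lin r%:C ep Lf Lb pf bp.
  by rewrite addrC.
have [h0|h0] := eqVneq (sqN h) 0; last first.
  have [t t0 th] := normalize Ah h0.
  exists (t%:C *: h), (s + r); split=> //.
  - by have := AZ t%:C Ah; rewrite !scalerA mulrC.
  - have := perp_family_lin t%:C ep Lh (si0 HS) ph (D0.2).
    by rewrite addr0.
  - move=> v w Avw pv; rewrite addrC addKr r2.
    exact: (cP (v, w)).
exists f, (s - r); split=> //.
  apply: (Aext Afg Lf) => //; [exact: (siZ HS)|exact: eqae_refl|].
  apply/(eqaeP Lg); first exact: (siZ HS).
  have -> : g - (s - r)%:C *: f = h.
    apply/funext => e; apply/funext => x.
    rewrite -[LHS]/(b e x + s%:C * f e x - (s - r)%:C * f e x).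
    rewrite -[RHS]/(b e x + r%:C * f e x).
    by rewrite rmorphB /=; ring.
  exact: h0.
move=> v w Avw pv; rewrite addrC addKr sqrrN r2.
exact: (cP (v, w)).
Qed.

End Minimizer.
End Spectral.

(** * Dimensions and eigenvalue lists *)

Lemma card_II_seq (X : set nat) k : (X #= `I_k)%card ->
  exists s : seq nat, [/\ uniq s, size s = k & forall x, X x <-> x \in s].
Proof.
rewrite card_eq_sym => /card_set_bijP[f0 [fX finj fsurj]].
pose f (i : nat) : nat := f0 i.
exists [seq f i | i <- iota 0 k]; split.
- rewrite map_inj_in_uniq ?iota_uniq// => i j; rewrite !mem_iota /= !add0n => ik jk.
  by apply: finj; rewrite inE.
- by rewrite size_map size_iota.
- move=> x; split=> [Xx|].
    have [i ik <-] := fsurj _ Xx; apply/mapP; exists i => //.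
    by rewrite mem_iota.
  by move=> /mapP[j]; rewrite mem_iota /= add0n => jk ->; exact: fX.
Qed.

Lemma seq_card_II (X : set nat) (s : seq nat) : uniq s ->
  (forall x, X x <-> x \in s) -> (X #= `I_(size s))%card.
Proof.
move=> us Xs; rewrite card_eq_sym; apply/card_set_bijP.
exists (nth 0%N s); split.
- by move=> i /= ik; apply/Xs; exact: mem_nth.
- move=> i j; rewrite !inE /= => ik jk /eqP.
  by rewrite nth_uniq// => /eqP.
- move=> x /Xs xs; exists (index x s); last exact: nth_index.
  by rewrite /= index_mem.
Qed.

Section Dimension.
Variables (R : realType) (G : metric_graph R).
Implicit Types (W : set (gfun G)) (f g : gfun G).
Let HS := @semi_inner_inner R G.

(** More vectors than the dimension are dependent, by [underdetermined] applied
    to their coefficients. *)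
Lemma dim_le W n m (v : 'I_m -> gfun G) : has_dim W n -> (forall i, W (v i)) ->
  (forall c : 'I_m -> R[i], eqae (\sum_i c i *: v i) 0 -> forall i, c i = 0) ->
  (m <= n)%N.
Proof.
move=> [b [_ _ span]] Wv free; rewrite leqNgt; apply/negP => nm.
have [M MP] := choice (fun i => span _ (Wv i)).
have [c [j cj] cM] := underdetermined (fun i j => M j i) nm.
move: cj; rewrite free ?eqxx//.
apply: eqae_trans (eqae_sum (fun i => eqaeZ (c i) (MP i))) _.
rewrite (_ : \sum_i _ = 0); first exact: eqae_refl.
under eq_bigr do rewrite scaler_sumr.
rewrite exchange_big big1//= => k _.
under eq_bigr do rewrite scalerA mulrC.
by rewrite -scaler_suml cM scale0r.
Qed.

Lemma has_dim_unique W n m : has_dim W n -> has_dim W m -> n = m.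
Proof.
move=> dn dm; apply/eqP; rewrite eqn_leq; apply/andP; split.
- by have [b [Wb free _]] := dn; exact: dim_le dm Wb free.
- by have [b [Wb free _]] := dm; exact: dim_le dn Wb free.
Qed.

Lemma dimensionE W n : has_dim W n -> dimension W = n.
Proof.
move=> dn; apply: (@has_dim_unique W) => //.
exact: (@xgetI _ 0%N [set k | has_dim W k] n dn).
Qed.

Lemma orthonormal_free n (e : 'I_n -> gfun G) (c : 'I_n -> R[i]) :
  orthonormal (@L2 R G) (@inner R G) e -> eqae (\sum_i c i *: e i) 0 -> forall i, c i = 0.
Proof.
move=> oe; have [Le _] := oe => h i.
rewrite -(orthonormal_comb HS c i oe).
have LS : L2 (\sum_i c i *: e i) by apply: (si_sum HS) => k _; exact: (siZ HS).
by rewrite (inner_eqae_l LS (si0 HS) (Le i) h) (ip0l HS).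
Qed.

Lemma eigenspaceP (A : operator G) mu f : linear_operator A ->
  Defs.eigenspace A mu f <-> A (f, mu%:C *: f).
Proof.
move=> [AL Aext _ _ _]; split=> [[g Afg gE]|Af]; last by exists (mu%:C *: f) => //; exact: eqae_refl.
have [Lf Lg] := AL _ _ Afg.
by apply: (Aext _ _ _ _ Afg Lf) => //; [exact: (siZ HS)|exact: eqae_refl].
Qed.

Lemma eigenspace0 (A : operator G) : linear_operator A -> Defs.eigenspace A 0 = ker A.
Proof.
move=> _; apply/seteqP; split=> f [g Afg g0]; exists g => //; move: g0;
  by rewrite rmorph0 scale0r.
Qed.

End Dimension.

Section Lists.
Variables (R : realType) (G : metric_graph R) (A : operator G).
Implicit Types (a b : nat -> R) (P : set R).
Let HS := @semi_inner_inner R G.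

Lemma list_multiplicity P a b mu : eigenvalue_list P A a -> eigenvalue_list P A b -> P mu ->
  exists s t : seq nat, [/\ uniq s, uniq t, size s = size t,
    forall j, a j = mu <-> j \in s & forall j, b j = mu <-> j \in t].
Proof.
move=> [_ _ ha] [_ _ hb] Pmu.
have [n dn /card_II_seq[s [us ss sP]]] := ha mu Pmu.
have [m dm /card_II_seq[t [ut st tP]]] := hb mu Pmu.
by exists s, t; split=> //; rewrite ss st; exact: has_dim_unique dn dm.
Qed.

(* The value a n occurs as often in b as in a, but in b only among the first n
   entries, where a and b agree. *)
Let no_lt P a b n : eigenvalue_list P A a -> eigenvalue_list P A b ->
  (forall i, (i < n)%N -> a i = b i) -> ~ a n < b n.
Proof.
move=> la lb ab lt; have [_ Pa _] := la; have [ndb _ _] := lb.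
have [s [t [us ut st sP tP]]] := list_multiplicity la lb (Pa n).
have tn j : j \in t -> (j < n)%N.
  move=> /tP bj; rewrite ltnNge; apply/negP => nj.
  by have := ndb _ _ nj; rewrite bj leNgt lt.
have : (size (n :: t) <= size s)%N.
  apply: uniq_leq_size => [|j].
    by rewrite /= ut andbT; apply/negP => /tn; rewrite ltnn.
  rewrite in_cons => /predU1P[->|jt]; apply/sP => //.
  by rewrite (ab _ (tn _ jt)); apply/tP.
by rewrite /= st ltnn.
Qed.

Lemma eigenvalue_list_unique P a b : eigenvalue_list P A a -> eigenvalue_list P A b -> a = b.
Proof.
move=> la lb; apply/funext => n.
elim/ltn_ind: n => n IH; apply/eqP; rewrite eq_le; apply/andP; split; rewrite leNgt; apply/negP.
- by apply: (no_lt lb la) => i /IH.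
- exact: (no_lt la lb).
Qed.

Lemma lambdaE a j : eigenvalue_list setT A a -> lambda j A = a j.-1.
Proof.
move=> la; rewrite /lambda; congr (_ _); apply: (@eigenvalue_list_unique setT) => //.
exact: (@xgetI _ 0 [set l | eigenvalue_list setT A l] a la).
Qed.

Lemma lambda_posE a j : eigenvalue_list [set x | 0 < x] A a -> lambda_pos j A = a j.-1.
Proof.
move=> la; rewrite /lambda_pos; congr (_ _).
apply: (@eigenvalue_list_unique [set x | 0 < x]) => //.
exact: (@xgetI _ 0 [set l | eigenvalue_list [set x | 0 < x] A l] a la).
Qed.

(** If a N > mu, then every eigenvalue up to mu occurs among the first N entries
    of the list, with its full multiplicity; so the N + 1 eigenvalues of the
    family, counted with multiplicities, would form a subfamily of these. *)
Lemma list_le a N (p : nat -> gfun G * R) mu : linear_operator A ->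
  eigenvalue_list setT A a -> eigenfamily A N.+1 p ->
  (forall i, (i < N.+1)%N -> (p i).2 <= mu) -> a N <= mu.
Proof.
move=> linA [nda _ ha] ep pmu; rewrite leNgt; apply/negP => lt.
pose s := [seq (p i).2 | i <- iota 0 N.+1]; pose t := [seq a j | j <- iota 0 N].
have : exists2 r, subseq r t & perm_eq s r.
  apply/count_subseqP => nu.
  have [nus|nus] := boolP (nu \in s); last by rewrite (count_memPn nus).
  have nu_mu : nu <= mu.
    by have /mapP[j] := nus; rewrite mem_iota add0n => jN ->; exact: pmu.
  have [n dn /card_II_seq[r [ur rn rP]]] := ha nu I.
  apply: (@leq_trans n).
    pose J := [seq i <- iota 0 N.+1 | (p i).2 == nu].
    have -> : count_mem nu s = size J by rewrite count_map size_filter.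
    have JP (i : 'I_(size J)) : (nth 0%N J i < N.+1)%N /\ (p (nth 0%N J i)).2 = nu.
      have := mem_nth 0%N (ltn_ord i); rewrite mem_filter mem_iota add0n.
      by move=> /andP[/eqP -> /andP[_ ->]].
    have oJ : orthonormal (@L2 R G) (@inner R G) (fun i : 'I_(size J) => (p (nth 0%N J i)).1).
      split=> [i|i j]; first by have [AL _ _ _ _] := linA; have [] := AL _ _ (ep.1 _ (JP i).1).
      rewrite (ep.2 _ _ (JP i).1 (JP j).1) nth_uniq//.
      by rewrite filter_uniq ?iota_uniq.
    apply: (dim_le dn (v := fun i => (p (nth 0%N J i)).1)); last first.
      by move=> c; exact: orthonormal_free.
    move=> i; apply/(eigenspaceP _ _ linA).
    by have := ep.1 _ (JP i).1; rewrite (JP i).2.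
  rewrite -rn count_map -size_filter; apply: uniq_leq_size => // j /rP aj.
  rewrite mem_filter /= aj eqxx mem_iota add0n /= ltnNge; apply/negP => Nj.
  by have := nda _ _ Nj; rewrite aj leNgt (le_lt_trans nu_mu lt).
move=> [r /size_subseq rt /perm_size sr].
by move: rt; rewrite -sr !size_map !size_iota ltnn.
Qed.

End Lists.

(** * Existence of the list of all eigenvalues *)

Section EigenList.
Variables (R : realType) (G : metric_graph R) (A : operator G).
Implicit Types (f g h u v w : gfun G) (p : nat -> gfun G * R).
Let HS := @semi_inner_inner R G.
Local Notation sqN := (sqn (@inner R G)).
Hypothesis A_sa : self_adjoint A.

Definition family_rcons n p (x : gfun G * R) : nat -> gfun G * R :=
  fun i => if i == n then x else p i.

Lemma eigenfamily_eq n p p' : (forall i, (i < n)%N -> p i = p' i) ->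
  eigenfamily A n p -> eigenfamily A n p'.
Proof.
move=> pp [h1 h2]; split=> [i ni|i j ni nj]; first by rewrite -(pp _ ni); exact: h1.
by rewrite -(pp _ ni) -(pp _ nj); exact: h2.
Qed.

Lemma eigenfamily_rcons n p f (lam : R) : eigenfamily A n p -> A (f, lam%:C *: f) ->
  sqN f = 1 -> perp_family n p f -> eigenfamily A n.+1 (family_rcons n p (f, lam)).
Proof.
move=> ep Af f1 pf; have [h1 h2] := ep.
have Lf : L2 f by case: (A_sa) => -[AL _ _ _ _] _ _; have [] := AL _ _ Af.
have ff : inner f f = 1 by rewrite (ip_sqn HS)// f1.
split=> [i|i j]; rewrite /family_rcons !ltnS.
  by case: eqVneq => [_ _ //|ne le]; apply: h1; rewrite ltn_neqAle ne.
have [->|ni] := eqVneq i n; have [->|nj] := eqVneq j n => le lej /=.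
- by rewrite ff.
- by rewrite pf// ltn_neqAle nj lej.
- have lti : (i < n)%N by rewrite ltn_neqAle ni.
  have Li := eigenfamily_L2 A_sa ep lti.
  by rewrite (negPf ni) (ip_conj HS Lf Li) pf// conjc0.
- by apply: h2; rewrite ltn_neqAle ?ni ?nj.
Qed.

Hypothesis A_compact : compact_domain A.

(** Otherwise compactness would give a Cauchy subsequence of the orthonormal
    sequence, whose members have distance sqrt 2. *)
Lemma eigenvalues_unbounded p r : (forall n, eigenfamily A n p) ->
  ~ (forall n, `|(p n).2| <= r).
Proof.
move=> ep pr.
have Ap n : A ((p n).1, (p n).2%:C *: (p n).1) by have [h _] := ep n.+1; exact: h.
have Lp n : L2 (p n).1 by exact: (eigenfamily_L2 A_sa (ep n.+1)).
have p1 n : sqN (p n).1 = 1 by have [_ h] := ep n.+1; rewrite /sqn h// eqxx.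
have [|n|n|phi [phin cau]] := A_compact (f_ := fun n => (p n).1)
    (g_ := fun n => (p n).2%:C *: (p n).1) (C := 1 + r ^+ 2).
- by [].
- by rewrite p1 lerDl sqr_ge0.
- rewrite (sqnZ HS)// sqmod_real p1 mulr1.
  have h := pr n; have : (p n).2 ^+ 2 <= r ^+ 2.
    rewrite -[leLHS]real_normK ?num_real//; have := normr_ge0 (p n).2; nra.
  lra.
have [N NP] := cau 1 ltr01.
have ne : (phi (phi N).+1 == phi N) = false.
  by apply/negbTE; rewrite gtn_eqF//; exact: leq_trans (phin _).
have := NP (phi N).+1 N (leq_trans (phin N) (leqnSn _)) (leqnn N).
rewrite (sqnB HS)// !p1.
pose m := (maxn (phi (phi N).+1) (phi N)).+1.
have [_ h] := ep m; rewrite h ?ltnS ?leq_maxl ?leq_maxr// ne Re0; lra.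
Qed.

Hypothesis A_ge0 : forall f g, A (f, g) -> 0 <= ReC (inner g f).
Hypothesis A_infinite : forall n p, eigenfamily A n p ->
  exists v w, [/\ A (v, w), perp_family n p v & sqN v != 0].

(** Apply [minimal_eigenfunction] with s = 0 repeatedly.  Since A is nonnegative,
    minimality of |A f| is minimality of the eigenvalue, whence the monotonicity. *)
Lemma exists_eigensequence : exists p, [/\ forall n, eigenfamily A n p,
  forall n, 0 <= (p n).2, nondecreasing_seq (fun n => (p n).2) &
  forall n v w, A (v, w) -> perp_family n p v -> (p n).2 ^+ 2 * sqN v <= sqN w].
Proof.
have ex (np : nat * (nat -> gfun G * R)) : exists x : gfun G * R,
    eigenfamily A np.1 np.2 -> [/\ A (x.1, x.2%:C *: x.1), sqN x.1 = 1,
     perp_family np.1 np.2 x.1 &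
     forall v w, A (v, w) -> perp_family np.1 np.2 v -> x.2 ^+ 2 * sqN v <= sqN w].
  case: np => n p /=; have [ep|] := pselect (eigenfamily A n p); last by exists (0, 0).
  have [v0 [w0 [Av0 pv0 n0]]] := A_infinite ep.
  have [f [lam [Af f1 pf fmin]]] := minimal_eigenfunction A_sa A_compact 0 ep Av0 pv0 n0.
  exists (f, lam) => _; split=> // v w Avw pv.
  by have := fmin _ _ Avw pv; rewrite subr0 rmorph0 scale0r subr0.
have [nxt nxtP] := choice ex.
pose E := fix E (n : nat) : nat -> gfun G * R :=
  if n is m.+1 then family_rcons m (E m) (nxt (m, E m)) else fun=> (0, 0).
pose e n := nxt (n, E n).
have Ee n i : (i < n)%N -> E n i = e i.
  elim: n => // n IH; rewrite ltnS leq_eqVlt /= /family_rcons => /predU1P[->|lt].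
    by rewrite eqxx.
  by rewrite ltn_eqF// IH.
have EE n : eigenfamily A n (E n).
  elim: n => [|n IH]; first by split.
  have [A1 f1 pf _] := nxtP (n, E n) IH.
  rewrite /=; case: (nxt (n, E n)) A1 f1 pf => f lam; exact: eigenfamily_rcons.
have perpE n v : perp_family n e v <-> perp_family n (E n) v.
  by split=> h i ni; have := h i ni; rewrite Ee.
have ge0 n : 0 <= (e n).2.
  have [A1 f1 _ _] := nxtP (n, E n) (EE n); rewrite /= in A1 f1.
  have Le : L2 (e n).1 by case: (A_sa) => -[AL _ _ _ _] _ _; have [] := AL _ _ A1.
  by have := A_ge0 A1; rewrite (ipZl HS)// (ip_sqn HS)// f1 mulr1.
have emin n v w : A (v, w) -> perp_family n e v -> (e n).2 ^+ 2 * sqN v <= sqN w.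
  move=> Avw /perpE pv; have [_ _ _ h] := nxtP (n, E n) (EE n).
  exact: h.
have Ae n : eigenfamily A n e by apply: eigenfamily_eq (EE n) => i; exact: Ee.
exists e; split=> //.
apply/nondecreasing_seqP => n.
have [A1 f1 pf _] := nxtP (n.+1, E n.+1) (EE n.+1).
have := emin n _ _ A1 _; rewrite f1 mulr1 => h.
have Le : L2 (e n.+1).1 by exact: (eigenfamily_L2 A_sa (Ae n.+2)).
have : (e n).2 ^+ 2 <= (e n.+1).2 ^+ 2.
  have := h _; rewrite (sqnZ HS)// f1 mulr1 sqmod_real; apply.
  by move=> i ni; rewrite -(Ee n.+1 i (ltnW ni)); apply: pf; rewrite /= ltnW.
by rewrite ler_sqr ?nnegrE//.
Qed.

Section Sequence.
Variable p : nat -> gfun G * R.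
Hypothesis p_family : forall n, eigenfamily A n p.
Hypothesis p_ge0 : forall n, 0 <= (p n).2.
Hypothesis p_mono : nondecreasing_seq (fun n => (p n).2).
Hypothesis p_min : forall n v w, A (v, w) -> perp_family n p v ->
  (p n).2 ^+ 2 * sqN v <= sqN w.

Let linA : linear_operator A. Proof. by case: A_sa. Qed.
Let Ap n : A ((p n).1, (p n).2%:C *: (p n).1).
Proof. by have [h _] := p_family n.+1; exact: h. Qed.
Let Lp n : L2 (p n).1. Proof. exact: (eigenfamily_L2 A_sa (p_family n.+1)). Qed.
Let ipp i j : inner (p i).1 (p j).1 = (i == j)%:R.
Proof.
have [_ h] := p_family (maxn i j).+1.
by apply: h; rewrite ltnS ?leq_maxl ?leq_maxr.
Qed.

Lemma eigenvalues_exceed mu : exists N, mu < (p N).2.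
Proof.
apply: contrapT => h; apply: (eigenvalues_unbounded p_family (r := mu)) => n.
by rewrite ger0_norm// leNgt; apply/negP => lt; apply: h; exists n.
Qed.

Let eigen_orth f mu i : A (f, mu%:C *: f) -> (p i).2 != mu -> inner f (p i).1 = 0.
Proof.
move=> Af ne; have [AL _ _ _ _] := linA; have [Lf _] := AL _ _ Af.
have := sa_symmetric A_sa Af (Ap i).
rewrite (ipZl HS)// (ipZr HS)// cj_real => /eqP.
rewrite -subr_eq0 -mulrBl mulf_eq0 => /orP[|/eqP//].
by rewrite subr_eq0 (inj_eq (@complexI R)) eq_sym (negPf ne).
Qed.

(** An eigenfunction for mu is orthogonal to the members of the sequence with
    other eigenvalues; its part orthogonal to those with eigenvalue mu would
    contradict minimality of the first member with an eigenvalue exceeding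
    |mu|. *)
Lemma sequence_list : eigenvalue_list setT A (fun n => (p n).2).
Proof.
split=> // mu _; have [N NP] := eigenvalues_exceed `|mu|.
pose J := [seq i <- iota 0 N | (p i).2 == mu].
have JP j : (p j).2 = mu <-> j \in J.
  split=> [pj|]; last by rewrite mem_filter => /andP[/eqP].
  rewrite mem_filter pj eqxx mem_iota add0n /= ltnNge; apply/negP => Nj.
  by have := p_mono Nj; rewrite pj leNgt (le_lt_trans (ler_norm _) NP).
have uJ : uniq J by rewrite filter_uniq ?iota_uniq.
exists (size J); last exact: seq_card_II.
pose b (i : 'I_(size J)) := (p (nth 0%N J i)).1.
have bval (i : 'I_(size J)) : (p (nth 0%N J i)).2 = mu by apply/JP; exact: mem_nth.
have ob : orthonormal (@L2 R G) (@inner R G) b.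
  by split=> [i|i j]; [exact: Lp|rewrite /b ipp nth_uniq].
exists b; split.
- move=> i; apply/(eigenspaceP _ _ linA).
  by have := Ap (nth 0%N J i); rewrite bval.
- by move=> c; exact: orthonormal_free.
move=> f /(eigenspaceP _ _ linA) Af; have [AL Aext A0 Alin _] := linA.
have [Lf _] := AL _ _ Af.
have oN := eigenfamily_orthonormal A_sa (p_family N).
pose S := \sum_(i < N) inner f (p i).1 *: (p i).1.
have LS : L2 S by apply: (si_sum HS) => i _; exact: (siZ HS).
have SE : S = \sum_(i < size J) inner f (b i) *: b i.
  rewrite /S -(big_mkord xpredT (fun i => inner f (p i).1 *: (p i).1)).
  rewrite /index_iota subn0 (bigID (fun i => (p i).2 == mu))/= [X in _ + X]big1 ?addr0.
    rewrite -big_filter -/J (big_nth 0%N) big_mkord; exact: eq_bigr.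
  by move=> i ne; rewrite (eigen_orth Af ne) scale0r.
have AS : A (S, mu%:C *: S).
  rewrite SE scaler_sumr.
  have Asum (n : nat) (F F' : 'I_n -> gfun G) : (forall i, A (F i, F' i)) ->
      A (\sum_i F i, \sum_i F' i).
    elim: n F F' => [|n IH] F F' h; first by rewrite !big_ord0.
    rewrite !big_ord_recr/=.
    have := Alin 1 _ _ _ _ (IH _ _ (fun i => h (widen_ord (leqnSn n) i))) (h ord_max).
    by rewrite !scale1r.
  apply: Asum => i; have := Alin (inner f (b i)) _ _ _ _ (Ap (nth 0%N J i)) A0.
  by rewrite !addr0 bval !scalerA mulrC.
have Lfs : L2 (f - S) by exact: (siB HS).
have Afs : A (f - S, mu%:C *: (f - S)).
  have := Alin (-1) _ _ _ _ AS Af.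
  rewrite [mu%:C *: (f - S)]scalerBr !scaleN1r [- S + f]addrC.
  by rewrite [- (mu%:C *: S) + _]addrC.
have pfs : perp_family N p (f - S).
  by move=> i iN; have := orthonormal_residual HS (Ordinal iN) oN Lf.
exists (fun i => inner f (b i)).
rewrite -SE; apply/(eqaeP Lf LS).
have := p_min Afs pfs; rewrite (sqnZ HS)// sqmod_real => h.
apply/eqP; rewrite eq_le (sqn_ge0 HS)// andbT leNgt; apply/negP => s0.
rewrite ler_pM2r// in h.
have : mu ^+ 2 < (p N).2 ^+ 2.
  rewrite -(real_normK (num_real mu)) ltr_sqr ?nnegrE//.
by rewrite ltNge h.
Qed.

End Sequence.
End EigenList.


(** * Compactness of the domains *)

Section Compact.
Variables (R : realType) (G : metric_graph R) (q : edge G -> R -> R) (M : R).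
Local Notation mu := (@lebesgue_measure R).
Hypothesis q_meas : forall e, measurable_fun (`]0, len e[%classic : set R) (q e).
Hypothesis q_bound : forall e x, (`]0, len e[%classic : set R) x -> `|q e x| <= M.
Implicit Types (f g h u v F H : gfun G).
Let HS := @semi_inner_inner R G.
Local Notation sqN := (sqn (@inner R G)).

Lemma sqn_qmul f : L2 f -> sqN (qmul q f) <= M ^+ 2 * sqN f.
Proof.
move=> Lf; have Lqf := L2_qmul q_meas q_bound Lf.
rewrite !sqn_inner mulr_sumr; apply: ler_sum => e _.
rewrite -sqmod_real -(sqnZ (semi_inner_ipI _) _ (Lf e)); apply: sqn_le.
- exact: Lqf e.
- by apply: (siZ (semi_inner_ipI _)); exact: Lf.
move=> x Ix; rewrite -[(M%:C *: f e) x]/(M%:C * f e x) /qmul.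
rewrite !sqmodM !sqmod_real ler_wpM2r ?sqmod_ge0//.
rewrite -[leLHS]real_normK ?num_real// ler_sqr ?nnegrE//; first exact: q_bound.
exact: le_trans (normr_ge0 _) (q_bound Ix).
Qed.

(** The second derivative F2 = q F - g is controlled by the function and its
    image. *)
Lemma bcop_compact (B : boundary_condition G) : compact_domain (bcop q B).
Proof.
move=> f_ g_ C Afg fC gC.
have ex n : exists T : gfun G * gfun G * gfun G,
    [/\ h2rep T.1.1 T.1.2 T.2, eqae (f_ n) T.1.1 & eqae (g_ n) (qmul q T.1.1 - T.2)].
  have /bcop_rep[_ _ [F [F1 [F2 [? ? ? _]]]]] := Afg n.
  by exists (F, F1, F2).
have [T TP] := choice ex.
have Lf n : L2 (f_ n) by have [] := Afg n.
have Lg n : L2 (g_ n) by have [] := Afg n.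
have LT n : [/\ L2 (T n).1.1, L2 (T n).1.2 & L2 (T n).2].
  by apply: h2rep_L2; have [] := TP n.
have TC n : sqN (T n).1.1 <= C.
  have [L1 _ _] := LT n; have [_ fF _] := TP n.
  by rewrite -(sqn_eqae (Lf n) L1 fF).
have C0 : 0 <= C := le_trans (sqn_ge0 HS (Lf 0%N)) (fC 0%N).
have T2C n : sqN (T n).2 <= 2 * (M ^+ 2 * C) + 2 * C.
  have [L1 _ L2'] := LT n; have [_ fF gE] := TP n.
  have Lq := L2_qmul q_meas q_bound L1.
  have Lqf := siB HS Lq L2'.
  have -> : (T n).2 = qmul q (T n).1.1 - (qmul q (T n).1.1 - (T n).2).
    by rewrite subKr.
  apply: (le_trans (sqnD_le HS Lq (siN HS Lqf))).
  rewrite (sqnN HS Lqf) -(sqn_eqae (Lg n) Lqf gE).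
  have := sqn_qmul L1; have := TC n; have := gC n; have := sqr_ge0 M.
  move: (M ^+ 2) (sqN (g_ n)) (sqN (T n).1.1) (sqN (qmul q _)) => a b c d.
  by nra.
have C' : C <= C + (2 * (M ^+ 2 * C) + 2 * C).
  by rewrite lerDl addr_ge0// mulr_ge0// mulr_ge0// sqr_ge0.
have C'' : 2 * (M ^+ 2 * C) + 2 * C <= C + (2 * (M ^+ 2 * C) + 2 * C) by rewrite lerDr.
have rT n : h2rep (T n).1.1 (T n).1.2 (T n).2 by have [] := TP n.
have [phi [phin cau]] := rep_compact rT
  (fun n => le_trans (TC n) C')
  (fun n => le_trans (T2C n) C'').
exists phi; split=> // eps e0; have [N NP] := cau eps e0.
exists N => m n Nm Nn; have [_ fm _] := TP (phi m); have [_ fn _] := TP (phi n).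
have [Lm _ _] := LT (phi m); have [Ln _ _] := LT (phi n).
rewrite (sqn_eqae _ _ (eqaeB fm fn)); [exact: NP|exact: (siB HS)|exact: (siB HS)].
Qed.

End Compact.

(** * Linear combinations in the domain of an operator *)

Section Combination.
Variables (R : realType) (G : metric_graph R) (A : operator G).
Implicit Types (f g h u v w : gfun G).
Let HS := @semi_inner_inner R G.
Local Notation sqN := (sqn (@inner R G)).
Hypothesis A_linear : linear_operator A.

Definition free_family n (u : 'I_n -> gfun G) : Prop :=
  forall c : 'I_n -> R[i], eqae (\sum_i c i *: u i) 0 -> forall i, c i = 0.

Lemma operator_sum (J : finType) (c : J -> R[i]) (u v : J -> gfun G) :
  (forall i, A (u i, v i)) -> A (\sum_i c i *: u i, \sum_i c i *: v i).
Proof.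
have [_ _ A0 Alin _] := A_linear => uv.
rewrite -![\sum_i _]big_enum; elim: (enum J) => [|i r IH]; first by rewrite !big_nil.
by rewrite !big_cons; exact: Alin.
Qed.

Lemma free_perp m n (u v : 'I_m -> gfun G) (p : nat -> gfun G * R) :
  (forall i, A (u i, v i)) -> free_family u -> (n < m)%N ->
  (forall i, (i < n)%N -> L2 (p i).1) ->
  exists c : 'I_m -> R[i], perp_family n p (\sum_i c i *: u i) /\
    sqN (\sum_i c i *: u i) != 0.
Proof.
move=> uv free nm Lp; have [AL _ _ _ _] := A_linear.
have Lu i : L2 (u i) by have [] := AL _ _ (uv i).
have [c [j cj] cM] := underdetermined (fun (k : 'I_n) i => inner (u i) (p k).1) nm.
have LS : L2 (\sum_i c i *: u i) by apply: (si_sum HS) => i _; exact: (siZ HS).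
exists c; split.
  move=> k kn; have Lk := Lp _ kn.
  rewrite (ip_suml HS)//; last by move=> i _; exact: (siZ HS).
  under eq_bigr => i _ do rewrite (ipZl HS (c i) (Lu i) Lk).
  by under eq_bigr do rewrite mulrC; exact: (cM (Ordinal kn)).
apply/negP => /eqP /(eqae0P LS) S0.
by move: cj; rewrite (free _ S0) eqxx.
Qed.

End Combination.


(** * Polynomials in the domain of the minimal operator *)

Section Polynomials.
Variables (R : realType) (l : R).
Hypothesis l0 : 0 < l.
Implicit Types (p : {poly R[i]}).

Definition poly_fun p : R -> R[i] := fun x => p.[x%:C].

Lemma cac_poly p : cac l (poly_fun p) (poly_fun p^`()%R).
Proof.
elim/poly_ind: p => [|p c IH].
  by apply: cac_eq (cac_cst l 0) => x; rewrite /poly_fun ?deriv0 horner0.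
apply: cac_eq (cacD (cacM l0 IH (cac_id l)) (cac_cst l c)) => x /=.
  by rewrite /poly_fun !hornerE.
by rewrite /poly_fun derivD derivM derivX derivC !hornerE.
Qed.

(** The polynomial vanishes at all points of [0, l], in particular at more
    points than its degree allows. *)
Lemma poly_ae_eq0 p : ae_equal l (poly_fun p) (fun=> 0) -> p = 0.
Proof.
move=> p0; apply: contraTeq isT => pn0.
pose s := [seq (l / k.+1%:R)%:C | k <- iota 0 (size p)].
have : (size s < size p)%N.
  apply: max_poly_roots => //.
    apply/allP => _ /mapP[k _ ->]; apply/rootP.
    have k0 : 0 < k.+1%:R :> R by rewrite ltr0n.
    apply: (cac_ae_eq l0 (cac_poly p) (cac_cst l 0) p0).
    rewrite divr_ge0 ?(ltW l0) ?(ltW k0)//= ler_pdivrMr// ler_peMr ?(ltW l0)//.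
    by rewrite ler1n.
  rewrite map_inj_uniq ?iota_uniq// => i j /complexI /(mulfI (lt0r_neq0 l0)).
  by move=> /invr_inj /eqP; rewrite eqr_nat => /eqP[].
by rewrite size_map size_iota ltnn.
Qed.

Let V : {poly R[i]} := 'X * ('X - (l%:C)%:P).

(** Double zeros at both ends make all boundary data vanish. *)
Definition poly_bump (k : nat) : {poly R[i]} := 'X^k * (V * V).

Lemma poly_bump0 k : [/\ poly_fun (poly_bump k) 0 = 0, poly_fun (poly_bump k) l = 0,
  poly_fun (poly_bump k)^`()%R 0 = 0 & poly_fun (poly_bump k)^`()%R l = 0].
Proof.
have V0 : V.[(0 : R)%:C] = 0 by rewrite /V hornerM hornerX mul0r.
have Vl : V.[l%:C] = 0 by rewrite /V !hornerE subrr mulr0.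
rewrite /poly_fun /poly_bump; move: (V) V0 Vl => W W0 Wl; split.
- by rewrite !hornerM W0 !mulr0.
- by rewrite !hornerM Wl !mulr0.
- by rewrite !derivM hornerD !hornerM hornerD !hornerM W0 !(mulr0, mul0r, addr0).
- by rewrite !derivM hornerD !hornerM hornerD !hornerM Wl !(mulr0, mul0r, addr0).
Qed.

Lemma poly_bump_free n (c : 'I_n -> R[i]) :
  \sum_i c i *: poly_bump i = 0 -> forall i, c i = 0.
Proof.
move=> h i.
have V0 : V * V != 0 by rewrite !mulf_neq0 ?polyX_eq0 ?polyXsubC_eq0.
have : (\sum_(i < n) c i *: 'X^i) * (V * V) = 0.
  by rewrite mulr_suml -[RHS]h; apply: eq_bigr => j _; rewrite scalerAl.
move=> /eqP; rewrite mulf_eq0 (negPf V0) orbF => /eqP /(congr1 (fun p : {poly R[i]} => p`_i)).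
rewrite coef_sum coef0 (bigD1 i)//= coefZ coefXn eqxx mulr1 big1 ?addr0// => j ji.
by rewrite coefZ coefXn (inj_eq val_inj) eq_sym (negPf ji) mulr0.
Qed.

End Polynomials.

Section InfiniteDimension.
Variables (R : realType) (G : metric_graph R) (q : edge G -> R -> R) (M : R).
Hypothesis q_meas : forall e, measurable_fun (`]0, len e[%classic : set R) (q e).
Hypothesis q_bound : forall e x, (`]0, len e[%classic : set R) x -> `|q e x| <= M.
Let HS := @semi_inner_inner R G.

Lemma minimal_infinite n : exists u v : 'I_n -> gfun G,
  (forall i, bcop q (@bc_min R G) (u i, v i)) /\ free_family u.
Proof.
have /card_gt0P[e _] := edge_nonempty G; have l0 := len_gt0 e.
pose P (i : nat) := poly_bump (len e) i.
pose u (i : 'I_n) := on_edge e (poly_fun (P i)).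
have ru (i : 'I_n) : h2rep (u i) (on_edge e (poly_fun (P i)^`()%R))
    (on_edge e (poly_fun (P i)^`()^`()%R)).
  by apply: on_edge_h2rep; exact: cac_poly.
exists u, (fun i => qmul q (u i) - on_edge e (poly_fun (P i)^`()^`()%R)); split.
  move=> i; apply: (h2rep_bcop q_meas q_bound (ru i)).
  have [a b c d] := poly_bump0 (len e) i.
  by rewrite on_edge_tr0// on_edge_dn0//; split=> // x; rewrite big1.
move=> c h; apply: (@poly_bump_free R (len e)); apply: (poly_ae_eq0 l0).
have := h e; congr (ae_equal _ _ _); apply/funext => x.
rewrite /poly_fun horner_sum fct_sumE fct_sumE; apply: eq_bigr => i _.
by rewrite hornerZ -[LHS]/(c i * u i e x) /u on_edge_same.
Qed.

End InfiniteDimension.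


(** * Kernels *)

Section Kernels.
Variables (R : realType) (G : metric_graph R) (q : edge G -> R -> R) (M : R).
Hypothesis q_meas : forall e, measurable_fun (`]0, len e[%classic : set R) (q e).
Hypothesis q_bound : forall e x, (`]0, len e[%classic : set R) x -> `|q e x| <= M.
Hypothesis q_ge0 : forall e x, (`]0, len e[%classic : set R) x -> 0 <= q e x.
Implicit Types (f g h u v F H : gfun G) (t d : endpoint G -> R[i]).
Let HS := @semi_inner_inner R G.
Local Notation sqN := (sqn (@inner R G)).
Local Notation S := (bcop q (@bc_min R G)).
Local Notation T := (bcop q (@bc_continuous R G)).
Local Notation D := (bcop q (@bc_dir R G)).
Local Notation St := (bcop q (@bc_standard R G)).
Let C := poincare_constant G.
Let C0 : 0 < C. Proof. exact: poincare_constant_gt0. Qed.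

Lemma bcop_in_L2 (B : boundary_condition G) : in_L2 (bcop q B).
Proof. by move=> f g []. Qed.

Lemma dirichlet_op_coercive : coercive D C.
Proof. exact: (dirichlet_coercive q_meas q_bound q_ge0). Qed.

Lemma minimal_op_coercive : coercive S C.
Proof.
by move=> u v uv; apply: dirichlet_op_coercive; exact: (bcop_mono (@min_sub_dir R G) uv).
Qed.

Let linD : linear_operator D.
Proof. exact: (bcop_linear q_meas q_bound (linear_dir G)). Qed.
Lemma minimal_dense : densely_defined S.
Proof.
apply: (@S_dense _ _ S); first exact: (bcop_linear q_meas q_bound (linear_min G)).
rewrite (adjoint_min q_meas q_bound).
exact: (bcop_linear q_meas q_bound (linear_continuous G)).
Qed.

Lemma self_adjoint_bcop (B : boundary_condition G) : linear_bc B ->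
  (forall t d, bc_min t d -> B t d) -> adjoint (bcop q B) = bcop q B ->
  self_adjoint (bcop q B).
Proof.
move=> linB mB adjB; split=> //; first exact: (bcop_linear q_meas q_bound).
move=> f Lf eps e0; have [u [v Suv] lt] := minimal_dense Lf e0.
by exists u => //; exists v; exact: (bcop_mono mB).
Qed.

Lemma dirichlet_self_adjoint : self_adjoint D.
Proof.
apply: self_adjoint_bcop; [exact: linear_dir|exact: min_sub_dir|].
exact: (adjoint_dir q_meas q_bound).
Qed.

Lemma standard_self_adjoint : self_adjoint St.
Proof.
apply: self_adjoint_bcop; [exact: linear_standard|exact: min_sub_standard|].
exact: (adjoint_standard q_meas q_bound).
Qed.

Lemma dirichlet_kernel u : ker D u -> eqae u 0.
Proof.
by move=> [v Duv v0]; exact: (coercive_kernel (@bcop_in_L2 _) dirichlet_op_coercive Duv).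
Qed.

Lemma dirichlet_kernel_dim : has_dim (ker D) 0.
Proof.
exists (fun i : 'I_0 => 0); split=> [[]//|c _ []//|f kf].
by exists (fun=> 0); rewrite big_ord0; exact: dirichlet_kernel.
Qed.

(** The range is closed, and its complement is the kernel, which is trivial. *)
Lemma dirichlet_surjective g : L2 g -> exists u v, D (u, v) /\ eqae g v.
Proof.
move=> Lg.
have DE : D = adjoint D by rewrite (adjoint_dir q_meas q_bound).
have [u [v [Duv orth]]] := closed_range C0 linD (@bcop_in_L2 _) DE dirichlet_op_coercive Lg.
exists u, v; split=> //; have [Lu Lv _] := Duv.
have Lgv : L2 (g - v) by exact: (siB HS).
have Dgv : D (g - v, 0).
  rewrite DE; split=> //; first exact: (si0 HS).
  move=> u' v' Duv'; have [/= Lu' Lv' _] := Duv'.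
  by rewrite /= (ip_conj HS Lgv Lv') (orth _ _ Duv') conjc0 (ip0r HS).
have := coercive_kernel (@bcop_in_L2 _) dirichlet_op_coercive Dgv (eqae_refl 0).
by move=> /(eqae0P Lgv)/(eqaeP Lg Lv).
Qed.

(** Correct an arbitrary function with the given endpoint values by a function
    with zero endpoint values. *)
Lemma dirichlet_problem t : exists F F1 F2, [/\ h2rep F F1 F2, tr F = t &
  eqae (qmul q F - F2) 0].
Proof.
have [H [H1 [H2 [rH trH _]]]] := hermite t (fun=> 0).
have [LH _ LH2] := h2rep_L2 rH.
have [|u [v [Duv gv]]] := @dirichlet_surjective (qmul q H - H2).
  by apply: (siB HS) => //; exact: (L2_qmul q_meas q_bound).
have /bcop_rep[Lu Lv [U [U1 [U2 [rU uU vE trU]]]]] := Duv.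
exists ((-1) *: U + H), ((-1) *: U1 + H1), ((-1) *: U2 + H2); split.
- exact: h2rep_lin.
- by apply/funext => p; rewrite tr_lin trU mulr0 add0r trH.
- have -> : qmul q ((-1) *: U + H) - ((-1) *: U2 + H2) =
      (qmul q H - H2) - (qmul q U - U2).
    by rewrite qmul_lin !scaleN1r opprD opprK addrACA opprB [RHS]addrC [U2 - _]addrC.
  by have := eqaeB (eqae_trans gv vE) (eqae_refl (qmul q U - U2)); rewrite subrr.
Qed.

Lemma ker_maximal_rep k : ker T k -> exists F F1 F2, [/\ L2 k, h2rep F F1 F2, eqae k F,
  eqae (qmul q F - F2) 0 & bc_continuous (tr F) (dn F1)].
Proof.
move=> [g /bcop_rep[Lk Lg [F [F1 [F2 [rF kF gE BF]]]]] g0].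
exists F, F1, F2; split=> //; exact: eqae_trans (eqae_sym gE) g0.
Qed.

Hypothesis G_connected : connected_graph G.

(** In a connected graph with an edge, a vertex without edges would not be
    connected to the ends of that edge. *)
Lemma vertex_endpoint (x : vertex G) : exists p : endpoint G, location p = x.
Proof.
have /card_gt0P[e _] := edge_nonempty G.
have /connectP[[|y s]] := G_connected x (src e).
  by move=> _ /= <-; exists (e, false).
move=> /= /andP[/existsP[e' /orP[]/andP[/eqP h1 /eqP h2]] _] _.
  by exists (e', false).
by exists (e', true).
Qed.

(** The solutions of the Dirichlet problem for the indicator functions of the
    vertices form a basis: a function in the kernel is determined by its vertex values,
    since the Dirichlet operator has trivial kernel. *)
Lemma maximal_kernel_dim : has_dim (ker T) #|vertex G|.
Proof.
have [ep epP] := choice vertex_endpoint.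
pose t (i : 'I_#|vertex G|) : endpoint G -> R[i] := fun p => (location p == enum_val i)%:R.
have ex i : exists X : gfun G * gfun G * gfun G, [/\ h2rep X.1.1 X.1.2 X.2, tr X.1.1 = t i &
    eqae (qmul q X.1.1 - X.2) 0].
  by have [F [F1 [F2 ?]]] := dirichlet_problem (t i); exists (F, F1, F2).
have [X XP] := choice ex.
have rsum (c : 'I_#|vertex G| -> R[i]) : exists F1 F2,
    [/\ h2rep (\sum_i c i *: (X i).1.1) F1 F2 & eqae (qmul q (\sum_i c i *: (X i).1.1) - F2) 0].
  rewrite -![\sum_i _]big_enum; elim: (enum _) => [|i r [F1 [F2 [IH1 IH2]]]].
    exists 0, 0; rewrite big_nil; split; first exact: h2rep0.
    by rewrite subr0 => e; apply: aeW => x; rewrite /qmul mulr0.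
  have [rX _ X0] := XP i.
  exists (c i *: (X i).1.2 + F1), (c i *: (X i).2 + F2); rewrite big_cons; split.
    exact: h2rep_lin.
  have := eqae_lin (c i) X0 IH2.
  by rewrite qmul_lin scaler0 addr0 scalerBr opprD addrACA.
have trsum (c : 'I_#|vertex G| -> R[i]) i :
    tr (\sum_i c i *: (X i).1.1) (ep (enum_val i)) = c i.
  rewrite /tr fct_sumE fct_sumE (bigD1 i)//= big1 ?addr0 => [|j ji].
    have [_ tX _] := XP i; rewrite -[LHS]/(c i * tr (X i).1.1 (ep (enum_val i))) tX.
    by rewrite /t epP eqxx mulr1.
  have [_ tX _] := XP j; rewrite -[LHS]/(c j * tr (X j).1.1 (ep (enum_val i))) tX.
  by rewrite /t epP (inj_eq enum_val_inj) eq_sym (negPf ji) mulr0.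
exists (fun i => (X i).1.1); split.
- move=> i; have [rX tX X0] := XP i; exists (qmul q (X i).1.1 - (X i).2) => //.
  by apply: (h2rep_bcop q_meas q_bound rX); rewrite tX => p p'; rewrite /t => ->.
- move=> c c0 i; have [F1 [F2 [rF _]]] := rsum c.
  by rewrite -[LHS]trsum (tr_unique _ rF (@h2rep0 R G) c0).
move=> f /ker_maximal_rep[F [F1 [F2 [Lf rF fF F0 tc]]]].
pose c (i : 'I_#|vertex G|) := tr F (ep (enum_val i)); exists c.
have [H1 [H2 [rH H0]]] := rsum c; set H := \sum_i _ in rH H0 *.
apply: (eqae_trans fF).
have rFH := h2rep_lin (-1) rH rF.
have tFH : tr ((-1) *: H + F) = fun=> 0.
  apply/funext => p; rewrite tr_lin.
  have -> : tr H p = tr F p.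
    have [F1' [F2' [rF' _]]] := rsum c.
    have tX : tr H p = \sum_i c i * t i p.
      rewrite /tr /H fct_sumE fct_sumE; apply: eq_bigr => i _.
      by have [_ <- _] := XP i.
    rewrite tX (bigD1 (enum_rank (location p)))//= big1 => [|i ip].
      by rewrite /c /t enum_rankK eqxx mulr1 addr0; apply: tc; rewrite epP.
    rewrite /t; case: eqP => [E|]; last by rewrite mulr0.
    by rewrite E enum_valK eqxx in ip.
  by rewrite mulN1r addNr.
have Dk : D ((-1) *: H + F, qmul q ((-1) *: H + F) - ((-1) *: H2 + F2)).
  by apply: (h2rep_bcop q_meas q_bound rFH); rewrite tFH.
have v0 : eqae (qmul q ((-1) *: H + F) - ((-1) *: H2 + F2)) 0.
  have := eqae_lin (-1) H0 F0.
  by rewrite qmul_lin scaler0 addr0 scalerBr opprD addrACA.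
have := coercive_kernel (@bcop_in_L2 _) dirichlet_op_coercive Dk v0.
have [LH _ _] := h2rep_L2 rH; have [LF _ _] := h2rep_L2 rF.
rewrite scaleN1r addrC => /(eqae0P (siB HS LF LH)).
by move/(eqaeP LF LH).
Qed.

Hypothesis q_eq0 : forall e x, q e x = 0.

Lemma bc_standard_flux t d : bc_standard t d -> \sum_p d p * cj (t p) = 0.
Proof.
move=> [tc d0]; rewrite sum_location big1// => x _.
have [p0 lp0] := vertex_endpoint x.
rewrite (eq_bigr (fun p => d p * cj (t p0))) => [|p /eqP lp].
  by rewrite -mulr_suml d0 mul0r.
by rewrite (tc p p0)// lp lp0.
Qed.

(** Without potential a function in the kernel has zero energy, so it is constant on
    each edge, and by continuity and connectedness constant on the graph. *)
Lemma standard_kernel_dim : has_dim (ker St) 1.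
Proof.
have r1 : h2rep ((fun _ _ => 1) : gfun G) 0 0 by move=> e; split; exact: cac_cst.
have qm f : qmul q f = 0.
  by apply/funext => e; apply/funext => x; rewrite /qmul q_eq0 rmorph0 mul0r.
have /card_gt0P[e0 _] := edge_nonempty G.
exists (fun i _ _ => 1); split.
- move=> _; exists (qmul q ((fun _ _ => 1) : gfun G) - 0); last by rewrite qm subr0; exact: eqae_refl.
  apply: (h2rep_bcop q_meas q_bound r1); split=> // x; rewrite big1// => p _.
  by rewrite /dn /tr oppr0; case: p.2.
- move=> c; rewrite big_ord1 => c0 i; rewrite (ord1 i).
  have := tr_unique (e0, false) (h2rep_lin (c 0) r1 (@h2rep0 R G)) (@h2rep0 R G).
  by rewrite addr0 => /(_ c0); rewrite /tr -[LHS]/(c 0 * 1) mulr1.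
move=> f [g /bcop_rep[Lf Lg [F [F1 [F2 [rF fF gE [tc d0]]]]]] g0].
have [LF LF1 LF2] := h2rep_L2 rF.
have LE : L2 (qmul q F - F2) by apply: (siB HS) => //; exact: (L2_qmul q_meas q_bound).
have F10 : eqae F1 0.
  apply/(eqae0P LF1)/eqP; rewrite eq_le (sqn_ge0 HS)// andbT.
  apply: (le_trans (energy_ge q_meas q_bound q_ge0 rF _)).
    exact: bc_standard_flux.
  rewrite (ip_null_l HS)//; apply/(eqae0P LE).
  exact: eqae_trans (eqae_sym gE) g0.
have Fcst e x : 0 <= x <= len e -> F e x = F e 0.
  have [c1 _] := rF e => xl; have l0 := len_gt0 e.
  have : sqmod (F e x - F e 0) <= 0.
    have /andP[x0 xl'] := xl; apply: (le_trans (hoelder_edge c1 (lexx 0) x0 xl')).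
    rewrite subr0 mulr_ge0_le0//; apply: (le_trans (sqn_edge_le e LF1)).
    by rewrite ((eqae0P LF1).1 F10).
  by move=> h; apply/eqP; rewrite -subr_eq0; apply/eqP/sqmod_eq0/eqP; rewrite eq_le h sqmod_ge0.
have Fend e : tr F (e, true) = tr F (e, false).
  by rewrite /tr /coordinate /= Fcst// lexx ltW ?len_gt0.
have trcst p p' : tr F p = tr F p'.
  suff h x y : connect (@Defs.adjacent R G) x y -> forall p p' : endpoint G,
      location p = x -> location p' = y -> tr F p = tr F p'.
    exact: h (G_connected _ _) _ _ erefl erefl.
  move=> /connectP[s]; elim: s x => [|z s IH] x /=.
    by move=> _ -> r r' lr lr'; apply: tc; rewrite lr lr'.
  move=> /andP[/existsP[e /orP[]/andP[/eqP h1 /eqP h2]] ps] ls r r' lr lr'.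
    rewrite (tc r (e, false)) ?lr//= -Fend.
    exact: (IH z ps ls (e, true) r').
  rewrite (tc r (e, true)) ?lr//= Fend.
  exact: (IH z ps ls (e, false) r').
exists (fun=> tr F (e0, false)); rewrite big_ord1.
apply: (eqae_trans fF) => e; apply: aeW => x Ix.
rewrite -[RHS]/(tr F (e0, false) * 1) mulr1 (trcst _ (e, false)).
by apply: Fcst; move: Ix; rewrite /= in_itv/= => /andP[/ltW -> /ltW ->].
Qed.

End Kernels.


(** * Borel versions of potentials *)

Section BorelVersion.
Variable R : realType.
Local Notation mu := (@lebesgue_measure R).
Local Notation I l := (`]0, l[%classic : set R).

(** Each set where q exceeds a rational number is a Borel set up to a null set.
    Off a Borel null set Z containing these countably many exceptional sets, and the
    set where q is negative, q is a Borel function; put q' = 0 on Z. *)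
Lemma borel_version (l : R) (q : R -> R) :
  measurable_fun (`]0, l[%classic : set (g_sigma_algebraType (completed_algebra_gen mu))) q ->
  {ae mu, forall x, 0 < x < l -> 0 <= q x} ->
  exists q', [/\ measurable_fun (I l) q', ae_eq mu (I l) q q', forall x, 0 <= q' x &
    forall x, q' x = 0 \/ I l x /\ q' x = q x].
Proof.
move=> mq [Z0 [mZ0 Z00 subZ0]].
(* an enumeration of the rational numbers *)
pose s (n : nat) : R := ratr (odflt 0 (unpickle n)).
have mI : measurable (I l : set (measurableTypeR R)) by exact: measurable_itv.
have mIc : (completed_algebra_gen mu).-sigma.-measurable (I l).
  rewrite g_sigma_completed_algebra_genE.
  by exists (I l) => //; exists set0; [exact: negligible_set0|rewrite setU0].
have ex n : exists AN : set R * set R, [/\ measurable (AN.1 : set (measurableTypeR R)),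
    mu.-negligible AN.2 & AN.1 `|` AN.2 = I l `&` q @^-1` `]s n, +oo[].
  have := mq mIc `]s n, +oo[%classic (measurable_itv _).
  rewrite g_sigma_completed_algebra_genE.
  by move=> [A mA [N nN E]]; exists (A, N).
have [AN ANP] := choice ex.
have [Z1 [mZ1 Z10 subZ1]] : mu.-negligible (\bigcup_n (AN n).2).
  by apply: negligible_bigcup => n; have [] := ANP n.
pose Z := Z0 `|` Z1.
have mIZ : measurable (I l `\` Z : set (measurableTypeR R)).
  by apply: measurableD => //; exact: measurableU.
have key a : (I l `\` Z) `&` q @^-1` `]a, +oo[ =
    (I l `\` Z) `&` \bigcup_(n in [set n | a < s n]) (AN n).1.
  apply/seteqP; split=> x [[Ix nZ]] /=.
    rewrite in_itv/= andbT => /rat_in_itvoo[r /itvP rq]; split=> //.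
    have sr : s (pickle r) = ratr r by rewrite /s pickleK.
    exists (pickle r) => /=; first by rewrite sr rq.
    have [_ _ E] := ANP (pickle r).
    have : ((AN (pickle r)).1 `|` (AN (pickle r)).2) x.
      by rewrite E; split=> //; rewrite /= in_itv/= andbT sr rq.
    move=> [//|N]; exfalso; apply: nZ; right; apply: subZ1.
    by exists (pickle r).
  move=> [n /= an ANx]; split=> //; rewrite /= in_itv/= andbT.
  have [_ _ E] := ANP n.
  have : (I l `&` q @^-1` `]s n, +oo[) x by rewrite -E; left.
  by move=> [_] /=; rewrite in_itv/= andbT; exact: lt_trans.
have mqZ : measurable_fun (I l `\` Z : set (measurableTypeR R)) q.
  apply: (measurability _ (RGenOInfty.measurableE R)) => _ [_ [a ->] <-].
  rewrite key; apply: measurableI => //.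
  by apply: bigcup_measurable => n _; have [] := ANP n.
exists (q \_ (I l `\` Z)); split.
- apply: (@measurable_funS _ _ _ _ setT) => //.
  by apply/(measurable_restrictT _ mIZ).
- exists Z; split.
  + exact: measurableU.
  + by rewrite measureU0.
  + move=> x /= h; apply: contrapT => nZ; apply: h => Ix.
    by rewrite patchE mem_set.
- move=> x; rewrite patchE; case: ifPn => // /set_mem[Ix nZ].
  apply: contrapT => h; apply: nZ; left; apply: subZ0 => /= h'; apply: h; apply: h'.
  by move: Ix; rewrite /= in_itv.
- move=> x; rewrite patchE; case: ifPn => [/set_mem[Ix _]|_]; [by right|by left].
Qed.

End BorelVersion.

Section BorelPotential.
Variables (R : realType) (G : metric_graph R).
Local Notation mu := (@lebesgue_measure R).

Lemma schroedinger_ae (q q' : edge G -> R -> R) (P : set (gfun G)) :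
  (forall e, ae_eq mu (`]0, len e[%classic : set R) (q e) (q' e)) ->
  schroedinger q P = schroedinger q' P.
Proof.
move=> qq.
have sub (r r' : edge G -> R -> R) :
    (forall e, ae_eq mu (`]0, len e[%classic : set R) (r e) (r' e)) ->
    schroedinger r P `<=` schroedinger r' P.
  move=> rr [f g] [Pf Lg gE]; split=> //; apply: (eqae_trans gE) => e.
  move: (rr e); apply: ae_imp.
  by move=> x h Ix; rewrite h.
by apply/seteqP; split; apply: sub => // e; exact: ae_eq_sym.
Qed.

Lemma borel_potential (q : edge G -> R -> R) : measurable_potential q ->
  bounded_potential q -> nonnegative_potential q ->
  exists (q' : edge G -> R -> R) (M : R), [/\ forall e, measurable_fun (`]0, len e[%classic : set R) (q' e),
    forall e x, (`]0, len e[%classic : set R) x -> `|q' e x| <= M,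
    forall e x, (`]0, len e[%classic : set R) x -> 0 <= q' e x &
    forall P, schroedinger q P = schroedinger q' P].
Proof.
move=> mq [M qM] q0.
have [q' q'P] := choice (fun e => borel_version (mq e) (q0 e)).
exists q', M; split=> [e|e x Ix|e x _|P].
- by have [] := q'P e.
- have xl : 0 < x < len e by move: Ix; rewrite /= in_itv.
  have [_ _ _ /(_ x)[->|[_ ->]]] := q'P e; last exact: qM.
  by rewrite normr0 (le_trans _ (qM e x xl)).
- by have [_ _ ->] := q'P e.
- by apply: schroedinger_ae => e; have [] := q'P e.
Qed.

End BorelPotential.


(** * Comparison with the Krein-von Neumann extension *)

Section Comparison.
Variables (R : realType) (G : metric_graph R) (S : operator G) (C : R) (V : nat).
Implicit Types (f g h u v k : gfun G) (p : nat -> gfun G * R).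
Let HS := @semi_inner_inner R G.
Local Notation sqN := (sqn (@inner R G)).
Local Notation T := (adjoint S).
Local Notation K := (krein_von_neumann S).
Hypothesis S_linear : linear_operator S.
Hypothesis T_linear : linear_operator T.
Hypothesis S_closed : S = adjoint T.
Hypothesis S_sub_T : S `<=` T.
Hypothesis C_gt0 : 0 < C.
Hypothesis S_coercive : coercive S C.
Hypothesis T_compact : compact_domain T.
Hypothesis S_infinite : forall n, exists u v : 'I_n -> gfun G,
  (forall i, S (u i, v i)) /\ free_family u.
Hypothesis T_kernel : has_dim (ker T) V.

Let K_sa : self_adjoint K. Proof. exact: (krein_self_adjoint S_linear T_linear S_closed S_sub_T C_gt0). Qed.
Let K_linear : linear_operator K. Proof. by case: K_sa. Qed.
Let K_ge0 f g : K (f, g) -> 0 <= ReC (inner g f).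
Proof. exact: (krein_ge0 S_linear T_linear S_sub_T C_gt0). Qed.
Let K_compact : compact_domain K.
Proof. by apply: compact_domain_sub T_compact => fg []. Qed.

Lemma extension_infinite (A : operator G) n p :
  linear_operator A -> S `<=` A -> (forall i, (i < n)%N -> L2 (p i).1) ->
  exists v w, [/\ A (v, w), perp_family n p v & sqN v != 0].
Proof.
move=> linA SA Lp; have [u [v [uv free]]] := S_infinite n.+1.
have Auv i : A (u i, v i) by exact: SA.
have [c [pc c0]] := free_perp linA Auv free (ltnSn n) Lp.
by exists (\sum_i c i *: u i), (\sum_i c i *: v i); split=> //; exact: operator_sum.
Qed.

Lemma krein_kernel : ker K = ker T.
Proof.
apply/seteqP; split=> f.
  by move=> /(ker_krein S_linear T_linear) /(ker_T T_linear).
by move=> /(ker_T T_linear) /(ker_krein S_linear T_linear).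
Qed.

(** The list is nondecreasing and nonnegative, so its zeros come first, and their
    number is the dimension of the kernel. *)
Lemma krein_spectrum : exists p, [/\ forall n, eigenfamily K n p,
  eigenvalue_list setT K (fun n => (p n).2), forall n, 0 <= (p n).2 &
  forall n, (p n).2 = 0 <-> (n < V)%N].
Proof.
have [n p ep|p [ep p0 pmono pmin]] := exists_eigensequence K_sa K_compact K_ge0.
  apply: extension_infinite => //; first exact: S_sub_krein.
  by move=> i; exact: (eigenfamily_L2 K_sa ep).
have lp := sequence_list K_sa K_compact ep p0 pmono pmin.
exists p; split=> //.
have [_ _ /(_ 0 I)[n dn /card_II_seq[s [us ss sP]]]] := lp.
have {dn ss} sV : size s = V.
  rewrite ss; move: dn; rewrite (eigenspace0 K_linear) krein_kernel => dn.
  exact: has_dim_unique dn T_kernel.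
move=> m; split=> [m0|mV].
  have : (size (iota 0 m.+1) <= size s)%N.
    apply: uniq_leq_size; first exact: iota_uniq.
    move=> i; rewrite mem_iota add0n ltnS => /andP[_ im]; apply/sP.
    by apply/eqP; rewrite eq_le p0 -m0 pmono.
  by rewrite size_iota sV.
apply: contrapT => m0.
have : (size s <= size (iota 0 m))%N.
  apply: uniq_leq_size => // i /sP pi; rewrite mem_iota add0n /= ltnNge.
  apply/negP => mi; apply: m0; apply/eqP; rewrite eq_le p0 andbT -pi.
  exact: pmono.
by rewrite size_iota sV leqNgt mV.
Qed.

Lemma positive_list (a : nat -> R) : eigenvalue_list setT K a ->
  (forall n, 0 <= a n) -> (forall n, a n = 0 <-> (n < V)%N) ->
  eigenvalue_list [set x | 0 < x] K (fun n => a (n + V)%N).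
Proof.
move=> [amono _ ha] a0 aV; split.
- by move=> i j ij; apply: amono; rewrite leq_add2r.
- move=> j; rewrite /= lt_def a0 andbT; apply/eqP => /aV.
  by rewrite ltnNge leq_addl.
move=> mu /= mu0; have [n dn /card_II_seq[s [us ss sP]]] := ha mu I.
exists n => //; have sV j : j \in s -> (V <= j)%N.
  by move=> /sP aj; rewrite leqNgt; apply/negP => /aV aj0; move: mu0; rewrite -aj aj0 ltxx.
rewrite -ss -(size_map (subn^~ V)); apply: seq_card_II.
  rewrite map_inj_in_uniq// => i j /sV iV /sV jV /eqP.
  by rewrite -(eqn_add2r V) !subnK// => /eqP.
move=> j; split=> [aj|/mapP[i /[dup]/sV Vi /sP ai ->]]; last by rewrite /= subnK.
by apply/mapP; exists (j + V)%N; [apply/sP|rewrite addnK].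
Qed.

Section Extension.
Variable A : operator G.
Hypothesis A_sa : self_adjoint A.
Hypothesis S_sub_A : S `<=` A.
Let A_linear : linear_operator A. Proof. by case: A_sa. Qed.
Let AL : in_L2 A. Proof. by case: A_linear. Qed.

(** A self-adjoint extension of S is a restriction of the adjoint of S. *)
Lemma extension_compact : compact_domain A.
Proof.
apply: compact_domain_sub T_compact; case: A_sa => _ _ <- [f g] [Lf Lg h].
by split=> // u v /S_sub_A; exact: h.
Qed.

(** For Krein eigenfunctions f_i = u_i + k_i with eigenvalues nu_i, the space is
    spanned by the u_i and a basis of the kernel of A.  On it A v is a combination
    of the orthonormal f_i, which gives both independence and the estimate: the
    two sides are sum nu_i^2 |c_i|^2 and mu sum nu_i |c_i|^2. *)
Lemma comparison_space (p : nat -> gfun G * R) j d mu : (forall n, eigenfamily K n p) ->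
  (forall i, (i < j)%N -> 0 < (p (i + V)%N).2 <= mu) -> has_dim (ker A) d ->
  exists w z : 'I_(j + d) -> gfun G, [/\ forall i, A (w i, z i), free_family w &
    forall c, sqN (\sum_i c i *: z i) <=
      mu * ReC (inner (\sum_i c i *: z i) (\sum_i c i *: w i))].
Proof.
move=> ep pmu [b [kb bfree _]].
pose f (i : 'I_j) := (p (i + V)%N).1; pose nu (i : 'I_j) := (p (i + V)%N).2.
have Kf i : K (f i, (nu i)%:C *: f i) by have [h _] := ep (i + V).+1; exact: h.
have Lf i : L2 (f i) by case: K_linear => h _ _ _ _; have [] := h _ _ (Kf i).
have onf : orthonormal (@L2 R G) (@inner R G) f.
  split=> // i i'; have [_ h] := ep (maxn (i + V) (i' + V)).+1.
  by rewrite h ?ltnS ?leq_maxl ?leq_maxr// eqn_add2r.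
have ex i : exists uk : gfun G * gfun G,
    [/\ S (uk.1, (nu i)%:C *: f i), T (uk.2, 0) & eqae (f i) (uk.1 + uk.2)].
  have [u [k ?]] := krein_eigen S_linear T_linear S_sub_T (Kf i); by exists (u, k).
have [uk ukP] := choice ex.
have Ab i : A (b i, 0).
  have [g Abg g0] := kb i; have [Lb Lg] := AL Abg.
  case: A_linear => _ Aext _ _ _.
  by apply: (Aext _ _ _ _ Abg Lb (si0 HS)) => //; exact: eqae_refl.
pose w (i : 'I_(j + d)) := match fintype.split i with inl a => (uk a).1 | inr a => b a end.
pose z (i : 'I_(j + d)) := match fintype.split i with inl a => (nu a)%:C *: f a | inr a => 0 end.
have Swz a : S ((uk a).1, (nu a)%:C *: f a) by have [] := ukP a.
have Awz i : A (w i, z i).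
  by rewrite /w /z; case: (fintype.split i) => a //; exact: S_sub_A.
have sumz c : \sum_i c i *: z i = \sum_a (c (lshift d a) * (nu a)%:C) *: f a.
  rewrite big_split_ord/= [X in _ + X]big1 ?addr0 => [|a _].
    by apply: eq_bigr => a _; rewrite /z (unsplitK (inl a)) scalerA.
  by rewrite /z (unsplitK (inr a)) scaler0.
have sumw c : \sum_i c i *: w i = \sum_a c (lshift d a) *: (uk a).1 +
    \sum_a c (rshift j a) *: b a.
  rewrite big_split_ord/=; congr (_ + _); apply: eq_bigr => a _.
    by rewrite /w (unsplitK (inl a)).
  by rewrite /w (unsplitK (inr a)).
exists w, z; split=> //.
  move=> c c0; have [_ Aext A0 _ Afun] := A_linear.
  have Awzs := operator_sum A_linear c Awz; have [Lw Lz] := AL Awzs.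
  have z0 : eqae (\sum_i c i *: z i) 0.
    apply: (Afun 0) => //.
    by apply: (Aext _ _ _ _ Awzs (si0 HS) Lz c0); exact: eqae_refl.
  have cl a : c (lshift d a) = 0.
    have := orthonormal_free onf _ a; move: z0; rewrite sumz => z0 /(_ _ z0)/eqP.
    rewrite mulf_eq0 => /orP[/eqP//|].
    have /andP[+ _] := pmu a (ltn_ord a).
    by rewrite -(rmorph0 (real_complex R)) (inj_eq (@complexI R)) => /lt0r_neq0/negPf ->.
  have cr a : c (rshift j a) = 0.
    apply: (bfree (fun a => c (rshift j a))); move: c0; rewrite sumw big1 ?add0r// => i _.
    by rewrite cl scale0r.
  by move=> i; rewrite -(splitK i); case: (fintype.split i) => a /=.
move=> c; pose ca a := c (lshift d a).
set g := \sum_i c i *: z i.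
pose u := \sum_a ca a *: (uk a).1; pose k := \sum_a c (rshift j a) *: b a.
have gE : g = \sum_a (ca a * (nu a)%:C) *: f a by exact: sumz.
have Sug : S (u, g).
  have := operator_sum S_linear ca Swz; rewrite -/u gE.
  by under eq_bigr do rewrite scalerA.
have [SL _ _ _ _] := S_linear; have [TL _ _ _ _] := T_linear.
have [Lu Lg] := SL _ _ Sug.
have Ak : A (k, 0).
  have := operator_sum A_linear (fun a => c (rshift j a)) Ab.
  by rewrite [X in A (_, X)]big1// => a _; rewrite scaler0.
have [Lk _] := AL Ak.
rewrite sumw -/u -/k (ipDr HS)//.
rewrite (sa_symmetric A_sa (S_sub_A Sug) Ak) (ip0r HS)// addr0.
have ipgf a : inner g (uk a).1 = ca a * (nu a)%:C.
  have [_ Tk fE] := ukP a; have [Luk _] := SL _ _ (Swz a); have [Lka _] := TL _ _ Tk.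
  have -> : inner g (uk a).1 = inner g (f a).
    rewrite (inner_eqae_r Lg (Lf a) (siD HS Luk Lka) fE) (ipDr HS)//.
    by case: Tk => _ _ h; rewrite (h _ _ Sug) (ip0r HS)// addr0.
  by rewrite gE (orthonormal_comb HS _ a onf).
have -> : inner g u = \sum_a (nu a * sqmod (ca a))%:C.
  rewrite (ip_sumr HS)//; last first.
    by move=> a _; apply: (siZ HS); have [] := SL _ _ (Swz a).
  apply: eq_bigr => a _; rewrite (ipZr HS)//; last by have [] := SL _ _ (Swz a).
  by rewrite ipgf rmorphM /= -mul_cj; ring.
rewrite gE (sqn_orthonormal_comb HS _ onf) Re_sum mulr_sumr; apply: ler_sum => a _.
rewrite Re_real sqmodM sqmod_real.
have /andP[nu0 numu] := pmu a (ltn_ord a); rewrite -/(nu a) in nu0 numu.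
rewrite [leLHS](_ : _ = nu a * (nu a * sqmod (ca a))); last by ring.
by rewrite ler_wpM2r// mulr_ge0 ?sqmod_ge0 ?ltW.
Qed.

(** As long as m < N, some nonzero v in the given space is orthogonal to the m
    eigenfunctions found so far, and |(A - mu / 2) v| <= (mu / 2) |v|; so
    [minimal_eigenfunction] with s = mu / 2 gives a new eigenvalue lam with
    |lam - mu / 2| <= mu / 2. *)
Lemma extension_eigenfamily N (w z : 'I_N -> gfun G) mu : 0 <= mu ->
  (forall i, A (w i, z i)) -> free_family w ->
  (forall c, sqN (\sum_i c i *: z i) <=
      mu * ReC (inner (\sum_i c i *: z i) (\sum_i c i *: w i))) ->
  forall m, (m <= N)%N -> exists p, eigenfamily A m p /\
    forall i, (i < m)%N -> (p i).2 <= mu.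
Proof.
move=> mu0 Awz wfree le; elim=> [_|m IH mN].
  by exists (fun=> (0, 0)).
have [p [ep pmu]] := IH (ltnW mN).
have [c [pc c0]] := free_perp A_linear Awz wfree mN (fun i => eigenfamily_L2 A_sa ep (i := i)).
have Ac := operator_sum A_linear c Awz; have [Lw Lz] := AL Ac.
have [f [lam [Af f1 pf fmin]]] := minimal_eigenfunction A_sa extension_compact (mu / 2) ep Ac pc c0.
exists (family_rcons m p (f, lam)); split; first exact: eigenfamily_rcons.
move=> i; rewrite ltnS leq_eqVlt /family_rcons => /predU1P[->|im]; last first.
  by rewrite ltn_eqF//; exact: pmu.
rewrite eqxx /=.
have := fmin _ _ Ac pc; have := le c.
set g := \sum_i _ *: z _ in Lz *; set v := \sum_i _ in Lw c0 *.
rewrite (sqnB HS) ?(sqnZ HS) ?sqmod_real ?(ipZr HS)// ?cj_real; last exact: (siZ HS).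
rewrite mulrC cReM Re_real Im_real mul0r subr0.
have v0 : 0 < sqN v by rewrite lt_def c0 (sqn_ge0 HS).
move: (sqN v) (sqN g) (ReC _) v0 => X Y Z X0 YZ h.
have : (lam - mu / 2) ^+ 2 * X <= (mu / 2) ^+ 2 * X by lra.
rewrite ler_pM2r// => {}h.
have : `|lam - mu / 2| <= mu / 2.
  rewrite -ler_sqr ?nnegrE ?normr_ge0//; last by lra.
  by rewrite real_normK ?num_real.
by move=> /ler_normlP[]; lra.
Qed.

End Extension.

Theorem krein_comparison : (forall j : nat, (1 <= j)%N ->
    lambda_pos j K = lambda (j + V) K) /\
  forall A, self_adjoint A -> S `<=` A -> forall j : nat, (1 <= j)%N ->
    lambda (j + dimension (ker A)) A <= lambda_pos j K.
Proof.
have [p [ep lp p0 pV]] := krein_spectrum.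
have lpos := positive_list lp p0 pV.
split=> [[//|j] _|A A_sa SA [//|j] _].
  by rewrite (lambda_posE _ lpos) (lambdaE _ lp).
rewrite (lambda_posE _ lpos) /=; set mu := (p (j + V)%N).2.
have [[a la]|none] := pselect (exists a, eigenvalue_list setT A a); last first.
  (* without a list of all eigenvalues, lambda has the default value 0 *)
  rewrite /lambda xgetPN => [|a la]; first exact: p0.
  by apply: none; exists a.
have linA : linear_operator A by case: A_sa.
have [_ _ /(_ 0 I)[d dn _]] := la.
rewrite (eigenspace0 linA) in dn; rewrite (dimensionE dn) (lambdaE _ la) addSn /=.
have [pmono _ _] := lp.
have pmu i : (i < j.+1)%N -> 0 < (p (i + V)%N).2 <= mu.
  move=> ij; apply/andP; split; last by apply: pmono; rewrite leq_add2r.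
  by have [_ + _] := lpos; exact.
have [w [z [Awz wfree le]]] := comparison_space A_sa SA ep pmu dn.
have [r [er rmu]] := extension_eigenfamily A_sa SA (p0 _) Awz wfree le (leqnn _).
exact: list_le linA la er rmu.
Qed.

End Comparison.


(** * The perturbed Krein Laplacian of a metric graph *)

Section Potentials.
Variables (R : realType) (G : metric_graph R) (q : edge G -> R -> R).
Hypothesis G_connected : connected_graph G.
Hypothesis q_measurable : measurable_potential q.
Hypothesis q_bounded : bounded_potential q.
Hypothesis q_ge0 : nonnegative_potential q.
Local Notation S := (minimal_operator q).
Local Notation K := (krein_laplacian q).

Lemma krein_laplacian_comparison : (forall j : nat, (1 <= j)%N ->
    lambda_pos j K = lambda (j + #|vertex G|) K) /\
  forall A, self_adjoint A -> S `<=` A -> forall j : nat, (1 <= j)%N ->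
    lambda (j + dimension (ker A)) A <= lambda_pos j K.
Proof.
have [q' [M [mq qM q0 qE]]] := borel_potential q_measurable q_bounded q_ge0.
rewrite /krein_laplacian /minimal_operator qE -/(minimal_operator q') minimal_bcop.
have adjS := adjoint_min mq qM; have adjT := adjoint_continuous mq qM.
apply: (@krein_comparison _ _ _ (poincare_constant G)); rewrite ?adjS ?adjT//.
- exact: (bcop_linear mq qM (linear_min G)).
- exact: (bcop_linear mq qM (linear_continuous G)).
- exact: (bcop_mono (@min_sub_continuous R G)).
- exact: poincare_constant_gt0.
- exact: (minimal_op_coercive mq qM q0).
- exact: (bcop_compact mq qM).
- exact: (minimal_infinite mq qM).
- exact: (maximal_kernel_dim mq qM q0).
Qed.

Lemma dirichlet_extension_trivial_kernel : [/\ self_adjoint (dirichlet_laplacian q),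
  S `<=` dirichlet_laplacian q & dimension (ker (dirichlet_laplacian q)) = 0%N].
Proof.
have [q' [M [mq qM q0 qE]]] := borel_potential q_measurable q_bounded q_ge0.
rewrite /dirichlet_laplacian /minimal_operator !qE.
rewrite -/(minimal_operator q') -/(dirichlet_laplacian q') minimal_bcop dirichlet_bcop.
split; first exact: (dirichlet_self_adjoint mq qM).
  exact: (bcop_mono (@min_sub_dir R G)).
apply: dimensionE; exact: (dirichlet_kernel_dim mq qM q0).
Qed.

End Potentials.

Section ZeroPotential.
Variables (R : realType) (G : metric_graph R).
Hypothesis G_connected : connected_graph G.
Let q0 : edge G -> R -> R := zero_potential G.

Lemma zero_potential_admissible : [/\ measurable_potential q0, bounded_potential q0 &
  nonnegative_potential q0].
Proof.
split.
- by move=> e; exact: measurable_cst.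
- by exists 0 => e x _; rewrite normr0.
- by move=> e; apply: aeW => x _.
Qed.

Lemma standard_extension_simple_kernel : [/\ self_adjoint (standard_laplacian q0),
  minimal_operator q0 `<=` standard_laplacian q0 &
  dimension (ker (standard_laplacian q0)) = 1%N].
Proof.
have mq e : measurable_fun (`]0, len e[%classic : set R) (q0 e) by exact: measurable_cst.
have qM e x : (`]0, len e[%classic : set R) x -> `|q0 e x| <= 0 by rewrite normr0.
rewrite minimal_bcop standard_bcop.
split; first exact: (standard_self_adjoint mq qM).
  exact: (bcop_mono (@min_sub_standard R G)).
by apply: dimensionE; apply: (standard_kernel_dim mq qM).
Qed.

End ZeroPotential.

Theorem theorem3p12 (R : realType) (G : metric_graph R)
    (q : edge G -> R -> R)
    (G_connected : connected_graph G)
    (q_measurable : measurable_potential q)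
    (q_bounded : bounded_potential q)
    (q_ge0 : nonnegative_potential q) :
  [/\ forall A : operator G, self_adjoint A -> minimal_operator q `<=` A ->
        forall j : nat, (1 <= j)%N ->
          lambda (j + dimension (ker A)) A
            <= lambda_pos j (krein_laplacian q)
          /\ lambda_pos j (krein_laplacian q)
            = lambda (j + #|vertex G|) (krein_laplacian q),
      forall j : nat, (1 <= j)%N ->
        lambda j (dirichlet_laplacian q)
          <= lambda_pos j (krein_laplacian q)
        /\ lambda_pos j (krein_laplacian q)
          = lambda (j + #|vertex G|) (krein_laplacian q) &
      forall j : nat, (1 <= j)%N ->
        lambda (j + 1) (standard_laplacian (zero_potential G))
          <= lambda_pos j (krein_laplacian (zero_potential G))
        /\ lambda_pos j (krein_laplacian (zero_potential G))
          = lambda (j + #|vertex G|) (krein_laplacian (zero_potential G))].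
Proof.
split.
- move=> A A_sa SA j j1.
  have [eqK leK] := krein_laplacian_comparison G_connected q_measurable q_bounded q_ge0.
  by split; [exact: leK|exact: eqK].
- move=> j j1.
  have [eqK leK] := krein_laplacian_comparison G_connected q_measurable q_bounded q_ge0.
  have [D_sa SD kerD] := dirichlet_extension_trivial_kernel q_measurable q_bounded q_ge0.
  by have := leK _ D_sa SD j j1; rewrite kerD addn0; split; [|exact: eqK].
- move=> j j1; have [m0 b0 n0] := zero_potential_admissible G.
  have [eqK leK] := krein_laplacian_comparison G_connected m0 b0 n0.
  have [St_sa SSt kerSt] := standard_extension_simple_kernel G_connected.
  by have := leK _ St_sa SSt j j1; rewrite kerSt; split; [|exact: eqK].
Qed.
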